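(* Let $L_1,L_2,L_3>0$ and $\Omega=(0,L_1)\times(0,L_2)\times(0,L_3)$. The set $$\mathcal C:=\left\{Y^{j(n),n}\ \middle|\ n\in\mathbb N^3,\ 0\le n_i\le 3\ (i=1,2,3),\ \#_0(n)\le 1,\ j(n)\in\{1,2-\#_0(n)\}\right\}$$ of eigenfunctions of the Stokes operator $A$ under Lions boundary conditions is $(\mathtt L,D(A))$-saturating.
   Context: Here $\mathbb N=\{0,1,2,\dots\}$ contains $0$. Function spaces and operators. $\Omega=(0,L_1)\times(0,L_2)\times(0,L_3)\subset\mathbb R^3$, with outward unit normal $\mathbf n$ on $\partial\Omega$; $\nu>0$ is fixed. $H:=\{u\in L^2(\Omega,\mathbb R^3)\mid \operatorname{div}u=0,\ (u\cdot\mathbf n)|_{\partial\Omega}=0\}$ with the $L^2$ norm, taken as pivot space ($H=H'$); $V:=H\cap H^1(\Omega,\mathbb R^3)$; $D(A):=\{u\in H\cap H^2(\Omega,\mathbb R^3)\mid (\operatorname{curl}u-((\operatorname{curl}u)\cdot\mathbf n)\mathbf n)|_{\partial\Omega}=0\}$. $A\colon V\to V'$ is given by $\langle Au,v\rangle_{V',V}:=\nu(\operatorname{curl}u,\operatorname{curl}v)_{L^2(\Omega,\mathbb R^3)}$. $B\colon V\times V\to V'$ is given by $\langle B(u,v),w\rangle_{V',V}:=-\int_\Omega(\langle u\cdot\nabla\rangle w)\cdot v\,d\Omega$, where $\langle u\cdot\nabla\rangle w=(u\cdot\nabla w_1,u\cdot\nabla w_2,u\cdot\nabla w_3)$; for $u,v\in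 D(A)$, $B(u,v)=\Pi(\langle u\cdot\nabla\rangle v)$ with $\Pi$ the orthogonal projection of $L^2(\Omega,\mathbb R^3)$ onto $H$. Set $\mathcal B(a,b):=B(a,b)+B(b,a)$. Eigenfunctions. For $k\in\mathbb N^3$, $\#_0(k)$ is the number of vanishing components of $k$. For $z,k\in\mathbb R^3$ put $(z,k)_{[L]}:=\frac{z_1k_1}{L_1}+\frac{z_2k_2}{L_2}+\frac{z_3k_3}{L_3}$, and $$\{k\}_0^{\perp_{[L]}}:=\{z\in\mathbb R^3\setminus\{(0,0,0)\}\mid (z,k)_{[L]}=0,\text{ and } z_i=0 \text{ if } k_i=0\}.$$ For each $k\in\mathbb N^3$ with $\#_0(k)\le1$ fix a linearly independent and orthogonal family $\{w^{j(k),k}\mid j(k)\in\{1,2-\#_0(k)\}\}\subset\{k\}_0^{\perp_{[L]}}$ (two vectors if $\#_0(k)=0$, one vector if $\#_0(k)=1$), and set $$Y^{j(k),k}:=\begin{pmatrix} w_1^{j(k),k}\sin(\frac{k_1\pi x_1}{L_1})\cos(\frac{k_2\pi x_2}{L_2})\cos(\frac{k_3\pi x_3}{L_3})\\ w_2^{j(k),k}\cos(\frac{k_1\pi x_1}{L_1})\sin(\frac{k_2\pi x_2}{L_2})\cos(\frac{k_3\pi x_3}{L_3})\\ w_3^{j(k),k}\cos(\frac{k_1\pi x_1}{L_1})\cos(\frac{k_2\pi x_2}{L_2})\sin(\frac{k_3\pi x_3}{L_3})\end{pmatrix}.$$ The functions $Y^{j(k),k}$, $k\in\mathbb N^3$,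 $\#_0(k)\le 1$, form a complete system of eigenfunctions of $A$ in $H$. Saturating sets. Let $\mathcal C\subset D(A)$ be finite. For a finite-dimensional space $E$ with $\mathcal C\subset E\subset D(A)$ put $$\mathcal F_{\mathtt L}(E):=E+\Big(\operatorname{span}\{\mathcal B(a,b)\mid a\in\mathcal C,\ b\in E,\ (B(a,a),B(b,b))\in H\times H\}\cap D(A)\Big).$$ Define $\mathcal G^0:=\operatorname{span}\mathcal C$ and $\mathcal G^{j+1}:=\mathcal F_{\mathtt L}(\mathcal G^j)$ for $j\ge0$. The set $\mathcal C$ is called $(\mathtt L,D(A))$-saturating if $\bigcup_{j\in\mathbb N}\mathcal G^j$ is dense in $H$. *)

(* Defs.v *)
From mathcomp Require Import all_boot all_order all_algebra.
From mathcomp Require Import all_classical all_reals all_analysis.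

Set Implicit Arguments.
Unset Strict Implicit.
Unset Printing Implicit Defensive.

Import Order.TTheory GRing.Theory Num.Theory.
Import numFieldNormedType.Exports.

Local Open Scope classical_set_scope.
Local Open Scope ring_scope.

Section Euclidean.
Context {R : realType}.

Definition xcoord (i : 'I_3) (x : R * R * R) : R := [:: x.1.1; x.1.2; x.2]`_i.

Definition basis_vec (i : 'I_3) : R * R * R :=
  ((i == 0)%:R, (i == 1)%:R, (i == 2)%:R).

Definition dot (a b : 'rV[R]_3) : R := \sum_i a 0 i * b 0 i.

Definition volume : {measure set (measurableTypeR R * measurableTypeR R
                                  * measurableTypeR R)%type -> \bar R} :=
  (@lebesgue_measure R \x @lebesgue_measure R \x @lebesgue_measure R)%E.

Definition area : {measure set (measurableTypeR R * measurableTypeR R)%type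
                   -> \bar R} :=
  (@lebesgue_measure R \x @lebesgue_measure R)%E.

Definition linspan (V : lmodType R) (S : set V) : set V :=
  [set v | exists n (c : 'I_n -> R) (s : 'I_n -> V),
     (forall i, S (s i)) /\ v = \sum_(i < n) c i *: s i].

(* C^oo(R^3): all iterated partial derivatives exist and are continuous. *)
Definition smooth (f : R * R * R -> R) : Prop :=
  forall s : seq 'I_3,
    let g := foldr (fun i h => 'D_(basis_vec i) h) f s in
    continuous g /\ forall x i, derivable g x (basis_vec i).

End Euclidean.

(* An L^2 class is represented by any function on R^3 whose restriction to the
   box belongs to it; values outside of the box are irrelevant. *)
Notation field R := (R * R * R -> 'rV[R]_3).
(* Elements of V' are represented by functions of which only the values on V
   matter: they are compared with eq_on_V below. *)
Notation functional R := (field R -> R).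

Section Box.
Context {R : realType} (L : 'I_3 -> R).
Implicit Types (i j : 'I_3) (f g : R * R * R -> R) (u v w : field R).

Definition box : set (R * R * R) := [set x | forall i, 0 < xcoord i x < L i].

Definition component u j : R * R * R -> R := fun x => u x 0 j.

Definition L2 f : Prop :=
  measurable_fun box f /\ (\int[volume]_(x in box) (f x ^+ 2)%:E < +oo)%E.

Definition L2v u : Prop := forall j, L2 (component u j).

Definition inner u v : R := \int[volume]_(x in box) dot (u x) (v x).

Definition L2norm u : \bar R :=
  sqrte (\int[volume]_(x in box) (dot (u x) (u x))%:E)%E.

Definition test_fun (phi : R * R * R -> R) : Prop :=
  smooth phi /\ exists K : set (R * R * R),
    [/\ compact K, K `<=` box & forall x, ~ K x -> phi x = 0].

Definition is_wpartial i f g : Prop :=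
  L2 g /\ forall phi, test_fun phi ->
    \int[volume]_(x in box) (f x * 'D_(basis_vec i) phi x) =
    - \int[volume]_(x in box) (g x * phi x).

(* A representative of the weak derivative if there is one in L^2, else 0. *)
Definition wpartial i f : R * R * R -> R :=
  xget (cst 0) [set g | is_wpartial i f g].

Definition H1 f : Prop := L2 f /\ forall i, exists g, is_wpartial i f g.

Definition H2 f : Prop := H1 f /\ forall i, H1 (wpartial i f).

Definition H1v u : Prop := forall j, H1 (component u j).

Definition H2v u : Prop := forall j, H2 (component u j).

(* Indices are added in Z/3, which is the cyclic rule for the curl. *)
Definition curl u : field R := fun x => \row_(i < 3)
  (wpartial (i + 1) (component u (i + 2)) x
   - wpartial (i + 2) (component u (i + 1)) x).

(* div u = 0 in the sense of distributions *)
Definition div_free u : Prop := forall phi, test_fun phi ->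
  \int[volume]_(x in box) (\sum_i component u i x * 'D_(basis_vec i) phi x) = 0.

(* For u in L^2 with div u in L^2, the normal trace is the functional
   phi |-> \int (u . grad phi + (div u) phi), for phi smooth up to the boundary;
   here div u = 0. *)
Definition normal_trace0 u : Prop := forall phi, smooth phi ->
  \int[volume]_(x in box) (\sum_i component u i x * 'D_(basis_vec i) phi x) = 0.

Definition H u : Prop := [/\ L2v u, div_free u & normal_trace0 u].

Definition V u : Prop := H u /\ H1v u.

(* The point of the plane x_i = c whose other two coordinates are, in order,
   those of y. *)
Definition face_pt i (c : R) (y : R * R) : R * R * R :=
  if i == 0 then (c, y.1, y.2)
  else if i == 1 then (y.1, c, y.2) else (y.1, y.2, c).

Definition face_dom i : set (R * R) :=
  [set y | forall j, j != i -> 0 < xcoord j (face_pt i 0 y) < L j].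

(* The face x_i = L_i if b, x_i = 0 otherwise, and its outward normal. *)
Definition face_pos i (b : bool) : R := if b then L i else 0.
Definition face_normal i (b : bool) : 'rV[R]_3 :=
  (if b then 1 else -1) *: delta_mx 0 i.

(* The trace operator H^1 -> L^2(face) is the continuous extension of the
   restriction of smooth functions: g is the trace of f iff some smooth phi_n
   tend to f in H^1 while their restrictions tend to g in L^2(face). *)
Definition is_trace i (b : bool) f (g : R * R -> R) : Prop :=
  [/\ H1 f, measurable_fun (face_dom i) g &
   exists phi : nat -> R * R * R -> R,
    [/\ forall n, smooth (phi n),
     (\int[volume]_(x in box) ((phi n x - f x) ^+ 2)%:E)%E
        @[n --> \oo] --> 0%E,
     forall j, (\int[volume]_(x in box)
        (('D_(basis_vec j) (phi n) x - wpartial j f x) ^+ 2)%:E)%E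
        @[n --> \oo] --> 0%E &
     (\int[area]_(y in face_dom i)
        ((phi n (face_pt i (face_pos i b) y) - g y) ^+ 2)%:E)%E
        @[n --> \oo] --> 0%E]].

(* om - (om . n) n vanishes on the boundary *)
Definition tangential_trace0 (om : field R) : Prop :=
  forall i (b : bool), exists g : R * R -> 'rV[R]_3,
    (forall j, is_trace i b (component om j) (fun y => g y 0 j)) /\
    {ae area, forall y, face_dom i y ->
       g y - dot (g y) (face_normal i b) *: face_normal i b = 0}.

Definition DA u : Prop := [/\ H u, H2v u & tangential_trace0 (curl u)].

Definition eq_on_V (l l' : functional R) : Prop := forall w, V w -> l w = l' w.

Definition stokes (nu : R) u : functional R :=
  fun w => nu * inner (curl u) (curl w).

Definition B u v : functional R := fun w =>
  - \int[volume]_(x in box)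
      \sum_j (\sum_i component u i x * wpartial i (component w j) x) * component v j x.

Definition symB a b : functional R := B a b + B b a.

(* h : field is identified with the functional inner h (pivot space H). *)
Definition in_H (l : functional R) : Prop :=
  exists2 h, H h & eq_on_V l (inner h).

Definition FL (C E : set (field R)) : set (field R) :=
  [set u | exists (e g : field R), [/\ E e, DA g, u = e + g &
     exists2 l : functional R,
       linspan [set l' | exists a b : field R,
         [/\ C a, E b, in_H (B a a), in_H (B b b) & l' = symB a b]] l &
       eq_on_V l (inner g)]].

Definition G (C : set (field R)) (j : nat) : set (field R) :=
  iter j (FL C) (linspan C).

Definition dense_in_H (S : set (field R)) : Prop :=
  forall u, H u -> forall eps : R, 0 < eps ->
    exists2 v, S v & (L2norm (u - v)%R < eps%:E)%E.

Definition saturating (C : set (field R)) : Prop :=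
  [/\ finite_set C, C `<=` DA & dense_in_H (\bigcup_j G C j)].

Definition eigenfunction (nu : R) u : Prop :=
  [/\ DA u, L2norm u != 0%E &
   exists lam : R, eq_on_V (stokes nu u) (lam *: inner u)].

Definition nzeros (k : 'I_3 -> nat) : nat := #|[pred i | k i == 0%N]|.

Definition perp (k : 'I_3 -> nat) : set 'rV[R]_3 :=
  [set z | [/\ z != 0, \sum_i z 0 i * (k i)%:R / L i = 0 &
            forall i, k i = 0%N -> z 0 i = 0]].

(* The values of j(k): 1 and 2 if nzeros k = 0, only 1 if nzeros k = 1. *)
Definition js (k : 'I_3 -> nat) : seq nat := undup [:: 1; 2 - nzeros k]%N.

Definition admissible (wf : nat -> ('I_3 -> nat) -> 'rV[R]_3) : Prop :=
  forall k, (nzeros k <= 1)%N ->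
  [/\ forall m, m \in js k -> perp k (wf m k),
      free [seq wf m k | m <- js k] &
      forall m m', m \in js k -> m' \in js k -> m != m' ->
        dot (wf m k) (wf m' k) = 0].

Definition Y (wf : nat -> ('I_3 -> nat) -> 'rV[R]_3)
    (m : nat) (k : 'I_3 -> nat) : field R :=
  fun x => \row_(i < 3) (wf m k 0 i * \prod_(l < 3)
    (if l == i then sin else cos) ((k l)%:R * pi * xcoord l x / L l)).

Definition Cset (wf : nat -> ('I_3 -> nat) -> 'rV[R]_3) : set (field R) :=
  [set y | exists (n : 'I_3 -> nat) (m : nat),
     [/\ forall i, (n i <= 3)%N, (nzeros n <= 1)%N, m \in js n & y = Y wf m n]].

End Box.

(* Main.v *)
(* With K = (k_l pi / L_l)_l, let the mode (v, k) be the field whose i-th component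
   is v_i times sin (K_i x_i) times the cosines of the two other K_l x_l; the fields
   Y are modes. It is divergence free iff v . K = 0, and it satisfies all the
   boundary conditions in the classical sense.

   The symmetrised product of two divergence free modes (w, k) and (z, m) is, up to
   a gradient, 1/8 of the sum over the sign vectors t of the modes with wave vectors
   k + t m and amplitudes (w . tM) tz + (tz . K) w. By induction on |n|^2, all the
   divergence free modes of wave vector n >= 0 lie in the spaces G^j: one takes
   n = k + m with 0 <= m <= n and m <= 3, so that the wave vectors k + t m other than
   n are shorter, up to signs. If n_a >= 4 and n_b >= 2, then m = (1, 1, 0), or
   (2, 1, 0) if n_a = n_b, reaches all the amplitudes orthogonal to n. For
   n = (N, 1, p) with p = 1, 2 one needs both m = (1, 0, p) and m = (2, 0, p). Finally
   (N, 1, 0) = (N-1, 1, -1) + (1, 0, 1), where the only long wave vector besides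
   (N, 1, 0) is (N, 1, -2), which the previous case covers.

   For the density in H, each component of u in H is approximated in L^2 by the
   products of sines and cosines of its own parity. The resulting sum of modes is
   the sum of divergence free modes and of gradients; as gradients are orthogonal to
   H, dropping them only brings the sum closer to u. *)

(* Two obstacles shape the construction. When some [k_i] or [m_i] vanishes, several sign vectors [t]
   lead to [n] up to signs, and their contributions must be seen to agree. They do if [z_i = 0]
   where [m_i = 0], and [w_i = 0] where [k_i = 0] but [m_i] does not vanish. These entries do not
   affect the modes, but fixing them costs a dimension: for [n = (N, 1, p)] and [m = (s, 0, p)] both
   [w] and [z] are determined up to a factor, so that each [m] yields a single amplitude.

   The side lengths are arbitrary, so no step may depend on an accidental relation between them. The
   amplitudes therefore carry factors [L_i] that cancel those of the wave vectors, the inequality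
   between the lengths of [m] and [k] is obtained coordinate by coordinate, and the remaining
   determinants are sums of terms of one sign.

   Fields in V only have weak derivatives, and pairings with them are computed by parts. No trace
   theorem is used: the smooth factor vanishes linearly at the faces, which compensates the
   derivative of a cut-off. *)
From HB Require Import structures.
Require Import Defs.
From mathcomp Require Import all_boot all_order all_algebra.
From mathcomp Require Import all_classical all_reals all_analysis.
From mathcomp Require Import measurable_realfun.
From mathcomp Require Import ring lra zify.

Set Implicit Arguments.
Unset Strict Implicit.
Unset Printing Implicit Defensive.

Import Order.TTheory GRing.Theory Num.Theory.
Import numFieldNormedType.Exports.

Local Open Scope classical_set_scope.
Local Open Scope ring_scope.

(** * Smooth functions *)

Section Smooth.
Context {R : realType}.
Implicit Types (f g : R * R * R -> R) (i j : 'I_3) (h : R -> R).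

Lemma ord3P (P : 'I_3 -> Prop) : P 0 -> P 1 -> P 2 -> forall i, P i.
Proof.
move=> P0 P1 P2 [[|[|[|//]]]] lti; [rewrite (_ : Ordinal _ = 0)|
  rewrite (_ : Ordinal _ = 1)|rewrite (_ : Ordinal _ = 2)] => //; exact: val_inj.
Qed.

Lemma ord3_cases i : 0 = i \/ 1 = i \/ 2 = i.
Proof. by move: i; apply: ord3P; auto. Qed.

Lemma point_ext (x y : R * R * R) :
  (forall i, xcoord i x = xcoord i y) -> x = y.
Proof.
move: x y => [[a b] c] [[a' b'] c'] xy.
by move: (xy 0) (xy 1) (xy 2); rewrite /xcoord /= => -> -> ->.
Qed.

Lemma xcoord_line i j t (x : R * R * R) :
  xcoord i (t *: basis_vec j + x) = (i == j)%:R * t + xcoord i x.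
Proof.
move: i; apply: ord3P; move: j; apply: ord3P;
  rewrite /xcoord /basis_vec /= ?scaler0 ?mul0r ?mul1r //;
  by rewrite -[X in X + _ = _]/(t * 1) mulr1.
Qed.

Lemma continuous_xcoord i : continuous (@xcoord R i).
Proof.
move: i; apply: ord3P => x; rewrite /xcoord /=.
- by apply: (@cvg_comp _ _ _ fst fst); exact: cvg_fst.
- by apply: (@cvg_comp _ _ _ fst snd); [exact: cvg_fst|exact: cvg_snd].
- exact: cvg_snd.
Qed.

Lemma smooth_continuous f : smooth f -> continuous f.
Proof. by move=> /(_ [::]) []. Qed.

Lemma smooth_derivable f x i : smooth f -> derivable f x (basis_vec i).
Proof. by move=> /(_ [::]) []. Qed.

Lemma smooth_derive f i : smooth f -> smooth ('D_(basis_vec i) f).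
Proof. by move=> sf s; have := sf (rcons s i); rewrite foldr_rcons. Qed.

(** Smoothness is proved below by naming a class of functions that contains all the iterated
    derivatives; the induction over the sequence of directions is done once, here. *)
Lemma smooth_coind (P : (R * R * R -> R) -> Prop) :
  (forall f, P f -> continuous f /\ forall x i, derivable f x (basis_vec i)) ->
  (forall f i, P f -> P ('D_(basis_vec i) f)) ->
  forall f, P f -> smooth f.
Proof.
move=> Pcd PD f Pf s /=; apply: Pcd; elim: s => //= i s; exact: PD.
Qed.

#[local] Opaque smooth.

Lemma derive_funE f g i : (forall x, is_derive x (basis_vec i) f (g x)) ->
  'D_(basis_vec i) f = g.
Proof. by move=> fg; apply/funext => x; have [_ ->] := fg x. Qed.

Lemma smooth_cst (c : R) : smooth (cst c : R * R * R -> R).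
Proof.
pose P (f : R * R * R -> R) := exists c, f = cst c.
apply: (@smooth_coind P); last by exists c.
- by move=> _ [{}c ->]; split=> [|x i]; [exact: cst_continuous|exact: derivable_cst].
- by move=> _ i [{}c ->]; exists 0; apply: derive_funE => x; exact: is_derive_cst.
Qed.

Lemma smoothD f g : smooth f -> smooth g -> smooth (f \+ g).
Proof.
move=> sf sg.
pose P k := exists f g : R * R * R -> R, [/\ smooth f, smooth g & k = f \+ g].
apply: (@smooth_coind P); last by exists f, g.
- move=> _ [{sf} {}f [{sg} {}g [sf sg ->]]]; split=> [x|x i].
    by apply: cvgD; exact: smooth_continuous.
  by apply: derivableD; exact: smooth_derivable.
- move=> _ i [{sf} {}f [{sg} {}g [sf sg ->]]].
  exists ('D_(basis_vec i) f), ('D_(basis_vec i) g); split; try exact: smooth_derive.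
  apply: derive_funE => x; apply: is_deriveD;
    by apply: derivableP; exact: smooth_derivable.
Qed.

(** Products of smooth functions are not stable under differentiation, but their finite sums are,
    which is what [smooth_coind] asks for in [smoothM]. *)
Inductive prod_closure : (R * R * R -> R) -> Prop :=
| prod_closure_mul f g : smooth f -> smooth g -> prod_closure (f \* g)
| prod_closure_add f g : prod_closure f -> prod_closure g ->
    prod_closure (f \+ g).

Lemma prod_closure_cd f : prod_closure f ->
  continuous f /\ forall x i, derivable f x (basis_vec i).
Proof.
elim=> {f} [f g sf sg|f g _ [cf df] _ [cg dg]]; split=> [x|x i].
- by apply: cvgM; exact: smooth_continuous.
- by apply: derivableM; exact: smooth_derivable.
- by apply: cvgD; [exact: cf|exact: cg].
- exact: derivableD.
Qed.

Lemma derive_mulE f g i : smooth f -> smooth g ->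
  'D_(basis_vec i) (f \* g) =
  ('D_(basis_vec i) f \* g) \+ (f \* 'D_(basis_vec i) g).
Proof.
move=> sf sg; apply/funext => x /=.
rewrite deriveM; try exact: smooth_derivable.
by rewrite addrC; congr (_ + _); rewrite mulrC.
Qed.

Lemma derive_addE f g i : (forall x, derivable f x (basis_vec i)) ->
  (forall x, derivable g x (basis_vec i)) ->
  'D_(basis_vec i) (f \+ g) = 'D_(basis_vec i) f \+ 'D_(basis_vec i) g.
Proof. by move=> df dg; apply/funext => x /=; rewrite deriveD. Qed.

Lemma smoothM f g : smooth f -> smooth g -> smooth (f \* g).
Proof.
move=> sf sg; apply: (smooth_coind prod_closure_cd); last exact: prod_closure_mul.
move=> h i; elim=> {sf sg f g} [f g sf sg|f g Pf Df Pg Dg].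
  rewrite derive_mulE //.
  by apply: prod_closure_add; apply: prod_closure_mul;
      [exact: smooth_derive|exact: sg|exact: sf|exact: smooth_derive].
rewrite derive_addE; first exact: prod_closure_add.
  by move=> x; have [_] := prod_closure_cd Pf; exact.
by move=> x; have [_] := prod_closure_cd Pg; exact.
Qed.

Lemma smooth_sum I (r : seq I) (P : pred I) (F : I -> R * R * R -> R) :
  (forall a, P a -> smooth (F a)) -> smooth (fun x => \sum_(a <- r | P a) F a x).
Proof.
move=> sF; elim: r => [|a r IH].
  by rewrite (_ : (fun _ => _) = cst 0); [exact: smooth_cst|
    apply/funext => x; rewrite big_nil].
have [Pa|nPa] := boolP (P a); last first.
  by rewrite (_ : (fun _ => _) = (fun x => \sum_(b <- r | P b) F b x)) //;
    apply/funext => x; rewrite big_cons (negbTE nPa).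
rewrite (_ : (fun _ => _) = F a \+ (fun x => \sum_(b <- r | P b) F b x)).
  exact: (smoothD (sF _ Pa) IH).
by apply/funext => x; rewrite big_cons Pa.
Qed.

Lemma smoothZ (c : R) f : smooth f -> smooth (fun x => c * f x).
Proof. by move=> sf; exact: (smoothM (smooth_cst c) sf). Qed.

Lemma derive_scaleE (c : R) f i : smooth f ->
  'D_(basis_vec i) (fun x => c * f x) = fun x => c * 'D_(basis_vec i) f x.
Proof.
move=> sf; rewrite (derive_mulE i (smooth_cst c) sf); apply/funext => x /=.
by rewrite derive_cst mul0r add0r.
Qed.

Lemma smoothN f : smooth f -> smooth (fun x => - f x).
Proof.
move=> sf; rewrite (_ : (fun x => _) = (fun x => -1 * f x)); first exact: smoothZ.
by apply/funext => x; rewrite mulN1r.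
Qed.

Definition smooth1 h : Prop := forall n x, derivable h^`(n)%classic x 1.

Lemma is_derive_xcoord h i j (x : R * R * R) : derivable h (xcoord i x) 1 ->
  is_derive x (basis_vec j) (h \o xcoord i) ((i == j)%:R * h^`()%classic (xcoord i x)).
Proof.
move=> dh; have [ij|ij] := eqVneq i j; last first.
  rewrite mul0r.
  have E : (fun t : R => t^-1 *: (((h \o xcoord i) \o shift x) (t *: basis_vec j)
    - (h \o xcoord i) x)) = cst 0.
    apply/funext => t /=; rewrite xcoord_line (negbTE ij) mul0r add0r subrr.
    by rewrite scaler0.
  by split; [rewrite /derivable E; exact: is_cvg_cst|rewrite /derive E lim_cst].
rewrite mul1r; subst j; move: dh; set j := i => dh.
have E : (fun t : R => t^-1 *: (((h \o xcoord j) \o shift x) (t *: basis_vec j)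
    - (h \o xcoord j) x)) =
   (fun t : R => t^-1 *: ((h \o shift (xcoord j x)) (t *: 1) - h (xcoord j x))).
  apply/funext => t /=; rewrite xcoord_line eqxx mul1r.
  by rewrite -[t *: 1]/(t * 1) mulr1.
split; first by rewrite /derivable E.
by rewrite /derive E derive1E.
Qed.

Lemma smooth_xcoord h i : smooth1 h -> smooth (h \o xcoord i).
Proof.
move=> sh.
pose P f := exists c n, f = fun x => c * h^`(n)%classic (xcoord i x) :> R.
have dP c n x j : is_derive x (basis_vec j) (fun x => c * h^`(n)%classic (xcoord i x))
    (c * (i == j)%:R * h^`(n.+1)%classic (xcoord i x)).
  have H := is_derive_xcoord j (sh n (xcoord i x)).
  have := is_deriveZ c H.
  by rewrite derive1nS -mulrA; exact.
apply: (@smooth_coind P); last by exists 1, 0; apply/funext => x; rewrite mul1r.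
- move=> _ [c [n ->]]; split=> [x|x j]; last by have [] := dP c n x j.
  apply: cvgM; first exact: cvg_cst.
  apply: (@continuous_comp _ _ _ (xcoord i) h^`(n)%classic); first exact: continuous_xcoord.
  apply: differentiable_continuous; apply/derivable1_diffP; exact: sh.
- move=> _ j [c [n ->]]; exists (c * (i == j)%:R), n.+1.
  by apply: derive_funE => x; exact: dP.
Qed.

Lemma derive_xcoordE h i j : smooth1 h ->
  'D_(basis_vec j) (h \o xcoord i) = fun x => (i == j)%:R * h^`()%classic (xcoord i x).
Proof.
by move=> sh; apply: derive_funE => x; apply: is_derive_xcoord; exact: (sh 0).
Qed.

(** Restriction to a line parallel to an axis, to apply the one-variable fundamental theorem and
    mean value theorem to partial derivatives. *)
Lemma is_derive_line f i (x : R * R * R) (t : R) :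
  derivable f (t *: basis_vec i + x) (basis_vec i) ->
  is_derive t 1 (fun s : R => f (s *: basis_vec i + x))
    ('D_(basis_vec i) f (t *: basis_vec i + x)).
Proof.
move=> df.
have E : (fun s : R => s^-1 *: (((fun s : R => f (s *: basis_vec i + x)) \o shift t)
    (s *: 1) - f (t *: basis_vec i + x))) =
  (fun s : R => s^-1 *: ((f \o shift (t *: basis_vec i + x)) (s *: basis_vec i)
    - f (t *: basis_vec i + x))).
  apply/funext => s /=; congr (_ *: (f _ - _)).
  by rewrite -[s *: 1]/(s * 1) mulr1 scalerDl addrA.
by split; [rewrite /derivable E|rewrite /derive E].
Qed.

End Smooth.

(** * Smooth functions of one variable: trigonometric and flat functions *)

Section Smooth1.
Context {R : realType}.
Implicit Types (h : R -> R).

Lemma smooth1_coind (P : (R -> R) -> Prop) :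
  (forall h, P h -> forall x, derivable h x 1) ->
  (forall h, P h -> P h^`()%classic) -> forall h, P h -> smooth1 h.
Proof.
move=> Pd PD h Ph n x; apply: Pd; elim: n => [|n IH]; first exact: Ph.
by rewrite derive1nS; exact: PD.
Qed.

Lemma derive1_funE h (k : R -> R) : (forall x : R, is_derive x 1 h (k x)) ->
  h^`()%classic = k.
Proof. by move=> hk; apply/funext => x; rewrite derive1E; have [_ ->] := hk x. Qed.

Lemma smooth1_derivable h (x : R) : smooth1 h -> derivable h x 1.
Proof. by move=> /(_ 0%N). Qed.

Lemma smooth1_derive1 h : smooth1 h -> smooth1 h^`()%classic.
Proof. by move=> sh n x; have := sh n.+1 x; rewrite derive1Sn. Qed.

Lemma smooth1_is_derive h (x : R) : smooth1 h -> is_derive x 1 h (h^`()%classic x).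
Proof.
by move=> sh; rewrite derive1E; apply: derivableP; exact: smooth1_derivable.
Qed.

Lemma is_derive_affine h (a b x : R) : smooth1 h ->
  is_derive x 1 (fun t => h (a * t + b)) (a * h^`()%classic (a * x + b)).
Proof.
move=> sh; have H := smooth1_is_derive (a * x + b) sh.
rewrite mulrC; apply: (@is_derive1_comp R h (fun t => a * t + b)).
have := is_deriveD (is_deriveZ a (is_derive_id x (1 : R))) (is_derive_cst b x (1 : R)).
by congr (is_derive _ _ _ _); rewrite addr0 -[LHS]/(a * 1) mulr1.
Qed.

Lemma smooth1_affine h (a b : R) : smooth1 h -> smooth1 (fun t => h (a * t + b)).
Proof.
move=> sh.
pose P g := exists c h, smooth1 h /\ g = fun t => c * h (a * t + b) :> R.
have dP (c : R) k (t : R) : smooth1 k -> is_derive t 1 (fun t => c * k (a * t + b))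
    (c * a * k^`()%classic (a * t + b)).
  move=> sk; rewrite -mulrA.
  exact: (is_deriveZ c (is_derive_affine a b t sk)).
apply: (@smooth1_coind P).
- by move=> _ [c [k [sk ->]]] x; have [] := dP c k x sk.
- move=> _ [c [k [sk ->]]]; exists (c * a), k^`()%classic.
  by split; [exact: smooth1_derive1|apply: derive1_funE => x; exact: dP].
- by exists 1, h; split=> //; apply/funext => t; rewrite mul1r.
Qed.

Lemma smooth1_sin_cos (a b : R) : smooth1 (fun t => a * sin t + b * cos t).
Proof.
pose P h := exists a b, h = fun t => a * sin t + b * cos t :> R.
have dP (c d x : R) :
    is_derive x 1 (fun t => c * sin t + d * cos t) (- d * sin x + c * cos x).
  have H1 := is_deriveZ c (is_derive_sin x).
  have H2 := is_deriveZ d (is_derive_cos x).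
  have := is_deriveD H1 H2; congr (is_derive _ _ _ _).
  by rewrite -[LHS]/(c * cos x + d * - sin x); ring.
apply: (@smooth1_coind P); last by exists a, b.
- by move=> _ [c [d ->]] x; have [] := dP c d x.
- by move=> _ [c [d ->]]; exists (- d), c; apply: derive1_funE => x; exact: dP.
Qed.

Lemma smooth1_sin : smooth1 (@sin R).
Proof.
have := @smooth1_sin_cos 1 0.
by rewrite (_ : (fun t => _) = sin) //; apply/funext => t; rewrite mul1r mul0r addr0.
Qed.

Lemma smooth1_cos : smooth1 (@cos R).
Proof.
have := @smooth1_sin_cos 0 1.
by rewrite (_ : (fun t => _) = cos) //; apply/funext => t; rewrite mul1r mul0r add0r.
Qed.

(* For [p = 1] this is the function exp(-1/t) extended by 0 to t <= 0. *)
Definition flat (p : {poly R}) (t : R) : R :=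
  if t <= 0 then 0 else p.[t^-1] * expR (- t^-1).

(** Term by term, since [y^i <= i! exp y]. With [y = 1/t] it gives the bounds on flat functions and
    on the derivative of the cut-off. *)
Lemma horner_expRN_bound (p : {poly R}) :
  exists2 C : R, 0 <= C & forall y : R, 0 <= y -> `|p.[y] * expR (- y)| <= C.
Proof.
exists (\sum_(i < size p) `|p`_i| * (i.+1)`!%:R).
  by apply: sumr_ge0 => i _; rewrite mulr_ge0.
move=> y y0; rewrite normrM (ger0_norm (expR_ge0 _)) horner_coef.
apply: (le_trans (ler_wpM2r (expR_ge0 _) (ler_norm_sum _ _ _))).
rewrite mulr_suml; apply: ler_sum => i _.
rewrite normrM -mulrA ler_wpM2l // normrX (ger0_norm y0) expRN.
rewrite ler_pdivrMr ?expR_gt0//.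
have [->|i0] := eqVneq (i : nat) 0%N.
  rewrite expr0 (_ : 1`!%:R = 1) // mul1r; apply: le_trans (expR_ge1Dx y).
  by rewrite lerDl.
have := expR_ge1Dxn i.-1 y0; rewrite prednK ?lt0n// => H.
rewrite factS natrM; apply: (@le_trans _ _ (i`!%:R * expR y)); last first.
  by rewrite ler_wpM2r ?expR_ge0// ler_peMl// ler1n.
rewrite -ler_pdivrMl ?ltr0n ?fact_gt0// mulrC.
by apply: le_trans H; rewrite lerDr.
Qed.

(** For [t > 0] the derivative of [p(1/t) exp(-1/t)] is [(p - p')(1/t) exp(-1/t) / t^2], which has
    the same form; the class of all [flat p] is thus stable under derivation. *)
Lemma is_derive_flat (p : {poly R}) (x : R) :
  is_derive x 1 (flat p) (flat ('X^2 * (p - p^`())) x).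
Proof.
have [x0|x0|->] := ltgtP x 0.
- rewrite {2}/flat (ltW x0).
  have H0 : is_derive x 1 (cst (0 : R)) (0 : R) by exact: is_derive_cst.
  apply: near_eq_is_derive H0.
  near=> t; rewrite /flat ifT //; apply: ltW; near: t; exact: lt_nbhsl.
- rewrite {2}/flat leNgt x0 /=.
  apply: (@near_eq_is_derive R R R (fun t : R => p.[t^-1] * expR (- t^-1))).
    near=> t; rewrite /flat ifF //; apply/negbTE; rewrite -ltNge.
    near: t; exact: lt_nbhsr.
  have x1 : x != 0 by rewrite gt_eqF.
  have dV : is_derive x 1 (fun t : R => t^-1) (- x ^- 2).
    have := @is_deriveV R id x 1 1 x1 (is_derive_id x (1 : R)).
    by rewrite -[_ *: 1]/(_ * 1) mulr1.
  have dp : is_derive x 1 (fun t => p.[t^-1]) (p^`().[x^-1] * - x ^- 2).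
    apply: (@is_derive1_comp R (horner p) (fun t => t^-1)).
  have de : is_derive x 1 (fun t => expR (- t^-1)) (expR (- x^-1) * x ^- 2).
    apply: (@is_derive1_comp R expR (fun t => - t^-1)).
    by have := is_deriveN dV; rewrite opprK.
  have := is_deriveM dp de; congr (is_derive _ _ _ _).
  rewrite !hornerE -exprVn.
  by rewrite -[LHS]/(p.[x^-1] * _ + expR (- x^-1) * _); ring.
- rewrite {2}/flat lexx.
  (* At 0 the difference quotient is [t] times the expression for the polynomial [X p X], which is
     bounded, so it tends to 0. *)
  have [C C0 HC] := horner_expRN_bound ('X * p * 'X).
  have E : (fun t : R => t^-1 *: ((flat p \o shift 0) (t *: 1) - flat p 0))
     @ 0^' --> (0 : R).
    rewrite /flat lexx /=; apply/cvgrPdist_le => e e0; near=> t.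
    rewrite sub0r normrN subr0 addr0 -[t *: 1]/(t * 1) mulr1.
    case: ifPn => [_|]; first by rewrite scaler0 normr0 ltW.
    rewrite -ltNge => t0.
    rewrite -[X in `|X|]/(t^-1 * (p.[t^-1] * expR (- t^-1))).
    have := HC t^-1; rewrite invr_ge0 (ltW t0) => /(_ isT).
    rewrite 2!hornerM hornerX => H.
    have -> : t^-1 * (p.[t^-1] * expR (- t^-1)) =
      t * (t^-1 * p.[t^-1] * t^-1 * expR (- t^-1)).
      by field; rewrite gt_eqF.
    rewrite normrM; apply: (@le_trans _ _ (`|t| * C)); first by rewrite ler_wpM2l.
    have : `|t| <= e / (C + 1).
      near: t; apply: dnbhs0_le; rewrite divr_gt0 // ltr_wpDl//.
    rewrite ler_pdivlMr ?ltr_wpDl// => te; apply: le_trans te.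
    by rewrite ler_wpM2l // lerDl.
  by split; [rewrite /derivable; apply/cvg_ex; exists 0|exact: (cvg_lim _ E)].
Unshelve. all: by end_near. Qed.

Lemma smooth1_flat (p : {poly R}) : smooth1 (flat p).
Proof.
pose P h := exists p, h = flat p.
apply: (@smooth1_coind P); last by exists p.
- by move=> _ [q ->] x; have [] := is_derive_flat q x.
- move=> _ [q ->]; exists ('X^2 * (q - q^`())).
  by apply: derive1_funE; exact: is_derive_flat.
Qed.

End Smooth1.

(** * Integrals over the box *)

Notation R3 R := (measurableTypeR R * measurableTypeR R * measurableTypeR R)%type.

Section BoxIntegral.
Context {R : realType}.
Implicit Types (f g h : R * R * R -> R) (i j : 'I_3).

(** The measurable structure is a product of sigma-algebras, so the open set [a < f] is written as
    the countable union of the cubes with rational centre and radius [1/(n+1)] that it contains. *)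
Lemma continuous_measurable3 f : continuous f -> measurable_fun setT f.
Proof.
move=> cf; apply: (measurability _ (RGenOInfty.measurableE R)).
move=> /= _ [_ [a ->] <-]; rewrite setTI.
pose B (q : rat * rat * rat * nat) : set (R * R * R) :=
  (ball (ratr q.1.1.1 : R) (q.2.+1%:R^-1) `*` ball (ratr q.1.1.2 : R) (q.2.+1%:R^-1))
  `*` ball (ratr q.1.2 : R) (q.2.+1%:R^-1).
pose F q : set (R * R * R) := if `[< B q `<=` [set x | a < f x] >] then B q else set0.
rewrite (_ : _ @^-1` _ = \bigcup_q F q); last first.
  apply/seteqP; split=> x /=; last first.
    move=> [q _]; rewrite /F; case: asboolP => // qf Bx.
    by rewrite in_itv /= andbT; exact: qf.
  rewrite in_itv /= andbT => ax.
  have /nbhs_ballP[e /= e0 xe] : nbhs x [set y | a < f y].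
    exact: (cf x [set t | a < t] (lt_nbhsr ax)).
  have [n _ ne] : \forall n \near \oo, n.+1%:R^-1 < e / 2 :> R.
    exact: (near_infty_natSinv_lt (PosNum (divr_gt0 e0 (ltr0n _ 2)))).
  have {}ne := ne n (leqnn n).
  have rb (t : R) : exists q : rat, ball (ratr q : R) (n.+1%:R^-1) t.
    have : t - n.+1%:R^-1 < t + n.+1%:R^-1.
      by rewrite ltrD2l gtrN // invr_gt0 ltr0n.
    move=> /rat_in_itvoo[q]; rewrite in_itv /= => /andP[q1 q2].
    exists q; rewrite -ball_normE /= ltr_norml.
    by move: q1 q2; set d := _^-1 => q1 q2; apply/andP; split; lra.
  have [q0 h0] := rb x.1.1; have [q1 h1] := rb x.1.2; have [q2 h2] := rb x.2.
  exists (q0, q1, q2, n) => //; rewrite /F; case: asboolP => [_|]; first by [].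
  move=> []; move=> y [[/= y0 y1] y2]; apply: xe.
  have tri (q : rat) s t : ball (ratr q : R) (n.+1%:R^-1) s ->
      ball (ratr q : R) (n.+1%:R^-1) t -> ball s e t.
    by move=> hs ht; apply: le_ball (ball_triangle (ball_sym hs) ht);
      move: ne; set d := _^-1; lra.
  by split; [split|]; [exact: tri h0 y0|exact: tri h1 y1|exact: tri h2 y2].
apply: countable_bigcupT_measurable => // q; rewrite /F.
case: asboolP => _; last exact: measurable0.
by do 2?apply: measurableX; exact: measurable_ball.
Qed.

Variable L : 'I_3 -> R.
Hypothesis L_gt0 : forall i, 0 < L i.
Local Notation box := (box L).
Local Notation T3 := (R3 R).

(* The display of [volume] is not the default one of [R * R * R]. *)
Definition mbox f : Prop := measurable_fun (box : set T3) (f : T3 -> R).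

Lemma boxE : box = (`]0, L 0[ `*` `]0, L 1[) `*` `]0, L 2[.
Proof.
apply/seteqP; split=> [[[a b] c] bx|[[a b] c] [[/= h0 h1] h2]].
  by have := bx 0; have := bx 1; have := bx 2; rewrite /xcoord /= => h2 h1 h0;
    split; [split|]; rewrite /= in_itv.
by apply: ord3P; [move: h0|move: h1|move: h2]; rewrite /= in_itv.
Qed.

Lemma measurable_box : measurable (box : set T3).
Proof. by rewrite boxE; do 2?apply: measurableX; exact: measurable_itv. Qed.

Lemma volume_box : volume box = (L 0 * L 1 * L 2)%:E.
Proof.
rewrite boxE /volume.
have mI (a : R) : measurable (`]0, a[%classic : set (measurableTypeR R)).
  exact: measurable_itv.
apply: etrans (product_measure1E _ _ _ (mI _)) _; first exact: measurableX.
apply: (etrans (congr1 (fun z => (z * _)%E) (product_measure1E _ _ (mI _) (mI _)))).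
have E i : (L i)%:E = @lebesgue_measure R `]0, L i[%classic.
  by rewrite lebesgue_measure_itv /= lte_fin L_gt0 oppr0 adde0.
by rewrite !EFinM !E.
Qed.

Lemma volume_box_lty : (volume box < +oo)%E.
Proof. by rewrite volume_box ltry. Qed.

Definition integ f : Prop := volume.-integrable box (EFin \o f).
Definition Ibox f : R := \int[volume]_(x in box) f x.

Lemma integD f g : integ f -> integ g -> integ (f \+ g).
Proof.
move=> fi gi; have := integrableD measurable_box fi gi.
by apply: eq_integrable; [exact: measurable_box|].
Qed.

Lemma integZ (c : R) f : integ f -> integ (fun x => c * f x).
Proof.
move=> fi; have := integrableZl measurable_box c fi.
by apply: eq_integrable; [exact: measurable_box|].
Qed.

Lemma integ_eq f g : (forall x, box x -> f x = g x) -> integ f -> integ g.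
Proof.
move=> fg; apply: eq_integrable; first exact: measurable_box.
by move=> x; rewrite inE => bx /=; rewrite fg.
Qed.

Lemma Ibox_eq f g : (forall x, box x -> f x = g x) -> Ibox f = Ibox g.
Proof. by move=> fg; apply: eq_Rintegral => x; rewrite inE; exact: fg. Qed.

Lemma IboxD f g : integ f -> integ g -> Ibox (f \+ g) = Ibox f + Ibox g.
Proof. by move=> fi gi; apply: RintegralD => //; exact: measurable_box. Qed.

Lemma IboxZ (c : R) f : integ f -> Ibox (fun x => c * f x) = c * Ibox f.
Proof. by move=> fi; apply: RintegralZl => //; exact: measurable_box. Qed.

Lemma integ_cst (c : R) : integ (cst c).
Proof.
apply: measurable_bounded_integrable; [exact: measurable_box|exact: volume_box_lty|
  exact: measurable_cst|].
by exists `|c|; split=> // M cM x _ /=; exact: ltW.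
Qed.

Lemma Ibox_cst (c : R) : Ibox (cst c) = c * (L 0 * L 1 * L 2).
Proof.
by rewrite /Ibox Rintegral_cst; [rewrite volume_box|exact: measurable_box].
Qed.

Lemma integ_sum I (r : seq I) (P : pred I) (F : I -> R * R * R -> R) :
  (forall a, P a -> integ (F a)) -> integ (fun x => \sum_(a <- r | P a) F a x).
Proof.
move=> Fi; have := integrable_sum measurable_box r Fi.
apply: eq_integrable; first exact: measurable_box.
by move=> x _ /=; rewrite sumEFin.
Qed.

Lemma Ibox_sum I (r : seq I) (P : pred I) (F : I -> R * R * R -> R) :
  (forall a, P a -> integ (F a)) ->
  Ibox (fun x => \sum_(a <- r | P a) F a x) = \sum_(a <- r | P a) Ibox (F a).
Proof.
move=> Fi; elim: r => [|a r IH].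
  rewrite big_nil; under Ibox_eq do rewrite big_nil.
  by rewrite (Ibox_cst 0) mul0r.
rewrite big_cons; case: ifP => Pa; last first.
  by rewrite -IH; apply: Ibox_eq => x _; rewrite big_cons Pa.
rewrite -IH -IboxD; [|exact: Fi|exact: integ_sum].
by apply: Ibox_eq => x _; rewrite big_cons Pa.
Qed.

Lemma Ibox0 f : (forall x, box x -> f x = 0) -> Ibox f = 0.
Proof. by move=> f0; rewrite (Ibox_eq f0) (Ibox_cst 0) mul0r. Qed.

Lemma integN f : integ f -> integ (fun x => - f x).
Proof. by move/(integZ (-1)); apply: integ_eq => x _; rewrite mulN1r. Qed.

Lemma IboxN f : integ f -> Ibox (fun x => - f x) = - Ibox f.
Proof.
by move=> fi; rewrite -mulN1r -IboxZ //; apply: Ibox_eq => x _; rewrite mulN1r.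
Qed.

Lemma integ_le f g : mbox f -> integ g ->
  (forall x, box x -> `|f x| <= g x) -> integ f.
Proof.
move=> mf gi fg; apply: (le_integrable measurable_box _ _ gi).
  exact/measurable_EFinP.
move=> x bx /=; rewrite lee_fin; apply: le_trans (fg _ bx) _; exact: ler_norm.
Qed.

Lemma Ibox_ge0 f : (forall x, box x -> 0 <= f x) -> 0 <= Ibox f.
Proof. by move=> f0; exact: Rintegral_ge0. Qed.

Lemma integral_Ibox f : integ f ->
  (\int[volume]_(x in box) (f x)%:E)%E = (Ibox f)%:E.
Proof.
by move=> fi; rewrite /Ibox /Rintegral fineK //; apply: integrable_fin_num => //;
  exact: measurable_box.
Qed.

Lemma Ibox_dominated (F : nat -> R * R * R -> R) f g :
  (forall n, mbox (F n)) ->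
  (forall x, box x -> F n x @[n --> \oo] --> f x) -> integ g ->
  (forall n x, box x -> `|F n x| <= g x) ->
  integ f /\ Ibox (F n) @[n --> \oo] --> Ibox f.
Proof.
move=> mF Ff gi Fg.
have mf : mbox f.
  apply: (measurable_fun_cvg mF) => x /Ff; exact.
have mFE n : measurable_fun (box : set T3) (EFin \o F n).
  by apply/measurable_EFinP; exact: mF.
have mfE : measurable_fun (box : set T3) (EFin \o f) by exact/measurable_EFinP.
have [] := @dominated_convergence _ _ _ volume _ measurable_box
  (fun n => EFin \o F n) (EFin \o f) (EFin \o g) mFE mfE _ gi _.
- by apply/aeW => x bx; apply: cvg_EFin; [exact: nearW|exact: Ff].
- by apply/aeW => x n bx /=; rewrite lee_fin; exact: Fg.
move=> fi _ cvg; split=> //.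
by apply: fine_cvg; rewrite -integral_Ibox.
Qed.

End BoxIntegral.

(** * Double integrals with vanishing inner integrals *)

Section FubiniZero.
Context d1 d2 (T1 : measurableType d1) (T2 : measurableType d2) {R : realType}.
Variables (m1 : {sigma_finite_measure set T1 -> \bar R})
  (m2 : {sigma_finite_measure set T2 -> \bar R}) (D1 : set T1) (D2 : set T2).
Hypotheses (mD1 : measurable D1) (mD2 : measurable D2).
Local Open Scope ereal_scope.

(** Fubini for the function extended by 0 outside of the rectangle; as all the inner integrals
    vanish, nothing has to be known about the outer one. *)
Lemma integral_prod_eq0l (f : T1 * T2 -> \bar R) :
  (m1 \x m2).-integrable (D1 `*` D2) f ->
  (forall x, D1 x -> \int[m2]_(y in D2) f (x, y) = 0) ->
  \int[m1 \x m2]_(z in D1 `*` D2) f z = 0.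
Proof.
move=> fi f0; rewrite integral_mkcond -integral12_prod_meas1; last first.
  by rewrite -integrable_mkcond //; exact: measurableX.
apply: integral0_eq => x _; rewrite /fubini_F.
have [D1x|nD1x] := pselect (D1 x); last first.
  apply: integral0_eq => y _; rewrite patchE ifF //; apply/negbTE.
  by rewrite notin_setE => -[].
rewrite -[RHS](f0 _ D1x) [RHS]integral_mkcond; apply: eq_integral => y _.
rewrite !patchE; congr (if _ then _ else _); apply/idP/idP; rewrite !inE => //.
by case.
Qed.

Lemma integral_prod_eq0r (f : T1 * T2 -> \bar R) :
  (m1 \x m2).-integrable (D1 `*` D2) f ->
  (forall y, D2 y -> \int[m1]_(x in D1) f (x, y) = 0) ->
  \int[m1 \x m2]_(z in D1 `*` D2) f z = 0.
Proof.
move=> fi f0; rewrite integral_mkcond -integral21_prod_meas1; last first.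
  by rewrite -integrable_mkcond //; exact: measurableX.
apply: integral0_eq => y _; rewrite /fubini_G.
have [D2y|nD2y] := pselect (D2 y); last first.
  apply: integral0_eq => x _; rewrite patchE ifF //; apply/negbTE.
  by rewrite notin_setE => -[].
rewrite -[RHS](f0 _ D2y) [RHS]integral_mkcond; apply: eq_integral => x _.
rewrite !patchE; congr (if _ then _ else _); apply/idP/idP; rewrite !inE => //.
by case.
Qed.

End FubiniZero.

(** Squares of an exhausting sequence of the line. [area] is itself a factor of [volume], and Fubini
    asks for sigma-finite factors. *)
Lemma sigma_finite_area {R : realType} : sigma_finite setT (@area R).
Proof.
have /sigma_finiteP[F [TF ndF Foo]] := @sigma_finiteT _ _ _ (@lebesgue_measure R).
exists (fun n => F n `*` F n).
  apply/seteqP; split=> // -[x y] _.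
  have : [set: measurableTypeR R] x by []; rewrite TF => -[n _ Fx].
  have : [set: measurableTypeR R] y by []; rewrite TF => -[m _ Fy].
  exists (maxn n m) => //; split=> /=.
    by move: Fx; apply/subsetPset/ndF/leq_maxl.
  by move: Fy; apply/subsetPset/ndF/leq_maxr.
move=> n; have [mF Fy] := Foo n; split; first exact: measurableX.
have -> : area (F n `*` F n) = (lebesgue_measure (F n) * lebesgue_measure (F n))%E.
  exact: product_measure1E.
by apply: lte_mul_pinfty => //; rewrite ge0_fin_numE.
Qed.

(* An alias: on products the canonical instance found by unification is the one
   for subprobabilities. *)
Definition plane_measure {R : realType} :
  set (measurableTypeR R * measurableTypeR R)%type -> \bar R := @area R.

HB.instance Definition _ {R : realType} := Measure.copy (@plane_measure R) (@area R).

HB.instance Definition _ {R : realType} :=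
  Measure_isSigmaFinite.Build _ _ _ (@plane_measure R) sigma_finite_area.

(** * Integrals of derivatives over the box *)

Section Parts.
Context {R : realType} (L : 'I_3 -> R).
Hypothesis L_gt0 : forall i, 0 < L i.
Local Notation box := (box L).
Local Notation T3 := (R3 R).
Local Notation integ := (integ L).
Local Notation mbox := (mbox L).
Local Notation Ibox := (Ibox L).
Implicit Types (f g h : R * R * R -> R) (i j : 'I_3).

Definition cbox : set (R * R * R) := [set x | forall i, 0 <= xcoord i x <= L i].

Lemma box_cbox x : box x -> cbox x.
Proof. by move=> bx i; have /andP[/ltW-> /ltW->] := bx i. Qed.

Lemma compact_cbox : compact cbox.
Proof.
rewrite (_ : cbox = (`[0, L 0] `*` `[0, L 1]) `*` `[0, L 2]).
  by do 2?apply: compact_setX; exact: segment_compact.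
apply/seteqP; split=> [[[a b] c] bx|[[a b] c] [[/= h0 h1] h2]].
  by have := bx 0; have := bx 1; have := bx 2; rewrite /xcoord /= => h2 h1 h0;
    split; [split|]; rewrite /= in_itv.
by apply: ord3P; [move: h0|move: h1|move: h2]; rewrite /= in_itv.
Qed.

Lemma continuous_cbox_bounded f : continuous f ->
  exists2 M : R, 0 < M & forall x, cbox x -> `|f x| <= M.
Proof.
move=> cf.
have /compact_bounded[M [Mr HM]] : compact (f @` cbox).
  apply: continuous_compact compact_cbox.
  by apply: continuous_subspaceT; exact: cf.
exists (`|M| + 1); first by rewrite ltr_wpDl.
move=> x bx; apply: (HM (`|M| + 1)); last by exists x.
by rewrite (le_lt_trans (ler_norm _)) // ltrDl.
Qed.

Lemma mbox_continuous f : continuous f -> mbox f.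
Proof.
by move=> cf; apply: measurable_funTS; exact: (continuous_measurable3 cf).
Qed.

Lemma integ_continuous f : continuous f -> integ f.
Proof.
move=> cf; have [M M0 fM] := continuous_cbox_bounded cf.
apply: (integ_le (mbox_continuous cf) (integ_cst L_gt0 M)) => x bx.
exact/fM/box_cbox.
Qed.

Lemma integral_line_eq0 (k : R -> R) (l : R) : 0 < l ->
  (forall t : R, derivable k t 1) -> continuous k^`()%classic ->
  k 0 = 0 -> k l = 0 ->
  (\int[@lebesgue_measure R]_(t in `]0%R, l[) ((k^`()%classic t)%:E) = 0)%E.
Proof.
move=> l0 dk ck k0 kl.
have mk' : measurable_fun (`]0, l[ : set (measurableTypeR R)) (EFin \o k^`()%classic).
  by apply/measurable_EFinP/measurable_funTS; exact: measurable_realfun.continuous_measurable_fun.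
rewrite integral_itv_bndo_bndc // integral_itv_obnd_cbnd; last first.
  apply/measurable_EFinP/measurable_funTS; exact: measurable_realfun.continuous_measurable_fun.
have kc : continuous k.
  by move=> t; apply: differentiable_continuous; apply/derivable1_diffP.
have k'c : {within `[0, l], continuous k^`()%classic} by exact: continuous_subspaceT.
have dk' : derivable_oo_LRcontinuous k 0 l.
  by split=> [t _||]; [exact: dk|exact: cvg_at_right_filter (kc _)|
    exact: cvg_at_left_filter (kc _)].
rewrite (continuous_FTC2 l0 k'c dk' (fun t _ => erefl)).
by rewrite k0 kl subee.
Qed.

(* Each of the three orders of integration ends with the variable [i]. *)
Lemma Ibox_derive_eq0 f i : smooth f ->
  (forall x, xcoord i x = 0 \/ xcoord i x = L i -> f x = 0) ->
  Ibox ('D_(basis_vec i) f) = 0.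
Proof.
move=> sf f0.
have sDf := smooth_derive i sf.
set g := 'D_(basis_vec i) f.
have cg : continuous g by exact: smooth_continuous.
have gi : integ g by exact: integ_continuous.
have line0 (x : R * R * R) : xcoord i x = 0 ->
    (\int[@lebesgue_measure R]_(t in `]0%R, L i[)
       ((g (t *: basis_vec i + x))%:E) = 0)%E.
  move=> xi; pose k t := f (t *: basis_vec i + x).
  have dk (t : R) : is_derive t 1 k (g (t *: basis_vec i + x)).
    by apply: is_derive_line; exact: smooth_derivable.
  have k'E : k^`()%classic = fun t => g (t *: basis_vec i + x).
    exact: derive1_funE.
  rewrite -[RHS](@integral_line_eq0 k (L i)) ?k'E //.
  - move=> t; apply: (@continuous_comp _ _ _ (fun t : R => t *: basis_vec i + x) g).
      by apply: cvgD; [apply: cvgZr_tmp; exact: cvg_id|exact: cvg_cst].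
    exact: cg.
  - by apply: f0; left; rewrite xcoord_line eqxx mul1r add0r.
  - by apply: f0; right; rewrite xcoord_line eqxx mul1r xi addr0.
have mI (a : R) : measurable (`]0, a[%classic : set (measurableTypeR R)).
  exact: measurable_itv.
have [M M0 gM] := continuous_cbox_bounded cg.
(* For the directions 0 and 1 the slice at height [c] is a double integral to which Fubini is
   applied once more. *)
have sec (c : R) : 0 < c < L 2 -> (area.-integrable (`]0, L 0[ `*` `]0, L 1[)
    (fun ab => (g (ab, c))%:E)).
  move=> cL; apply: measurable_bounded_integrable; first exact: measurableX.
  - apply: (@le_lt_trans _ _ (L 0 * L 1)%:E); last exact: ltry.
    rewrite le_eqVlt; apply/orP; left; apply/eqP.
    apply: etrans (product_measure1E _ _ (mI _) (mI _)) _.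
    have E j : (L j)%:E = @lebesgue_measure R `]0, L j[%classic.
      by rewrite lebesgue_measure_itv /= lte_fin L_gt0 oppr0 adde0.
    by rewrite !EFinM !E.
  - apply: measurable_funTS.
    apply: (@measurableT_comp _ _ _ _ T3 _ g); first exact: continuous_measurable3.
    by apply: measurable_fun_pair; [exact: measurable_id|exact: measurable_cst].
  - exists M; split=> [|N MN [a b] [/= ]]; first exact: num_real.
    rewrite !in_itv /= => aL bL; apply: le_trans (gM _ _) (ltW MN).
    by apply: box_cbox; apply: ord3P.
suff E : (\int[volume]_(x in box) (g x)%:E = 0)%E by rewrite /Ibox /Rintegral E.
have gi' : volume.-integrable ((`]0, L 0[ `*` `]0, L 1[) `*` `]0, L 2[)
  (EFin \o g) by rewrite -boxE; exact: gi.
rewrite boxE; clearbody g.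
pose lam : {sigma_finite_measure set (measurableTypeR R) -> \bar R} := @lebesgue_measure R.
have outer := integral_prod_eq0r (m1 := @plane_measure R) (m2 := lam) (measurableX (mI _) (mI _)) (mI _) gi'.
have lineE (j : 'I_3) (x : R * R * R) (k : R -> R * R * R) : j = i -> xcoord j x = 0 ->
    (forall t, k t = t *: basis_vec j + x) ->
    (\int[@lebesgue_measure R]_(t in `]0%R, L j[) ((g (k t))%:E) = 0)%E.
  move=> -> xi kE; rewrite -[RHS](line0 x xi).
  by apply: eq_integral => t _; rewrite kE.
have [i0|[i1|i2]] := ord3_cases i.
- apply: outer => c; rewrite /= in_itv /= => cL.
  apply: (integral_prod_eq0r (m1 := lam) (m2 := lam) (mI _) (mI _) (sec c cL)) => b _.
  apply: (lineE _ (0, b, c)) => // t.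
  by apply: point_ext; apply: ord3P; rewrite xcoord_line /xcoord /=; ring.
- apply: outer => c; rewrite /= in_itv /= => cL.
  apply: (integral_prod_eq0l (m1 := lam) (m2 := lam) (mI _) (mI _) (sec c cL)) => a _.
  apply: (lineE _ (a, 0, c)) => // t.
  by apply: point_ext; apply: ord3P; rewrite xcoord_line /xcoord /=; ring.
- apply: (integral_prod_eq0l (m1 := @plane_measure R) (m2 := lam) (measurableX (mI _) (mI _)) (mI _) gi')
    => -[a b] _.
  apply: (lineE _ (a, b, 0)) => // t.
  by apply: point_ext; apply: ord3P; rewrite xcoord_line /xcoord /=; ring.
Qed.

End Parts.

(** * Square integrable functions and cut-offs *)

Section L2Box.
Context {R : realType} (L : 'I_3 -> R).
Hypothesis L_gt0 : forall i, 0 < L i.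
Local Notation box := (box L).
Local Notation integ := (integ L).
Local Notation mbox := (mbox L).
Local Notation Ibox := (Ibox L).
Local Notation L2 := (L2 L).
Implicit Types (f g h : R * R * R -> R) (i j : 'I_3).

Lemma L2P f : L2 f <-> mbox f /\ integ (fun x => f x ^+ 2).
Proof.
have sqE : (\int[volume]_(x in box) `|(f x ^+ 2)%:E|)%E =
    (\int[volume]_(x in box) (f x ^+ 2)%:E)%E.
  by apply: eq_integral => x _; rewrite gee0_abs // lee_fin sqr_ge0.
split=> -[mf fi]; split=> //.
  apply/integrableP; split; last by rewrite sqE.
  by apply/measurable_EFinP; exact: measurable_realfun.measurable_funX.
by move: fi => /integrableP[_]; rewrite sqE.
Qed.

Lemma L2_measurable f : L2 f -> mbox f. Proof. by case. Qed.

Lemma L2_sqr_integ f : L2 f -> integ (fun x => f x ^+ 2).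
Proof. by move=> /L2P[]. Qed.

Lemma L2_mul_integ f g : L2 f -> L2 g -> integ (f \* g).
Proof.
move=> /L2P[mf fi] /L2P[mg gi].
apply: (integ_le _ (integD fi gi)) => [|x _ /=].
  exact: measurable_realfun.measurable_funM.
rewrite normrM -(real_normK (num_real (f x))) -(real_normK (num_real (g x))).
have := sqr_ge0 (`|f x| - `|g x|).
by have := normr_ge0 (f x); have := normr_ge0 (g x); nra.
Qed.

Lemma L2_eq f g : (forall x, box x -> f x = g x) -> L2 f -> L2 g.
Proof.
move=> fg /L2P[mf fi]; apply/L2P; split.
  by apply: eq_measurable_fun mf => x; rewrite inE; exact: fg.
by apply: integ_eq fi => x bx; rewrite fg.
Qed.

Lemma L2D f g : L2 f -> L2 g -> L2 (f \+ g).
Proof.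
move=> Lf Lg; apply/L2P; split.
  by apply: measurable_realfun.measurable_funD; exact: L2_measurable.
have fg := integZ 2 (L2_mul_integ Lf Lg).
apply: integ_eq (integD (integD (L2_sqr_integ Lf) (L2_sqr_integ Lg)) fg) => x _ /=.
by ring.
Qed.

Lemma L2_bounded_mul f g (M : R) : mbox f -> (forall x, box x -> `|f x| <= M) ->
  L2 g -> L2 (f \* g).
Proof.
move=> mf fM Lg; apply/L2P; split.
  by apply: measurable_realfun.measurable_funM => //; exact: L2_measurable.
apply: (integ_le _ (integZ (M ^+ 2) (L2_sqr_integ Lg))) => [|x bx /=].
  apply: measurable_realfun.measurable_funX; apply: measurable_realfun.measurable_funM => //.
  exact: L2_measurable.
rewrite exprMn normrM !normrX real_normK ?num_real// -[leLHS]mulrC.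
rewrite -[leRHS]mulrC real_normK ?num_real// ler_wpM2l ?sqr_ge0//.
rewrite -(real_normK (num_real (f x))) ler_sqr ?nnegrE ?fM//.
exact: le_trans (fM x bx).
Qed.

Lemma L2_cst (c : R) : L2 (cst c).
Proof.
by apply/L2P; split; [exact: measurable_cst|exact: (integ_cst L_gt0 (c ^+ 2))].
Qed.

Lemma L2Z (c : R) f : L2 f -> L2 (fun x => c * f x).
Proof.
by apply: (@L2_bounded_mul (cst c) f `|c|); [exact: measurable_cst|].
Qed.

Lemma L2N f : L2 f -> L2 (fun x => - f x).
Proof. by move/(L2Z (-1)); apply: L2_eq => x _; rewrite mulN1r. Qed.

Lemma L2B f g : L2 f -> L2 g -> L2 (fun x => f x - g x).
Proof. by move=> Lf Lg; apply: L2D => //; exact: L2N. Qed.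

Lemma L2_sum I (r : seq I) (P : pred I) (F : I -> R * R * R -> R) :
  (forall a, P a -> L2 (F a)) -> L2 (fun x => \sum_(a <- r | P a) F a x).
Proof.
move=> LF; elim: r => [|a r IH].
  by apply: L2_eq (L2_cst 0) => x _; rewrite big_nil.
case Pa: (P a); last by apply: L2_eq IH => x _; rewrite big_cons Pa.
by apply: L2_eq (L2D (LF a Pa) IH) => x _; rewrite big_cons Pa.
Qed.

Lemma L2_integ f : L2 f -> integ f.
Proof.
move=> Lf; apply: integ_eq (L2_mul_integ Lf (L2_cst 1)) => x _ /=.
by rewrite mulr1.
Qed.

Lemma L2_continuous f : continuous f -> L2 f.
Proof.
move=> cf; apply/L2P; split; first exact: mbox_continuous.
by apply: integ_continuous => // x; apply: cvgM; exact: cf.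
Qed.

Lemma L2_smooth f : smooth f -> L2 f.
Proof. by move/smooth_continuous/L2_continuous. Qed.

End L2Box.

(** * Smooth cut-offs near the faces *)

Section Cutoff.
Context {R : realType} (L : 'I_3 -> R).
Hypothesis L_gt0 : forall i, 0 < L i.
Local Notation box := (box L).
Local Notation cbox := (cbox L).
Local Notation integ := (integ L).
Local Notation mbox := (mbox L).
Local Notation Ibox := (Ibox L).
Local Notation L2 := (L2 L).
Implicit Types (f g h : R * R * R -> R) (i j : 'I_3) (n : nat) (x : R * R * R).

(** A smooth step that only tends to 1 at infinity. After the dilations below, pointwise convergence
    to 1 suffices, and the derivative stays explicit. *)
Definition step (t : R) : R := flat 1 (t - 1).

Definition dstep (t : R) : R := flat ('X^2 * (1 - 1^`())) (t - 1).

Lemma stepE t : step t = if t <= 1 then 0 else expR (- (t - 1)^-1).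
Proof. by rewrite /step /flat subr_le0; case: ifP => // _; rewrite hornerC mul1r. Qed.

Lemma smooth1_step : smooth1 step.
Proof.
have := @smooth1_affine _ _ 1 (-1) (@smooth1_flat R 1).
by congr smooth1; apply/funext => t; rewrite /step mul1r.
Qed.

Lemma derive1_step : step^`()%classic = dstep.
Proof.
apply: derive1_funE => t.
have := is_derive_affine 1 (-1) t (@smooth1_flat R 1).
rewrite (derive1_funE (is_derive_flat 1)) !mul1r.
by congr (is_derive _ _ _ _); apply/funext => s; rewrite /step mul1r.
Qed.

Lemma step_ge0 t : 0 <= step t.
Proof. by rewrite stepE; case: ifP => // _; exact: expR_ge0. Qed.

Lemma step_le1 t : step t <= 1.
Proof.
rewrite stepE; case: ifP => // /negbT; rewrite -ltNge => t1.
by rewrite expR_le1 oppr_le0 invr_ge0 subr_ge0 ltW.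
Qed.

Lemma dstepE t : dstep t =
  if t <= 1 then 0 else (t - 1) ^- 2 * expR (- (t - 1)^-1).
Proof.
rewrite /dstep /flat subr_le0; case: ifP => // _.
by rewrite -[1]/(1%:P) derivC subr0 mulr1 hornerXn exprVn.
Qed.

(** With [y = 1/(t - 1)] the two products are [(y^2 + y) exp(-y)] and [(y + 1)^2 exp(-y)]. The
    second bound expresses a decay like [t^(-2)]. *)
Lemma dstep_bound : exists2 C : R, 0 <= C &
  forall t, `|t * dstep t| <= C /\ `|t ^+ 2 * dstep t| <= C.
Proof.
have [C C0 HC] := horner_expRN_bound ('X^2 + 'X : {poly R}).
have [D D0 HD] := horner_expRN_bound (('X + 1%:P) ^+ 2 : {poly R}).
exists (C + D); first exact: addr_ge0.
move=> t; rewrite dstepE; case: ifPn => [_|].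
  by rewrite !mulr0 normr0; split; exact: addr_ge0.
rewrite -ltNge => t1; set y := (t - 1)^-1.
have y0 : 0 < y by rewrite invr_gt0 subr_gt0.
have tE : t = 1 + y^-1 by rewrite invrK; ring.
have yy : (t - 1) ^- 2 = y ^+ 2 by rewrite exprVn.
split; rewrite yy tE.
  apply: le_trans (ler_wpDr D0 (HC y (ltW y0))).
  rewrite le_eqVlt; apply/orP; left; apply/eqP; congr `|_|.
  rewrite hornerD hornerXn hornerX; field; exact: lt0r_neq0.
apply: le_trans (ler_wpDl C0 (HD y (ltW y0))).
rewrite le_eqVlt; apply/orP; left; apply/eqP; congr `|_|.
rewrite horner_exp hornerD hornerX hornerC; field; exact: lt0r_neq0.
Qed.

Definition lstep n i x : R := step (n.+1%:R * xcoord i x).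
Definition rstep n i x : R := step (n.+1%:R * (L i - xcoord i x)).
Definition cut1 n i : R * R * R -> R := lstep n i \* rstep n i.
Definition cutoff n : R * R * R -> R := (cut1 n 0 \* cut1 n 1) \* cut1 n 2.

Lemma lstepE n i : lstep n i = (fun t => step (n.+1%:R * t + 0)) \o xcoord i.
Proof. by apply/funext => x; rewrite /lstep /= addr0. Qed.

Lemma rstepE n i :
  rstep n i = (fun t => step (- n.+1%:R * t + n.+1%:R * L i)) \o xcoord i.
Proof. by apply/funext => x; rewrite /rstep /=; congr step; ring. Qed.

Lemma smooth_lstep n i : smooth (lstep n i).
Proof. by rewrite lstepE; apply: smooth_xcoord; exact/smooth1_affine/smooth1_step. Qed.

Lemma smooth_rstep n i : smooth (rstep n i).
Proof. by rewrite rstepE; apply: smooth_xcoord; exact/smooth1_affine/smooth1_step. Qed.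

Lemma smooth_cut1 n i : smooth (cut1 n i).
Proof. exact: smoothM (smooth_lstep n i) (smooth_rstep n i). Qed.

Lemma smooth_cutoff n : smooth (cutoff n).
Proof.
exact: smoothM (smoothM (smooth_cut1 n 0) (smooth_cut1 n 1)) (smooth_cut1 n 2).
Qed.

Lemma cut1_itv n i x : 0 <= cut1 n i x <= 1.
Proof.
by rewrite /cut1 /= mulr_ge0 ?step_ge0//= mulr_ile1 ?step_ge0 ?step_le1.
Qed.

Lemma cutoff_itv n x : 0 <= cutoff n x <= 1.
Proof.
have /andP[a0 a1] := cut1_itv n 0 x; have /andP[b0 b1] := cut1_itv n 1 x.
have /andP[c0 c1] := cut1_itv n 2 x; rewrite /cutoff /=.
have ab := mulr_ge0 a0 b0.
by apply/andP; split; [exact: mulr_ge0|exact: mulr_ile1 (mulr_ile1 _ _ _ _) _].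
Qed.

Lemma cut1_neq0 n i x : cut1 n i x != 0 ->
  n.+1%:R^-1 <= xcoord i x <= L i - n.+1%:R^-1.
Proof.
rewrite /cut1 /= mulf_eq0 negb_or /lstep /rstep !stepE.
case: ifPn => [|/= h1]; first by rewrite eqxx.
case: ifPn => [|/= h2 _]; first by rewrite eqxx andbF.
move: h1 h2; rewrite -!ltNge mulrC -ltr_pdivrMr ?ltr0n// div1r => h1.
rewrite mulrC -ltr_pdivrMr ?ltr0n// div1r => h2.
by apply/andP; split; [exact: ltW|rewrite lerBrDr -lerBrDl ltW].
Qed.

Lemma test_fun_cutoff f n : smooth f -> test_fun L (f \* cutoff n).
Proof.
move=> sf; split; first exact: smoothM sf (smooth_cutoff n).
(* For small [n] some [J i] may be empty; then [cutoff n] vanishes identically. *)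
pose J i := `[n.+1%:R^-1, L i - n.+1%:R^-1]%classic.
exists ((J 0 `*` J 1) `*` J 2); split.
- by do 2?apply: compact_setX; exact: segment_compact.
- have n0 : 0 < n.+1%:R^-1 :> R by rewrite invr_gt0 ltr0n.
  move=> [[a b] c] [[]]; rewrite /J /= !in_itv /= => h0 h1 h2.
  move: n0 h0 h1 h2; move: (_^-1) => d d0 h0 h1 h2.
  by apply: ord3P; rewrite /xcoord /=; apply/andP; split; lra.
- move=> x nKx; apply/eqP/negPn/negP.
  rewrite -[_ x]/(f x * (cut1 n 0 x * cut1 n 1 x * cut1 n 2 x)).
  rewrite mulf_eq0 negb_or => /andP[_].
  rewrite 2!mulf_eq0 !negb_or => /andP[/andP[h0 h1] h2].
  by apply: nKx; split; [split|]; rewrite /J /= in_itv;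
    [exact: cut1_neq0 h0|exact: cut1_neq0 h1|exact: cut1_neq0 h2].
Qed.

Lemma near_succ_gt (r : R) : \forall n \near \oo, r < n.+1%:R.
Proof.
near=> n; apply: lt_le_trans (_ : n%:R <= _); last by rewrite ler_nat.
by near: n; exact: nbhs_infty_gtr.
Unshelve. all: by end_near. Qed.

Lemma step_cvg1 (t : R) : 0 < t -> step (n.+1%:R * t) @[n --> \oo] --> (1 : R).
Proof.
move=> t0.
have H : expR (- (n.+1%:R * t - 1)^-1) @[n --> \oo] --> (1 : R).
  rewrite -[X in _ --> X]expR0.
  apply: continuous_cvg; first exact: continuous_expR.
  rewrite -[X in _ --> X]oppr0; apply: cvgN.
  apply/cvgrPdist_le => e e0; near=> n.
  rewrite sub0r normrN.
  have nt : (e^-1 + 1) / t <= n.+1%:R.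
    by apply: ltW; near: n; exact: near_succ_gt.
  move: nt; rewrite ler_pdivrMr // -lerBrDr => nt.
  have d0 : 0 < n.+1%:R * t - 1 by apply: lt_le_trans nt; rewrite invr_gt0.
  rewrite ger0_norm ?invr_ge0 ?(ltW d0)//.
  by rewrite -[leRHS]invrK lef_pV2 ?posrE ?invr_gt0.
apply: cvg_trans H; apply: near_eq_cvg; near=> n.
rewrite stepE ifF //; apply/negbTE; rewrite -ltNge -ltr_pdivrMr //.
near: n; exact: near_succ_gt.
Unshelve. all: by end_near. Qed.

Lemma cutoff_cvg1 x : box x -> cutoff n x @[n --> \oo] --> (1 : R).
Proof.
move=> bx.
have c1 i : cut1 n i x @[n --> \oo] --> (1 : R).
  have /andP[x0 xL] := bx i; rewrite -[X in _ --> X](mulr1 1).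
  by apply: cvgM; apply: step_cvg1; rewrite ?subr_gt0.
have E : 1 = 1 * 1 * 1 :> R by rewrite !mulr1.
rewrite [X in _ --> X]E; exact: cvgM (cvgM (c1 0) (c1 1)) (c1 2).
Qed.

Definition dcut1 n i x : R :=
  n.+1%:R * dstep (n.+1%:R * xcoord i x) * rstep n i x
  - lstep n i x * (n.+1%:R * dstep (n.+1%:R * (L i - xcoord i x))).

Lemma derive_lstep n i j : 'D_(basis_vec j) (lstep n i) =
  fun x => (i == j)%:R * (n.+1%:R * dstep (n.+1%:R * xcoord i x)).
Proof.
rewrite lstepE derive_xcoordE; last exact/smooth1_affine/smooth1_step.
apply/funext => x; congr (_ * _).
have := is_derive_affine n.+1%:R 0 (xcoord i x) smooth1_step.
by move=> [_]; rewrite -derive1E => ->; rewrite derive1_step addr0.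
Qed.

Lemma derive_rstep n i j : 'D_(basis_vec j) (rstep n i) =
  fun x => - ((i == j)%:R * (n.+1%:R * dstep (n.+1%:R * (L i - xcoord i x)))).
Proof.
rewrite rstepE derive_xcoordE; last exact/smooth1_affine/smooth1_step.
apply/funext => x; rewrite -mulrN; congr (_ * _).
have := is_derive_affine (- n.+1%:R) (n.+1%:R * L i) (xcoord i x) smooth1_step.
move=> [_]; rewrite -derive1E => ->; rewrite derive1_step mulNr; congr (- (_ * dstep _)).
by ring.
Qed.

Lemma derive_cut1 n i j : 'D_(basis_vec j) (cut1 n i) =
  fun x => (i == j)%:R * dcut1 n i x.
Proof.
rewrite (derive_mulE j (smooth_lstep n i) (smooth_rstep n i)).
apply/funext => x; rewrite derive_lstep derive_rstep /dcut1 /=; ring.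
Qed.

Lemma derive_mul_at f g i x : smooth f -> smooth g ->
  'D_(basis_vec i) (f \* g) x =
  'D_(basis_vec i) f x * g x + f x * 'D_(basis_vec i) g x.
Proof. by move=> sf sg; exact: (congr1 (@^~ x) (derive_mulE i sf sg)). Qed.

(** Only the [i]-th factor depends on [x_i], and the other two lie in [0, 1]. *)
Lemma derive_cutoff_le n i x :
  `|'D_(basis_vec i) (cutoff n) x| <= `|dcut1 n i x|.
Proof.
have -> : 'D_(basis_vec i) (cutoff n) x =
  (((0 == i)%:R * dcut1 n 0 x) * cut1 n 1 x
  + cut1 n 0 x * ((1 == i)%:R * dcut1 n 1 x)) * cut1 n 2 x
  + (cut1 n 0 x * cut1 n 1 x) * ((2 == i)%:R * dcut1 n 2 x).
  have dE j : 'D_(basis_vec i) (cut1 n j) x = (j == i)%:R * dcut1 n j x.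
    exact: (congr1 (@^~ x) (derive_cut1 n j i)).
  have sc := smooth_cut1 n.
  rewrite -!dE -(derive_mul_at _ _ (sc 0) (sc 1)).
  exact: derive_mul_at (smoothM (sc 0) (sc 1)) (sc 2).
have /andP[a0 a1] := cut1_itv n 0 x; have /andP[b0 b1] := cut1_itv n 1 x.
have /andP[c0 c1] := cut1_itv n 2 x.
have le (u v d : R) : 0 <= u -> u <= 1 -> 0 <= v -> v <= 1 -> `|u * v * d| <= `|d|.
  move=> u0 u1 v0 v1; rewrite normrM ler_piMl // ger0_norm ?mulr_ge0//.
  exact: mulr_ile1.
have [<-|[<-|<-]] := ord3_cases i; rewrite /= !(mul1r, mul0r, mulr0, addr0, add0r).
- by rewrite (_ : _ * _ * _ = cut1 n 1 x * cut1 n 2 x * dcut1 n 0 x);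
    [exact: le|ring].
- by rewrite (_ : _ * _ * _ = cut1 n 0 x * cut1 n 2 x * dcut1 n 1 x);
    [exact: le|ring].
- exact: le.
Qed.

(** Two estimates in terms of [d = x_i (L_i - x_i)]. The first is uniform in [n] and provides a
    dominating function; the second, with its additional factor [(n+1) d], gives convergence to 0 at
    each fixed point. *)
Lemma dcut1_bound i : exists2 C : R, 0 <= C & forall n x, box x ->
  xcoord i x * (L i - xcoord i x) * `|dcut1 n i x| <= C /\
  n.+1%:R * (xcoord i x * (L i - xcoord i x)) ^+ 2 * `|dcut1 n i x| <= C.
Proof.
have [C C0 HC] := dstep_bound; have Li0 := ltW (L_gt0 i).
exists (C * L i + C * L i ^+ 2 + (C * L i + C * L i ^+ 2)).
  by rewrite !addr_ge0 // mulr_ge0 // exprn_ge0.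
move=> n x bx; have /andP[x0 xL] := bx i.
set t := xcoord i x in x0 xL *; set s := L i - t.
have s0 : 0 < s by rewrite subr_gt0.
have Ni : 0 <= n.+1%:R :> R by rewrite ler0n.
have t0 := ltW x0; have s0' := ltW s0.
have d1 : `|dcut1 n i x| <=
    n.+1%:R * `|dstep (n.+1%:R * t)| + n.+1%:R * `|dstep (n.+1%:R * s)|.
  apply: le_trans (ler_normB _ _) _; apply: lerD.
    rewrite normrM normrM (ger0_norm Ni) ler_piMr ?mulr_ge0//.
    by rewrite ger0_norm ?step_ge0 // step_le1.
  rewrite normrM normrM (ger0_norm Ni) ler_piMl ?mulr_ge0//.
  by rewrite ger0_norm ?step_ge0 // step_le1.
have b1 r : 0 < r -> r * (n.+1%:R * `|dstep (n.+1%:R * r)|) <= C.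
  move=> /ltW r0; have [+ _] := HC (n.+1%:R * r); rewrite normrM ger0_norm; last first.
    exact: mulr_ge0.
  by congr (_ <= _); ring.
have b2 r : 0 < r -> n.+1%:R * r ^+ 2 * (n.+1%:R * `|dstep (n.+1%:R * r)|) <= C.
  move=> /ltW r0; have [_] := HC (n.+1%:R * r); rewrite normrM ger0_norm; last first.
    by rewrite exprn_ge0 // mulr_ge0.
  by congr (_ <= _); ring.
have := b1 t x0; have := b1 s s0; have := b2 t x0; have := b2 s s0.
set a := n.+1%:R * `|dstep (n.+1%:R * t)| in d1 *.
set b := n.+1%:R * `|dstep (n.+1%:R * s)| in d1 *.
have tL : t <= L i by exact: ltW.
have sL : s <= L i by rewrite /s gerBl ltW.
have a0 : 0 <= a by exact: mulr_ge0.
have b0 : 0 <= b by exact: mulr_ge0.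
move=> H4 H3 H2 H1; split.
  apply: (@le_trans _ _ (C * L i + C * L i)); last first.
    have := mulr_ge0 C0 (sqr_ge0 (L i)); lra.
  apply: (@le_trans _ _ (t * s * (a + b))); first by rewrite ler_wpM2l ?mulr_ge0.
  rewrite mulrDr lerD //.
    by rewrite (_ : t * s * a = t * a * s); [rewrite ler_pM ?mulr_ge0|ring].
  by rewrite (_ : t * s * b = s * b * t); [rewrite ler_pM ?mulr_ge0|ring].
apply: (@le_trans _ _ (C * L i ^+ 2 + C * L i ^+ 2)); last first.
  have := mulr_ge0 C0 (ltW (L_gt0 i)); lra.
apply: (@le_trans _ _ (n.+1%:R * (t * s) ^+ 2 * (a + b))).
  by rewrite ler_wpM2l ?mulr_ge0 ?sqr_ge0.
have ts : t ^+ 2 <= L i ^+ 2 by rewrite ler_sqr ?nnegrE.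
have ss : s ^+ 2 <= L i ^+ 2 by rewrite ler_sqr ?nnegrE.
rewrite mulrDr lerD //.
  rewrite (_ : _ * a = n.+1%:R * t ^+ 2 * a * s ^+ 2); last by ring.
  by rewrite ler_pM ?mulr_ge0 ?sqr_ge0.
rewrite (_ : _ * b = n.+1%:R * s ^+ 2 * b * t ^+ 2); last by ring.
by rewrite ler_pM ?mulr_ge0 ?sqr_ge0.
Qed.

(** The mean value theorem from both faces bounds [f] by [M] times the distance to the nearer one.
    The other distance is at least [L_i / 2], whence the constant [2 M / L_i]. *)
Lemma vanishing_bound f i : smooth f ->
  (forall x, xcoord i x = 0 \/ xcoord i x = L i -> f x = 0) ->
  exists2 K : R, 0 <= K & forall x, box x ->
    `|f x| <= K * (xcoord i x * (L i - xcoord i x)).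
Proof.
move=> sf f0.
have [M M0 HM] := continuous_cbox_bounded L (smooth_continuous (smooth_derive i sf)).
exists (2 * M / L i); first by rewrite divr_ge0 ?mulr_ge0 ?ltW.
move=> x bx; have /andP[x0 xL] := bx i.
set t := xcoord i x in x0 xL *.
pose k s := f (s *: basis_vec i + ((- t) *: basis_vec i + x)).
have pt (s : R) j : xcoord j (s *: basis_vec i + ((- t) *: basis_vec i + x)) =
    (j == i)%:R * (s - t) + xcoord j x.
  by rewrite !xcoord_line; ring.
have cb (s : R) : 0 <= s <= L i ->
    cbox (s *: basis_vec i + ((- t) *: basis_vec i + x)).
  move=> sL j; rewrite pt; have [->|_] := eqVneq j i.
    by rewrite mul1r -/t subrK.
  by rewrite mul0r add0r; have /andP[/ltW-> /ltW->] := bx j.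
have dk (s : R) : is_derive s 1 k
    ('D_(basis_vec i) f (s *: basis_vec i + ((- t) *: basis_vec i + x))).
  by apply: is_derive_line; exact: smooth_derivable.
have kc : continuous k.
  by move=> s; apply: differentiable_continuous; apply/derivable1_diffP;
    have [] := dk s.
have k0 : k 0 = 0 by apply: f0; left; rewrite pt eqxx mul1r -/t; ring.
have kL : k (L i) = 0 by apply: f0; right; rewrite pt eqxx mul1r -/t; ring.
have kt : k t = f x.
  by congr f; apply: point_ext => j; rewrite pt subrr mulr0 add0r.
have mvt a b : 0 <= a -> a <= b -> b <= L i -> `|k b - k a| <= M * (b - a).
  move=> a0 ab bL.
  have [c] := MVT_segment ab (fun s _ => dk s) (continuous_subspaceT kc).
  rewrite in_itv /= => /andP[ac cb' ->]; rewrite normrM (ger0_norm (_ : 0 <= b - a)).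
    rewrite ler_wpM2r ?subr_ge0 //; apply: HM; apply: cb.
    by rewrite (le_trans a0 ac) (le_trans cb').
  by rewrite subr_ge0.
have h1 : `|f x| <= M * t.
  by have := mvt 0 t (lexx _) (ltW x0) (ltW xL); rewrite kt k0 !subr0.
have h2 : `|f x| <= M * (L i - t).
  by have := mvt t (L i) (ltW x0) (ltW xL) (lexx _); rewrite kt kL sub0r normrN.
rewrite mulrAC ler_pdivlMr //.
have [tl|tl] := leP t (L i / 2).
  apply: le_trans (ler_wpM2r (ltW (L_gt0 i)) h1) _.
  have h : 0 <= L i - 2 * t by lra.
  by have := mulr_ge0 (mulr_ge0 (ltW M0) (ltW x0)) h; lra.
apply: le_trans (ler_wpM2r (ltW (L_gt0 i)) h2) _.
have h : 0 <= 2 * t - L i by lra.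
have h' : 0 <= L i - t by lra.
by have := mulr_ge0 (mulr_ge0 (ltW M0) h') h; lra.
Qed.

(** The passage from test functions to functions that are smooth up to the boundary. *)
Lemma Ibox_cutoff f g : L2 g -> smooth f ->
  Ibox (fun x => g x * (f x * cutoff n x)) @[n --> \oo] --> Ibox (g \* f).
Proof.
move=> Lg sf.
have [M M0 fM] := continuous_cbox_bounded L (smooth_continuous sf).
have [] // := @Ibox_dominated _ L (fun n x => g x * (f x * cutoff n x))
  (g \* f) (fun x => M * `|g x|).
- move=> n; apply: measurable_realfun.measurable_funM; first exact: L2_measurable.
  exact: mbox_continuous (smooth_continuous (smoothM sf (smooth_cutoff n))).
- move=> x bx; apply: cvgM; first exact: cvg_cst.
  by rewrite -[X in _ --> X]mulr1; apply: cvgM; [exact: cvg_cst|exact: cutoff_cvg1].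
- apply: integZ => //.
  have := L2_integ L_gt0 Lg; rewrite /integ /= => /integrable_norm.
  exact: integ_eq.
- move=> n x bx; rewrite normrM mulrC ler_wpM2r // normrM.
  have /andP[c0 c1] := cutoff_itv n x.
  rewrite (ger0_norm c0) -[leRHS]mulr1 ler_pM //.
  exact/fM/box_cbox.
Qed.

End Cutoff.

(** * Density of trigonometric polynomials *)

Section Density.
Context {R : realType} (L : 'I_3 -> R).
Hypothesis L_gt0 : forall i, 0 < L i.
Local Notation T3 := (R3 R).
Local Notation box := (box L).
Local Notation integ := (integ L).
Local Notation mbox := (mbox L).
Local Notation Ibox := (Ibox L).
Local Notation L2 := (L2 L).
Implicit Types (f g h : R * R * R -> R) (i j : 'I_3) (n : nat) (x : R * R * R).

Definition sqdist f g : R := Ibox (fun x => (f x - g x) ^+ 2).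

Lemma integ_sqB f g : L2 f -> L2 g -> integ (fun x => (f x - g x) ^+ 2).
Proof. by move=> Lf Lg; apply: L2_sqr_integ; exact: L2B. Qed.

Lemma Ibox_le f g : integ f -> integ g -> (forall x, box x -> f x <= g x) ->
  Ibox f <= Ibox g.
Proof.
move=> fi gi fg; rewrite -subr_ge0 -IboxN // -IboxD //; last exact: integN.
by apply: Ibox_ge0 => x bx /=; rewrite subr_ge0 fg.
Qed.

Lemma sqdist_ge0 f g : 0 <= sqdist f g.
Proof. by apply: Ibox_ge0 => x _; exact: sqr_ge0. Qed.

Lemma sqdist_triangle f g h : L2 f -> L2 g -> L2 h ->
  sqdist f h <= 2 * sqdist f g + 2 * sqdist g h.
Proof.
move=> Lf Lg Lh; have fg := integ_sqB Lf Lg; have gh := integ_sqB Lg Lh.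
rewrite /sqdist -!IboxZ // -IboxD; try exact: integZ.
apply: Ibox_le; [exact: integ_sqB|by apply: integD; exact: integZ|].
move=> x _ /=; have := sqr_ge0 ((f x - g x) - (g x - h x)); nra.
Qed.

Lemma sqdist_eq f g f' g' : (forall x, box x -> f x = f' x) ->
  (forall x, box x -> g x = g' x) -> sqdist f g = sqdist f' g'.
Proof. by move=> ff gg; apply: Ibox_eq => x bx; rewrite ff ?gg. Qed.

Definition L2closure (P : (R * R * R -> R) -> Prop) f : Prop :=
  L2 f /\ forall e : R, 0 < e -> exists2 p, P p & sqdist f p < e.

Variable P : (R * R * R -> R) -> Prop.
Hypothesis P_L2 : forall p, P p -> L2 p.
Hypothesis P_add : forall p q, P p -> P q -> P (p \+ q).
Hypothesis P_scale : forall c p, P p -> P (fun x => c * p x).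

Lemma L2closure_sub p : P p -> L2closure P p.
Proof.
move=> Pp; split=> [|e e0]; first exact: P_L2.
by exists p => //; rewrite /sqdist Ibox0 // => x _; rewrite subrr expr0n.
Qed.

Lemma L2closure_lim f : L2 f ->
  (forall e : R, 0 < e -> exists2 g, L2closure P g & sqdist f g < e) ->
  L2closure P f.
Proof.
move=> Lf H; split=> // e e0.
have e4 : 0 < e / 4 by rewrite divr_gt0.
have [g [Lg Hg] fg] := H _ e4; have [p Pp gp] := Hg _ e4.
exists p => //; apply: le_lt_trans (sqdist_triangle Lf Lg (P_L2 Pp)) _; lra.
Qed.

Lemma L2closure_eq f g : (forall x, box x -> f x = g x) ->
  L2closure P f -> L2closure P g.
Proof.
move=> fg [Lf Hf]; split=> [|e /Hf[p Pp fp]]; first exact: L2_eq Lf.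
by exists p => //; rewrite -(@sqdist_eq f p).
Qed.

Lemma L2closureD f g : L2closure P f -> L2closure P g -> L2closure P (f \+ g).
Proof.
move=> [Lf Hf] [Lg Hg]; split=> [|e e0]; first exact: L2D.
have e4 : 0 < e / 4 by rewrite divr_gt0.
have [p Pp fp] := Hf _ e4; have [q Pq gq] := Hg _ e4.
exists (p \+ q); first exact: P_add.
have ifp := integ_sqB Lf (P_L2 Pp); have igq := integ_sqB Lg (P_L2 Pq).
apply: (@le_lt_trans _ _ (2 * sqdist f p + 2 * sqdist g q)); last by lra.
rewrite /sqdist -!IboxZ // -IboxD; try exact: integZ.
apply: Ibox_le; [|by apply: integD; exact: integZ|].
  by apply: integ_sqB; apply: L2D => //; exact: P_L2.
move=> x _ /=; have := sqr_ge0 ((f x - p x) - (g x - q x)); nra.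
Qed.

Lemma L2closureZ (c : R) f : L2closure P f -> L2closure P (fun x => c * f x).
Proof.
move=> [Lf Hf]; split=> [|e e0]; first exact: L2Z.
have c0 : 0 < c ^+ 2 + 1 by rewrite ltr_wpDl ?sqr_ge0.
have [p Pp fp] := Hf _ (divr_gt0 e0 c0); exists (fun x => c * p x); first exact: P_scale.
have ifp := integ_sqB Lf (P_L2 Pp).
have -> : sqdist (fun x => c * f x) (fun x => c * p x) = c ^+ 2 * sqdist f p.
  by rewrite /sqdist -IboxZ //; apply: Ibox_eq => x _; rewrite -mulrBr exprMn.
move: fp; rewrite ltr_pdivlMr // => fp; apply: le_lt_trans fp.
by rewrite mulrC ler_wpM2l ?sqdist_ge0 // lerDl.
Qed.

Lemma L2closure_bounded_lim (F : nat -> R * R * R -> R) f g :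
  (forall n, L2closure P (F n)) -> L2 g ->
  (forall x, box x -> F n x @[n --> \oo] --> f x) ->
  (forall n x, box x -> `|F n x| <= g x) -> L2closure P f.
Proof.
move=> PF Lg Ff Fg.
have mF n : mbox (F n) by have [/L2_measurable] := PF n.
have fg x : box x -> `|f x| <= g x.
  by move=> bx; apply: (cvgr_to_le (cvg_norm (Ff x bx))); apply: nearW => n; exact: Fg.
have mf : mbox f by apply: (measurable_fun_cvg mF) => x /Ff; exact.
have Lf : L2 f.
  apply/L2P; split=> //; apply: (integ_le _ (L2_sqr_integ Lg)) => [|x bx].
    exact: measurable_realfun.measurable_funX.
  rewrite normrX ler_sqr ?nnegrE ?fg // (le_trans _ (fg x bx)) //.
have [_ cvg0] : integ (cst 0) /\ sqdist f (F n) @[n --> \oo] --> Ibox (cst 0).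
  apply: (@Ibox_dominated _ L (fun n x => (f x - F n x) ^+ 2) (cst 0)
    (fun x => 4 * g x ^+ 2)).
  - move=> n; apply: measurable_realfun.measurable_funX.
    exact: (measurable_realfun.measurable_funB mf (mF n)).
  - move=> x bx; rewrite [X in _ --> X](_ : _ = (f x - f x) ^+ 2).
      by rewrite expr2; apply: cvgM; apply: cvgB;
        do ?[exact: cvg_cst|exact: Ff].
    by rewrite subrr expr0n.
  - by apply: integZ; exact: L2_sqr_integ.
  - move=> n x bx; rewrite normrX (_ : 4 * g x ^+ 2 = (g x + g x) ^+ 2); last by ring.
    have g0 : 0 <= g x by exact: le_trans (fg x bx).
    rewrite ler_sqr ?nnegrE ?addr_ge0 //; apply: le_trans (ler_normB _ _) _.
    by apply: lerD; [exact: fg|exact: Fg].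
apply: L2closure_lim => // e e0.
move: cvg0; rewrite Ibox0 // => /cvgr_lt/(_ e e0)[n _ Hn].
by exists (F n); [exact: PF|exact: (Hn n (leqnn n))].
Qed.

Lemma L2closure_sum I (r : seq I) (F : I -> R * R * R -> R) :
  (forall a, L2closure P (F a)) ->
  (exists p, P p) -> L2closure P (fun x => \sum_(a <- r) F a x).
Proof.
move=> PF [p Pp]; elim: r => [|a r IH].
  apply: L2closure_eq (L2closureZ 0 (L2closure_sub Pp)) => x _.
  by rewrite big_nil mul0r.
by apply: L2closure_eq (L2closureD (PF a) IH) => x _; rewrite big_cons.
Qed.

(** These sets form a generating pi-system, and their indicators factor over the coordinates, each
    factor being a limit of polynomials in a cosine. *)
Definition octant (a : R * R * R) : set T3 :=
  [set x | [/\ x.1.1 < a.1.1, x.1.2 < a.1.2 & x.2 < a.2]].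

Lemma measurable_octants : @measurable _ T3 = <<s range octant >>.
Proof.
rewrite eqEsubset; split=> A; last first.
  apply: smallest_sub; first exact: sigma_algebra_measurable.
  move=> _ [a _ <-].
  rewrite (_ : octant a = (`]-oo, a.1.1[ `*` `]-oo, a.1.2[) `*` `]-oo, a.2[).
    by do 2?apply: measurableX; exact: measurable_itv.
  apply/seteqP; split=> x /=; rewrite /octant /= !in_itv /=; first by case.
  by move=> [[]].
pose S := g_sigma_algebraType (range octant).
have mo a : measurable (octant a : set S) by apply: sub_sigma_algebra; exists a.
(* A coordinate half-space is a countable union of octants: the bounds on the other two coordinates
   run through the naturals. *)
have coord (p : T3 -> R) : (forall b, (exists F : nat -> R * R * R,
    [set x | p x < b] = \bigcup_n octant (F n))) ->
    measurable_fun setT (p : S -> measurableTypeR R).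
  move=> H; apply: (measurability _ (RGenInftyO.measurableE R)).
  move=> /= _ [_ [b ->] <-]; rewrite setTI.
  have [F HF] := H b; rewrite (_ : _ @^-1` _ = \bigcup_n octant (F n)).
    exact: bigcupT_measurable.
  by rewrite -HF; apply/seteqP; split=> x /=; rewrite in_itv.
have big (t : R) : exists n : nat, forall m, (n <= m)%N -> t < m%:R.
  have [n _ nP] := nbhs_infty_gtr t; exists n => m nm; exact: nP.
have m0 : measurable_fun setT ((fun x => x.1.1) : S -> measurableTypeR R).
  apply: coord => b; exists (fun n => (b, n%:R, n%:R)); apply/seteqP; split=> x /=.
    have [n1 h1] := big x.1.2; have [n2 h2] := big x.2.
    by exists (maxn n1 n2) => //; split=> //=; [apply: h1|apply: h2];
      rewrite ?leq_maxl ?leq_maxr.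
  by move=> [n _ []].
have m1 : measurable_fun setT ((fun x => x.1.2) : S -> measurableTypeR R).
  apply: coord => b; exists (fun n => (n%:R, b, n%:R)); apply/seteqP; split=> x /=.
    have [n1 h1] := big x.1.1; have [n2 h2] := big x.2.
    by exists (maxn n1 n2) => //; split=> //=; [apply: h1|apply: h2];
      rewrite ?leq_maxl ?leq_maxr.
  by move=> [n _ []].
have m2 : measurable_fun setT ((fun x => x.2) : S -> measurableTypeR R).
  apply: coord => b; exists (fun n => (n%:R, n%:R, b)); apply/seteqP; split=> x /=.
    have [n1 h1] := big x.1.1; have [n2 h2] := big x.1.2.
    by exists (maxn n1 n2) => //; split=> //=; [apply: h1|apply: h2];
      rewrite ?leq_maxl ?leq_maxr.
  by move=> [n _ []].
move=> mA.
have := measurable_fun_pair (measurable_fun_pair m0 m1) m2 measurableT mA.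
rewrite setTI (_ : _ @^-1` _ = A) //.
by apply/seteqP; split=> -[[a b] c].
Qed.

Lemma octants_setI : setI_closed (range octant).
Proof.
move=> _ _ [a _ <-] [b _ <-].
exists (Num.min a.1.1 b.1.1, Num.min a.1.2 b.1.2, Num.min a.2 b.2) => //.
apply/seteqP; split=> x; rewrite /octant /= !lt_min.
  by move=> [/andP[? ?] /andP[? ?] /andP[? ?]].
by move=> [[? ? ?] [? ? ?]]; split; apply/andP.
Qed.

Variable s : R * R * R -> R.
Hypothesis s_meas : mbox s.
Hypothesis s_gt0 : forall x, box x -> 0 < s x <= 1.
Hypothesis s_octant : forall a, L2closure P (fun x => \1_(octant a) x * s x).

Let s_normr x : box x -> `|s x| <= 1.
Proof. by move=> /s_gt0/andP[s0 s1]; rewrite ger0_norm // ltW. Qed.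

(** By the pi-lambda theorem, from the octants. The indicators carry a factor [s], later a sine,
    because the approximants of a given parity are obtained as that sine times polynomials in
    cosines. *)
Lemma L2closure_indic (A : set T3) : measurable A ->
  L2closure P (fun x => \1_A x * s x).
Proof.
rewrite measurable_octants.
apply: (dynkin_induction (P := fun A => L2closure P (fun x => \1_A x * s x))
  measurable_octants octants_setI).
- apply: L2closure_eq (s_octant (L 0, L 1, L 2)) => x bx; congr (_ * _).
  rewrite !indicE in_setT mem_set //; split.
  + by have /andP[] := bx 0.
  + by have /andP[] := bx 1.
  + by have /andP[] := bx 2.
- by move=> _ [a _ <-]; exact: s_octant.
- move=> {}A mA HA.
  have HT : L2closure P (fun x => \1_(@setT T3) x * s x).
    apply: L2closure_eq (s_octant (L 0, L 1, L 2)) => x bx; congr (_ * _).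
    rewrite !indicE in_setT mem_set //; split.
    + by have /andP[] := bx 0.
    + by have /andP[] := bx 1.
    + by have /andP[] := bx 2.
  apply: L2closure_eq (L2closureD HT (L2closureZ (-1) HA)) => x _ /=.
  rewrite !indicE in_setT in_setC; case: (x \in A); rewrite /=; ring.
- move=> F mF tF HF; have HA0 := HF 0%N.
  have [p Pp] : exists p, P p by have [_ /(_ 1 ltr01)[p Pp _]] := HA0; exists p.
  apply: (@L2closure_bounded_lim
    (fun n x => \sum_(k <- iota 0 n) \1_(F k) x * s x) _ (cst 1)).
  + by move=> n; apply: L2closure_sum => //; exists p.
  + exact: L2_cst.
  + move=> x bx.
    have [[k _ Fkx]|nF] := pselect ((\bigcup_k F k) x); last first.
      rewrite indicE memNset // mul0r; under eq_cvg.
        move=> n; rewrite big1_seq; first over.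
        by move=> k _; rewrite indicE memNset ?mul0r // => Fk; apply: nF; exists k.
      exact: cvg_cst.
    rewrite indicE mem_set; last by exists k.
    rewrite mul1r; apply: cvg_near_cst; near=> n.
    rewrite (bigD1_seq k) ?iota_uniq //=; last by rewrite mem_iota add0n; near: n; exact: nbhs_infty_gt.
    rewrite indicE mem_set // mul1r big1_seq ?addr0 // => l /andP[lk _].
    rewrite indicE memNset ?mul0r // => Flx; move/eqP: lk; apply.
    have /trivIsetP/(_ l k I I) := tF; have [//|lk /(_ isT)] := eqVneq l k.
    by move=> /seteqP[/(_ x) + _]; case.
  + move=> n x bx; rewrite -mulr_suml normrM -[leRHS]mulr1 ler_pM // ?s_normr //.
    have H : \sum_(k <- iota 0 n) \1_(F k) x <= 1 :> R.
      have [[k Fkx]|nF] := pselect (exists k, F k x); last first.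
        rewrite big1_seq // => k _; rewrite indicE memNset // => Fk.
        by apply: nF; exists k.
      have E l : l != k -> \1_(F l) x = 0 :> R.
        move=> lk; rewrite indicE memNset // => Flx.
        by have /trivIsetP/(_ l k I I lk)/seteqP[/(_ x) + _] := tF; case.
      have [kn|kn] := boolP (k \in iota 0 n).
        by rewrite (bigD1_seq k) ?iota_uniq //= big1 ?addr0.
      rewrite big1_seq // => l /andP[_ ln]; apply: E.
      by apply: contraNneq kn => <-.
    by rewrite ger0_norm // sumr_ge0.
Unshelve. all: by end_near. Qed.

Import HBNNSimple.

(** The quotient [f / s] need not be square integrable, but its simple approximations from below,
    multiplied by [s], stay below [f], which is. *)
Lemma L2closure_ge0 f : L2 f -> (forall x, box x -> 0 <= f x) -> L2closure P f.
Proof.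
move=> Lf f0.
pose h x := f x / s x.
have mh : measurable_fun (box : set T3) (EFin \o h).
  apply/measurable_EFinP; apply: measurable_realfun.measurable_funM; first exact: L2_measurable.
  (* Measurability of [1 / s] on the box, as the exponential of [- ln s]. *)
  apply: (eq_measurable_fun (fun x => expR (- ln (s x)))).
    move=> x; rewrite inE => /s_gt0/andP[s0 _].
    by rewrite expRN lnK // posrE.
  apply: measurableT_comp; first exact: measurable_expR.
  apply: measurableT_comp; first exact: measurable_realfun.oppr_measurable.
  apply: measurableT_comp; [exact: measurable_ln|exact: s_meas].
pose a := nnsfun_approx (measurable_box L) mh.
have h0 x : box x -> (0 <= (EFin \o h) x)%E.
  by move=> bx; rewrite lee_fin divr_ge0 ?f0 // ltW //; have /andP[] := s_gt0 bx.
have acvg x : box x -> a n x @[n --> \oo] --> h x.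
  by move=> bx; exact: (fine_cvg (cvg_nnsfun_approx (measurable_box L) mh h0 bx)).
have ale n x : box x -> a n x <= h x.
  move=> bx; have nd : nondecreasing_seq (fun n => a n x).
    by move=> m k mk; have /lefP := nd_nnsfun_approx (measurable_box L) mh mk; exact.
  have := nondecreasing_cvgn_le nd (cvgP _ (acvg x bx)) n.
  by rewrite (cvg_lim _ (acvg x bx)).
have hs x : box x -> h x * s x = f x.
  by move=> bx; rewrite /h divfK // gt_eqF //; have /andP[] := s_gt0 bx.
apply: (@L2closure_bounded_lim (fun n x => a n x * s x) f f) => //.
- move=> n; pose t : seq R := finmap.enum_fset (fset_set (range (a n))).
  have [p Pp] : exists p, P p.
    by have [_ /(_ 1 ltr01)[p Pp _]] := s_octant (0, 0, 0); exists p.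
  have H := @L2closure_sum R t (fun y x => y * (\1_(a n @^-1` [set y]) x * s x)) _ (ex_intro _ p Pp).
  apply: L2closure_eq (H _) => [x _|y].
    rewrite [in RHS]fimfunE fsbig_finite //= mulr_suml.
    by apply: eq_bigr => y _; rewrite mulrA.
  apply: L2closureZ; apply: L2closure_indic.
  exact: measurable_sfunP.
- move=> x bx; rewrite -hs //; apply: cvgM; [exact: acvg|exact: cvg_cst].
- move=> n x bx; have /andP[s0 _] := s_gt0 bx.
  by rewrite ger0_norm ?mulr_ge0 // -?hs ?ler_wpM2r ?ale // ltW.
Qed.

Lemma L2closureT f : L2 f -> L2closure P f.
Proof.
move=> Lf.
have Lp : L2 (fun x => Num.max (f x) 0).
  apply/L2P; split.
    by apply: measurable_realfun.measurable_maxr; [exact: L2_measurable|exact: measurable_cst].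
  apply: (integ_le _ (L2_sqr_integ Lf)) => [|x bx].
    apply: measurable_realfun.measurable_funX.
    by apply: measurable_realfun.measurable_maxr; [exact: L2_measurable|exact: measurable_cst].
  rewrite normrX; have [f0|f0] := leP (f x) 0; first by rewrite normr0 expr0n sqr_ge0.
  by rewrite real_normK ?num_real.
have Lm : L2 (fun x => Num.max (f x) 0 - f x) by exact: L2B.
have H1 := L2closure_ge0 Lp (fun x _ => ltac:(by rewrite le_max lexx orbT)).
have H2 := L2closure_ge0 Lm (fun x _ => ltac:(by rewrite subr_ge0 le_max lexx)).
apply: L2closure_eq (L2closureD H1 (L2closureZ (-1) H2)) => x _ /=; ring.
Qed.

End Density.

(** * Polynomials approximating a step function *)

Section StepApprox.
Context {R : realType}.
Implicit Types (n : nat) (r d u y t : R).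

(** One term of the binomial expansion of the right-hand side. When [r + d < 1] it shows that
    [n r^n] tends to 0. *)
Lemma mul_expn_le r d n : 0 <= r -> 0 <= d ->
  n.+1%:R * r ^+ n * d <= (r + d) ^+ n.+1.
Proof.
move=> r0 d0; elim: n => [|n IH]; first by rewrite expr0 expr1 !mul1r lerDr.
rewrite [leRHS]exprS [leRHS]mulrDl.
have H1 := ler_wpM2l r0 IH.
have H2 : d * r ^+ n.+1 <= d * (r + d) ^+ n.+1.
  by rewrite ler_wpM2l // lerXn2r ?nnegrE ?addr_ge0 // lerDl.
apply: le_trans (lerD H1 H2); rewrite le_eqVlt; apply/orP; left; apply/eqP.
by rewrite !exprS -[n.+2%:R]natr1; ring.
Qed.

Lemma cvg_mul_expn r : 0 <= r < 1 -> n%:R * r ^+ n @[n --> \oo] --> (0 : R).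
Proof.
move=> /andP[r0 r1]; pose d := (1 - r) / 2.
have d0 : 0 < d by rewrite divr_gt0 ?subr_gt0.
have q1 : `|r + d| < 1 by rewrite ger0_norm ?addr_ge0 ?(ltW d0) // /d; lra.
apply: (@squeeze_cvgr _ _ _ _ (cst 0) (fun n => d^-1 * (r + d) ^+ n)).
- apply: nearW => n; rewrite mulr_ge0 ?exprn_ge0 //=.
  case: n => [|n]; first by rewrite mul0r mulr_ge0 ?invr_ge0 ?exprn_ge0 ?addr_ge0 // ltW.
  rewrite [leRHS]mulrC ler_pdivlMr //; apply: le_trans (mul_expn_le n r0 (ltW d0)).
  rewrite ler_wpM2r ?(ltW d0) // ler_wpM2l // exprS ler_piMl ?exprn_ge0 //.
  exact: ltW.
- exact: cvg_cst.
- exact: cvg_geometric.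
Qed.

Lemma bernoulli_lo u n : 0 <= u <= 1 -> 1 - n%:R * u <= (1 - u) ^+ n.
Proof.
move=> /andP[u0 u1]; elim: n => [|n IH]; first by rewrite mul0r subr0 expr0.
have h : 0 <= 1 - u by rewrite subr_ge0.
rewrite exprS; apply: le_trans (ler_wpM2l h IH); rewrite -natr1.
by have := mulr_ge0 (mulr_ge0 u0 u0) (ler0n R n); lra.
Qed.

(** From [(1 - u)^n (1 + u)^n <= 1] and the Bernoulli inequality for [1 + u]. *)
Lemma bernoulli_hi u n : 0 <= u <= 1 -> (1 - u) ^+ n * (1 + n%:R * u) <= 1.
Proof.
move=> /andP[u0 u1].
have h : 1 + n%:R * u <= (1 + u) ^+ n.
  elim: n => [|n IH]; first by rewrite mul0r addr0 expr0.
  have h : 0 <= 1 + u by exact: addr_ge0.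
  rewrite exprS; apply: le_trans (ler_wpM2l h IH); rewrite -natr1.
  by have := mulr_ge0 (mulr_ge0 u0 u0) (ler0n R n); lra.
have h' : 0 <= (1 - u) ^+ n by rewrite exprn_ge0 // subr_ge0.
apply: le_trans (ler_wpM2l h' h) _; rewrite -exprMn.
rewrite (_ : (1 - u) * (1 + u) = 1 - u ^+ 2); last by ring.
by rewrite exprn_ile1 ?subr_ge0 ?exprn_ile1 // gerBl sqr_ge0.
Qed.

Lemma stone_itv y n m : 0 <= y <= 1 -> 0 <= (1 - y ^+ n) ^+ m <= 1.
Proof.
move=> /andP[y0 y1]; have h : 0 <= 1 - y ^+ n by rewrite subr_ge0 exprn_ile1.
by rewrite exprn_ge0 //= exprn_ile1 // gerBl exprn_ge0.
Qed.

(** These polynomials are modelled on an elementary proof of the Stone-Weierstrass theorem. The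
    exponent times [y^n] is [n (2 y)^n], which tends to 0 for [y < 1/2] and is at least [n] for
    [y >= 1/2]; the two Bernoulli inequalities conclude. The factor [n] in the exponent settles the
    value at [y = 1/2]. *)
Lemma stone_cvg y : 0 <= y <= 1 ->
  (1 - y ^+ n) ^+ (n * 2 ^ n) @[n --> \oo] --> ((y < 2^-1)%R%:R : R).
Proof.
move=> y01; have /andP[y0 y1] := y01.
have u01 n : 0 <= y ^+ n <= 1 by rewrite exprn_ge0 // exprn_ile1.
have NE n : (n * 2 ^ n)%:R * y ^+ n = n%:R * (2 * y) ^+ n :> R.
  by rewrite natrM natrX exprMn mulrA.
have [ylt|yge] := ltP y 2^-1.
  have r01 : 0 <= 2 * y < 1 by rewrite mulr_ge0 //=; lra.
  apply: (@squeeze_cvgr _ _ _ _ (fun n => 1 - n%:R * (2 * y) ^+ n) (cst 1)).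
  - apply: nearW => n; have /andP[_ ->] := stone_itv n (n * 2 ^ n) y01.
    by rewrite andbT -NE bernoulli_lo.
  - rewrite -[X in _ --> X]subr0; apply: cvgB; first exact: cvg_cst.
    exact: cvg_mul_expn.
  - exact: cvg_cst.
apply: (@squeeze_cvgr _ _ _ _ (cst 0) (fun n => n.+1%:R^-1)).
- apply: nearW => n; have /andP[-> _] /= := stone_itv n (n * 2 ^ n) y01.
  rewrite -div1r ler_pdivlMr ?ltr0n //.
  apply: le_trans (bernoulli_hi (n * 2 ^ n) (u01 n)).
  have /andP[q0 _] := stone_itv n (n * 2 ^ n) y01.
  rewrite ler_wpM2l // -natr1 addrC lerD2l NE ler_peMr // exprn_ege1 //; lra.
- exact: cvg_cst.
- exact: cvg_harmonic.
Qed.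

Lemma poly_step (c : R) : -1 <= c <= 1 -> exists Q : nat -> {poly R},
  forall t, -1 <= t <= 1 -> (forall n, 0 <= (Q n).[t] <= 1) /\
    (Q n).[t] @[n --> \oo] --> ((c < t)%R%:R : R).
Proof.
move=> /andP[c1 c2].
(* As [|c - t| <= 2], dividing by 4 keeps [1/2 + (c - t)/4] in [0, 1]; it is less than 1/2 iff
   [c < t]. *)
pose Y : {poly R} := (2^-1 + c / 4)%:P - (4^-1) *: 'X.
exists (fun n => (1 - Y ^+ n) ^+ (n * 2 ^ n)) => t /andP[t1 t2].
pose y := 2^-1 + (c - t) / 4.
have yE : Y.[t] = y by rewrite /Y !hornerE /y; field.
have QE n : ((1 - Y ^+ n) ^+ (n * 2 ^ n)).[t] = (1 - y ^+ n) ^+ (n * 2 ^ n).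
  by rewrite horner_exp hornerD hornerN hornerC horner_exp yE.
have y01 : 0 <= y <= 1 by rewrite /y; apply/andP; split; lra.
split=> [n|]; first by rewrite QE stone_itv.
under eq_cvg do rewrite QE.
have -> : (c < t) = (y < 2^-1) by rewrite /y gtrDl; apply/idP/idP; lra.
exact: stone_cvg.
Qed.

Lemma cos_step (l a : R) : 0 < l -> exists Q : nat -> {poly R},
  forall t, 0 < t < l -> (forall n, 0 <= (Q n).[cos (pi / l * t)] <= 1) /\
    (Q n).[cos (pi / l * t)] @[n --> \oo] --> ((t < a)%R%:R : R).
Proof.
move=> l0.
have [a0|a0] := leP a 0.
  exists (fun=> 0) => t /andP[t0 _]; split=> [n|]; first by rewrite horner0 lexx ler01.
  rewrite (ltNge t) (le_trans a0 (ltW t0)) /=; under eq_cvg do rewrite horner0.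
  exact: cvg_cst.
have [la|al] := leP l a.
  exists (fun=> 1) => t /andP[_ tl]; split=> [n|]; first by rewrite hornerC lexx ler01.
  rewrite (lt_le_trans tl la) /=; under eq_cvg do rewrite hornerC.
  exact: cvg_cst.
have [Q HQ] := poly_step (c := cos (pi / l * a)) (ltac:(by rewrite cos_geN1 cos_le1)).
exists Q => t /andP[t0 tl].
have := HQ (cos (pi / l * t)) (ltac:(by rewrite cos_geN1 cos_le1)).
have pil : 0 < pi / l :> R by rewrite divr_gt0 ?pi_gt0.
have inpi s : 0 < s -> s < l -> pi / l * s \in `[0, pi].
  move=> s0 sl; rewrite in_itv /= mulr_ge0 ?(ltW pil) ?(ltW s0) //=.
  by rewrite mulrAC ler_pdivrMr // ler_wpM2l ?pi_ge0 // ltW.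
by rewrite ltr_cos ?inpi // ltr_pM2l.
Qed.

End StepApprox.

(** * Products of sines and cosines *)

Section Trig.
Context {R : realType}.
Implicit Types (w : 'I_3 -> R) (b : 'I_3 -> bool) (i j l : 'I_3) (x : R * R * R).

Definition trig (c : bool) : R -> R := if c then sin else cos.

Definition tprod b w x : R := \prod_(l < 3) trig (b l) (w l * xcoord l x).

Lemma smooth1_trig c (a : R) : smooth1 (fun t => trig c (a * t)).
Proof.
have H : smooth1 (trig c) by case: c; [exact: smooth1_sin|exact: smooth1_cos].
have := @smooth1_affine _ _ a 0 H.
by congr smooth1; apply/funext => t; rewrite addr0.
Qed.

Definition tfactor b w l : R * R * R -> R :=
  (fun t => trig (b l) (w l * t)) \o xcoord l.

Lemma prod_ord3 (F : 'I_3 -> R) : \prod_(l < 3) F l = F 0 * F 1 * F 2.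
Proof.
rewrite 3!big_ord_recl big_ord0 mulr1 mulrA; congr (F _ * F _ * F _);
  exact: val_inj.
Qed.

Lemma sum_ord3 (V : nmodType) (F : 'I_3 -> V) : \sum_(l < 3) F l = F 0 + F 1 + F 2.
Proof.
rewrite 3!big_ord_recl big_ord0 addr0 addrA; congr (F _ + F _ + F _);
  exact: val_inj.
Qed.

Lemma tprodE b w : tprod b w = (tfactor b w 0 \* tfactor b w 1) \* tfactor b w 2.
Proof. by apply/funext => x; rewrite /tprod prod_ord3. Qed.

Lemma smooth_tfactor b w l : smooth (tfactor b w l).
Proof. by apply: (smooth_xcoord (h := fun t => trig (b l) (w l * t))); exact: smooth1_trig. Qed.

Lemma smooth_tprod b w : smooth (tprod b w).
Proof.
by rewrite tprodE; exact: (smoothM (smoothM (smooth_tfactor _ _ _)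
  (smooth_tfactor _ _ _)) (smooth_tfactor _ _ _)).
Qed.

Definition flip j b l : bool := if l == j then ~~ b l else b l.

Lemma derive1_trig c (a t : R) :
  (fun t => trig c (a * t))^`()%classic t =
  (if c then a else - a) * trig (~~ c) (a * t).
Proof.
have sc : smooth1 (trig c) by case: (c); [exact: smooth1_sin|exact: smooth1_cos].
have := is_derive_affine a 0 t sc.
rewrite (_ : (fun t => trig c (a * t + 0)) = (fun t => trig c (a * t))); last first.
  by apply/funext => s; rewrite addr0.
move=> [_]; rewrite -derive1E addr0 => ->.
case: (c) => /=.
  have -> : (@sin R)^`()%classic = cos by apply: derive1_funE; exact: is_derive_sin.
  by [].
have -> : (@cos R)^`()%classic = (fun t => - sin t).
  by apply: derive1_funE; exact: is_derive_cos.
by rewrite mulrN mulNr.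
Qed.

Lemma derive_tfactor b w l j x : 'D_(basis_vec j) (tfactor b w l) x =
  (l == j)%:R * ((if b l then w l else - w l) * trig (~~ b l) (w l * xcoord l x)).
Proof.
have := derive_xcoordE l j (@smooth1_trig (b l) (w l)).
by move=> /(congr1 (@^~ x)) /= ->; rewrite derive1_trig.
Qed.

Lemma derive_tprod b w j : 'D_(basis_vec j) (tprod b w) =
  fun x => (if b j then w j else - w j) * tprod (flip j b) w x.
Proof.
apply/funext => x; have st := smooth_tfactor b w.
rewrite tprodE.
have -> : 'D_(basis_vec j) (tfactor b w 0 \* tfactor b w 1 \* tfactor b w 2) x =
  ('D_(basis_vec j) (tfactor b w 0) x * tfactor b w 1 x
   + tfactor b w 0 x * 'D_(basis_vec j) (tfactor b w 1) x) * tfactor b w 2 x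
  + (tfactor b w 0 x * tfactor b w 1 x) * 'D_(basis_vec j) (tfactor b w 2) x.
  rewrite -(derive_mul_at _ _ (st 0) (st 1)).
  exact: (derive_mul_at _ _ (smoothM (st 0) (st 1)) (st 2)).
rewrite !derive_tfactor tprodE /tfactor /flip /=.
by have [<-|[<-|<-]] := ord3_cases j;
  rewrite /= !(mul1r, mul0r, mulr0, addr0, add0r) -?mulrA //; ring.
Qed.

End Trig.

(** * Density within each parity class *)

Section TrigDensity.
Context {R : realType} (L : 'I_3 -> R).
Hypothesis L_gt0 : forall i, 0 < L i.
Local Notation box := (box L).
Implicit Types (k : 'I_3 -> int) (i j l : 'I_3) (x : R * R * R).

Definition fr k l : R := (k l)%:~R * (pi / L l).

(** The parity of the [i]-th component of the fields [Y]. *)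
Definition ei i : 'I_3 -> bool := fun l => l == i.

(** Frequencies are integers of either sign, so that multiplication by a cosine shifts one of them
    by 1 and by -1 without case distinction. *)
Definition trigspan i (p : R * R * R -> R) : Prop :=
  exists r : seq (R * ('I_3 -> int)),
    p = fun x => \sum_(a <- r) a.1 * tprod (ei i) (fr a.2) x.

Lemma smooth_trigspan i p : trigspan i p -> smooth p.
Proof.
by move=> [r ->]; apply: smooth_sum => a _; apply: smoothZ; exact: smooth_tprod.
Qed.

Lemma trigspanD i p q : trigspan i p -> trigspan i q -> trigspan i (p \+ q).
Proof.
by move=> [r ->] [r' ->]; exists (r ++ r'); apply/funext => x; rewrite big_cat.
Qed.

Lemma trigspanZ i c p : trigspan i p -> trigspan i (fun x => c * p x).
Proof.
move=> [r ->]; exists [seq (c * a.1, a.2) | a <- r]; apply/funext => x.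
by rewrite big_map mulr_sumr; apply: eq_bigr => a _; rewrite mulrA.
Qed.

Lemma trigspan_tprod i k : trigspan i (tprod (ei i) (fr k)).
Proof. by exists [:: (1, k)]; apply/funext => x; rewrite big_seq1 mul1r. Qed.

Lemma trigspan_sum i I (r : seq I) (F : I -> R * R * R -> R) :
  (forall a, trigspan i (F a)) -> trigspan i (fun x => \sum_(a <- r) F a x).
Proof.
move=> FT; elim: r => [|a r IH].
  by exists [::]; apply/funext => x; rewrite !big_nil.
rewrite (_ : (fun _ => _) = F a \+ (fun x => \sum_(a <- r) F a x)).
  exact: trigspanD.
by apply/funext => x; rewrite big_cons.
Qed.

Lemma trig_mul_cos c (A B : R) :
  trig c A * cos B = (trig c (A + B) + trig c (A - B)) / 2.
Proof. by case: c => /=; rewrite !(sinD, cosD, sinN, cosN); field. Qed.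

Lemma tprodD1 b (w : 'I_3 -> R) l x : tprod b w x =
  trig (b l) (w l * xcoord l x) * \prod_(j < 3 | j != l) trig (b j) (w j * xcoord j x).
Proof. by rewrite /tprod (bigD1 l). Qed.

Lemma trigspan_mul_cos i l p : trigspan i p ->
  trigspan i (fun x => p x * cos (pi / L l * xcoord l x)).
Proof.
move=> [r ->].
rewrite (_ : (fun _ => _) = (fun x => \sum_(a <- r)
    (a.1 * (tprod (ei i) (fr a.2) x * cos (pi / L l * xcoord l x))))); last first.
  by apply/funext => x; rewrite mulr_suml; apply: eq_bigr => a _; rewrite mulrA.
apply: trigspan_sum => a; apply: trigspanZ.
pose kp (e : int) j := if j == l then a.2 j + e else a.2 j.
rewrite (_ : (fun _ => _) = (fun x => 2^-1 * tprod (ei i) (fr (kp 1)) x) \+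
    (fun x => 2^-1 * tprod (ei i) (fr (kp (-1))) x)).
  by apply: trigspanD; apply: trigspanZ; exact: trigspan_tprod.
apply/funext => x /=; rewrite !(tprodD1 _ _ l).
have rest e : \prod_(j < 3 | j != l) trig (ei i j) (fr (kp e) j * xcoord j x) =
    \prod_(j < 3 | j != l) trig (ei i j) (fr a.2 j * xcoord j x).
  by apply: eq_bigr => j jl; rewrite /fr /kp (negbTE jl).
rewrite !rest mulrAC trig_mul_cos /fr /kp eqxx !intrD.
set t := xcoord l x; set m := (a.2 l)%:~R; set q := pi / L l.
rewrite (_ : (m + 1%:~R) * q * t = m * q * t + q * t); last by ring.
rewrite (_ : (m + (-1)%:~R) * q * t = m * q * t - q * t); last by ring.
by ring.
Qed.

Lemma trigspan_mul_horner_cos i l (q : {poly R}) p : trigspan i p ->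
  trigspan i (fun x => p x * q.[cos (pi / L l * xcoord l x)]).
Proof.
move=> Tp; elim/poly_ind: q => [|q c IH].
  rewrite (_ : (fun _ => _) = (fun x => 0 * p x)); first exact: trigspanZ.
  by apply/funext => x; rewrite horner0 mulr0 mul0r.
rewrite (_ : (fun _ => _) = (fun x => (p x * q.[cos (pi / L l * xcoord l x)])
   * cos (pi / L l * xcoord l x)) \+ (fun x => c * p x)).
  by apply: trigspanD; [exact: trigspan_mul_cos|exact: trigspanZ].
by apply/funext => x /=; rewrite hornerMXaddC; ring.
Qed.

(** The simplest function of the class that is positive on the box. *)
Definition weight i x : R := sin (pi / L i * xcoord i x).

Lemma trigspan_weight i : trigspan i (weight i).
Proof.
rewrite (_ : weight i = tprod (ei i) (fr (fun l => (l == i)%:Z))).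
  exact: trigspan_tprod.
apply/funext => x; rewrite (tprodD1 _ _ i) /ei eqxx /fr eqxx mul1r.
rewrite big1 ?mulr1 // => j /negbTE ji.
by rewrite ji /= !mul0r cos0.
Qed.

Lemma weight_gt0 i x : box x -> 0 < weight i x <= 1.
Proof.
move=> bx; have /andP[x0 xL] := bx i; rewrite /weight sin_le1 andbT.
apply: sin_gt0_pi; rewrite mulr_gt0 ?divr_gt0 ?pi_gt0 //=.
by rewrite mulrAC ltr_pdivrMr // ltr_pM2l ?pi_gt0.
Qed.

(** On the box, [weight i] times polynomials in the three cosines tends boundedly to [weight i]
    times the indicator of an octant, which is what [L2closureT] starts from. *)
Lemma trigspan_dense i f : L2 L f -> L2closure L (trigspan i) f.
Proof.
have TL2 p : trigspan i p -> L2 L p.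
  by move=> /smooth_trigspan; exact: L2_smooth.
have sw : smooth (weight i) by exact: smooth_trigspan (trigspan_weight i).
apply: (@L2closureT _ L L_gt0 _ TL2 (@trigspanD i) (@trigspanZ i) (weight i)).
- exact: mbox_continuous (smooth_continuous sw).
- exact: weight_gt0.
- move=> a.
  have [Q0 H0] := cos_step a.1.1 (L_gt0 0).
  have [Q1 H1] := cos_step a.1.2 (L_gt0 1).
  have [Q2 H2] := cos_step a.2 (L_gt0 2).
  pose C l x : R := cos (pi / L l * xcoord l x).
  pose F n x := ((weight i x * (Q0 n).[C 0 x]) * (Q1 n).[C 1 x]) * (Q2 n).[C 2 x].
  apply: (L2closure_bounded_lim (F := F) (g := cst 1) L_gt0 TL2).
  + move=> n; apply: L2closure_sub => //.
    do 3!apply: trigspan_mul_horner_cos; exact: trigspan_weight.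
  + exact: L2_cst.
  + move=> x bx.
    have [_ c0] := H0 _ (bx 0); have [_ c1] := H1 _ (bx 1); have [_ c2] := H2 _ (bx 2).
    have -> : \1_(octant a) x * weight i x = weight i x * (x.1.1 < a.1.1)%R%:R *
        (x.1.2 < a.1.2)%R%:R * (x.2 < a.2)%R%:R.
      rewrite mulrC -!mulrA; congr (_ * _); rewrite indicE -!natrM !mulnb.
      congr (nat_of_bool _)%:R.
      by apply/idP/and3P; rewrite inE.
    by apply: cvgM c2; apply: cvgM c1; apply: cvgM c0; exact: cvg_cst.
  + move=> n x bx.
    have [/(_ n)/andP[q0 q0'] _] := H0 _ (bx 0).
    have [/(_ n)/andP[q1 q1'] _] := H1 _ (bx 1).
    have [/(_ n)/andP[q2 q2'] _] := H2 _ (bx 2).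
    have /andP[/ltW w0 w1] := weight_gt0 i bx.
    rewrite /F ger0_norm ?mulr_ge0 //.
    by do 3?(apply: mulr_ile1 => //; rewrite ?mulr_ge0 //).
Qed.

End TrigDensity.

(** * Weak derivatives *)

Section Weak.
Context {R : realType} (L : 'I_3 -> R).
Hypothesis L_gt0 : forall i, 0 < L i.
Local Notation box := (box L).
Local Notation integ := (integ L).
Local Notation mbox := (mbox L).
Local Notation Ibox := (Ibox L).
Local Notation L2 := (L2 L).
Local Notation sqdist := (sqdist L).
Local Notation is_wpartial := (is_wpartial L).
Local Notation wpartial := (wpartial L).
Implicit Types (f g h : R * R * R -> R) (i j : 'I_3) (x : R * R * R).

Lemma sqdist_xx f : sqdist f f = 0.
Proof. by rewrite /sqdist Ibox0 // => x _; rewrite subrr expr0n. Qed.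

Lemma sqdist0B f g f' g' : L2 f -> L2 g -> L2 f' -> L2 g' ->
  sqdist f f' = 0 -> sqdist g g' = 0 ->
  sqdist (fun x => f x - g x) (fun x => f' x - g' x) = 0.
Proof.
move=> Lf Lg Lf' Lg' ff gg; apply/eqP; rewrite eq_le sqdist_ge0 andbT.
have i1 := integ_sqB Lf Lf'; have i2 := integ_sqB Lg Lg'.
have -> : (0 : R) = 2 * sqdist f f' + 2 * sqdist g g' by rewrite ff gg !mulr0 addr0.
rewrite /sqdist -!IboxZ // -IboxD; try exact: integZ.
apply: Ibox_le; [|by apply: integD; exact: integZ|].
  by apply: integ_sqB; exact: L2B.
move=> x _ /=; have := sqr_ge0 ((f x - f' x) + (g x - g' x)); nra.
Qed.

(** Almost everywhere equality is expressed by [sqdist f g = 0]. The integral of [(f - g) k] is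
    estimated by Young's inequality with a free parameter [t], instead of Cauchy-Schwarz. *)
Lemma sqdist0_mul f g k : L2 f -> L2 g -> L2 k -> sqdist f g = 0 ->
  Ibox (f \* k) = Ibox (g \* k).
Proof.
move=> Lf Lg Lk fg.
pose K := Ibox (fun x => k x ^+ 2).
have K0 : 0 <= K by apply: Ibox_ge0 => x _; exact: sqr_ge0.
have ik := L2_sqr_integ Lk; have ifg := integ_sqB Lf Lg.
have ifk := L2_mul_integ Lf Lk; have igk := L2_mul_integ Lg Lk.
have main (e t : R) : 0 < t -> e ^+ 2 = 1 ->
    e * (Ibox (f \* k) - Ibox (g \* k)) <= t * K.
  move=> t0 e1.
  have -> : t * K = t * K + (4 * t)^-1 * sqdist f g by rewrite fg mulr0 addr0.
  rewrite -IboxN // -IboxD //; last exact: integN.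
  have idiff : integ ((f \* k) \+ (fun x => - (g \* k) x)) by apply: integD => //; exact: integN.
  rewrite -IboxZ // /K /sqdist -!IboxZ // -IboxD; try exact: integZ.
  apply: Ibox_le; [exact: integZ|by apply: integD; exact: integZ|].
  move=> x _ /=; set a := f x - g x; rewrite -subr_ge0.
  rewrite (_ : _ - _ = (4 * t)^-1 * (2 * t * k x - e * a) ^+ 2); last first.
    have -> : a ^+ 2 = e ^+ 2 * a ^+ 2 by rewrite e1 mul1r.
    by rewrite -mulrBl -/a; field; exact: lt0r_neq0.
  by rewrite mulr_ge0 ?sqr_ge0 // invr_ge0 mulr_ge0 // ltW.
apply/eqP; rewrite -subr_eq0; set d := _ - _ in main *.
have dle (e : R) : e ^+ 2 = 1 -> e * d <= 0.
  move=> e1; rewrite leNgt; apply/negP => d0.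
  have K1 : 0 < K + 1 by rewrite ltr_wpDl.
  (* For this [t] the estimate reads [e d <= e d K / (K + 1)], which is absurd for positive
     [e d]. *)
  have := main e (e * d / (K + 1)) (divr_gt0 d0 K1) e1.
  rewrite mulrAC ler_pdivlMr //; have := d0; nra.
have := dle 1 (expr1n _ _); have := dle (-1) (ltac:(by rewrite sqrrN expr1n)).
by rewrite mul1r mulN1r oppr_le0 => d1 d2; rewrite eq_le d1 d2.
Qed.

Lemma L2_test phi : test_fun L phi -> L2 phi.
Proof. by case=> sphi _; exact: L2_smooth. Qed.

Lemma Ibox_mul_smooth_eq0 g : L2 g -> 
  (forall phi, test_fun L phi -> Ibox (fun x => g x * phi x) = 0) ->
  forall f, smooth f -> Ibox (g \* f) = 0.
Proof.
move=> Lg g0 f sf; have := Ibox_cutoff L_gt0 Lg sf.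
rewrite (_ : (fun n => _) = cst 0); last first.
  by apply/funext => n; rewrite (g0 _ (test_fun_cutoff L n sf)).
by move=> /(cvg_unique (@Rhausdorff R))/(_ (cvg_cst _)).
Qed.

(** By cut-off [g] is orthogonal to all smooth functions, hence to the trigonometric polynomials
    [p], for which [|g - p|^2 = |g|^2 + |p|^2]; by density [g] is null. Any parity class would do; 0
    is chosen. *)
Lemma test_separates g : L2 g ->
  (forall phi, test_fun L phi -> Ibox (fun x => g x * phi x) = 0) ->
  sqdist g (cst 0) = 0.
Proof.
move=> Lg g0; apply/eqP; rewrite eq_le sqdist_ge0 andbT.
apply/ler_addgt0Pr => e e0; rewrite add0r.
have [_ /(_ e e0)[p Tp gp]] := trigspan_dense L_gt0 0 Lg.
have sp := smooth_trigspan Tp; have Lp := L2_smooth L_gt0 sp.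
apply: le_trans (ltW gp).
have gp0 := Ibox_mul_smooth_eq0 Lg g0 sp.
have igp := L2_mul_integ Lg Lp; have ig := L2_sqr_integ Lg; have ip := L2_sqr_integ Lp.
have -> : sqdist g p = Ibox (fun x => g x ^+ 2) + Ibox (fun x => p x ^+ 2).
  rewrite -IboxD // -[RHS]addr0 -[0](mulr0 (-2)) -gp0 -IboxZ // -IboxD.
  - by apply: Ibox_eq => x _ /=; ring.
  - exact: integD.
  - exact: integZ.
rewrite (_ : sqdist g (cst 0) = Ibox (fun x => g x ^+ 2)); last first.
  by apply: Ibox_eq => x _; rewrite subr0.
by rewrite lerDl Ibox_ge0 // => x _; exact: sqr_ge0.
Qed.

Lemma is_wpartial_uniq i f g g' :
  is_wpartial i f g -> is_wpartial i f g' -> sqdist g g' = 0.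
Proof.
move=> [Lg Hg] [Lg' Hg'].
rewrite (_ : sqdist g g' = sqdist (fun x => g x - g' x) (cst 0)); last first.
  by apply: Ibox_eq => x _; rewrite subr0.
apply: test_separates; first exact: L2B.
move=> phi tphi; have Lphi := L2_test tphi.
rewrite (@Ibox_eq _ _ _ ((g \* phi) \+ (fun x => - (g' \* phi) x))); last first.
  by move=> x _ /=; rewrite mulrBl.
have i1 := L2_mul_integ Lg Lphi; have i2 := L2_mul_integ Lg' Lphi.
rewrite IboxD //; last exact: integN.
rewrite IboxN // -[Ibox (g \* phi)]opprK.
have := Hg _ tphi; have := Hg' _ tphi => <- ->.
by rewrite opprK subrr.
Qed.

Lemma is_wpartial_eq i f f' g : L2 f -> L2 f' -> sqdist f f' = 0 ->
  is_wpartial i f g -> is_wpartial i f' g.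
Proof.
move=> Lf Lf' ff [Lg Hg]; split=> // phi tphi.
rewrite -(Hg _ tphi); apply/esym; apply: (@sqdist0_mul f f') => //.
by apply: L2_smooth => //; apply: smooth_derive; case: tphi.
Qed.

Lemma wpartialP i f g : is_wpartial i f g -> is_wpartial i f (wpartial i f).
Proof. by move=> fg; exact: (xgetPex (cst 0) (ex_intro _ g fg)). Qed.

Lemma test_fun_face0 phi x i : test_fun L phi ->
  xcoord i x = 0 \/ xcoord i x = L i -> phi x = 0.
Proof.
move=> [_ [K [_ Kb phi0]]] xi; apply: phi0 => /Kb /(_ i).
by case: xi => ->; rewrite ltxx ?andbF.
Qed.

Lemma smooth_is_wpartial i f : smooth f -> is_wpartial i f ('D_(basis_vec i) f).
Proof.
move=> sf; have sD := smooth_derive i sf; split; first exact: L2_smooth.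
move=> phi tphi; have [sphi _] := tphi; have sDphi := smooth_derive i sphi.
have i1 := L2_mul_integ (L2_smooth L_gt0 sf) (L2_smooth L_gt0 sDphi).
have i2 := L2_mul_integ (L2_smooth L_gt0 sD) (L2_smooth L_gt0 sphi).
apply/eqP; rewrite -addr_eq0; apply/eqP.
rewrite -[LHS](IboxD i1 i2) -[RHS](@Ibox_derive_eq0 _ _ L_gt0 (f \* phi) i).
- by apply: Ibox_eq => x _; rewrite derive_mul_at //= addrC.
- exact: smoothM.
- by move=> x xi /=; rewrite (test_fun_face0 tphi xi) mulr0.
Qed.

(** [wpartial] chooses a representative, so a second derivative is taken of a function known only up
    to null sets. Hence, here and below, the pair of a function [f] and a smooth [f'] equal to it
    almost everywhere. *)
Lemma smooth_L2H1 f f' : L2 f -> smooth f' -> sqdist f' f = 0 -> H1 L f.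
Proof.
move=> Lf sf' ff; split=> // i; exists ('D_(basis_vec i) f').
exact: is_wpartial_eq (L2_smooth L_gt0 sf') Lf ff (smooth_is_wpartial i sf').
Qed.

Lemma smooth_wpartial i f f' : L2 f -> smooth f' -> sqdist f' f = 0 ->
  L2 (wpartial i f) /\ sqdist ('D_(basis_vec i) f') (wpartial i f) = 0.
Proof.
move=> Lf sf' ff.
have H := is_wpartial_eq (L2_smooth L_gt0 sf') Lf ff (smooth_is_wpartial i sf').
have H' := wpartialP H; split; first by case: H'.
exact: is_wpartial_uniq H H'.
Qed.

Lemma smooth_H2 f : smooth f -> H2 L f.
Proof.
move=> sf; have Lf := L2_smooth L_gt0 sf; have ff := sqdist_xx f; split.
  exact: smooth_L2H1 ff.
move=> i; have [Lw fw] := smooth_wpartial i Lf sf ff.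
exact: smooth_L2H1 Lw (smooth_derive i sf) fw.
Qed.

Lemma measurable_face_pt f i (c : R) : continuous f ->
  measurable_fun (face_dom L i) (fun y => f (face_pt i c y)).
Proof.
move=> cf; apply: measurable_funTS.
apply: (measurableT_comp (continuous_measurable3 cf)).
have m1 : measurable_fun setT (@fst R R) by exact: measurable_fst.
have m2 : measurable_fun setT (@snd R R) by exact: measurable_snd.
have mc : measurable_fun setT (fun _ : R * R => c) by exact: measurable_cst.
have [<-|[<-|<-]] := ord3_cases i.
- exact: measurable_fun_pair (measurable_fun_pair mc m1) m2.
- exact: measurable_fun_pair (measurable_fun_pair m1 mc) m2.
- exact: measurable_fun_pair (measurable_fun_pair m1 m2) mc.
Qed.

Lemma smooth_is_trace i b f f' : L2 f -> smooth f' -> sqdist f' f = 0 ->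
  is_trace L i b f (fun y => f' (face_pt i (face_pos L i b) y)).
Proof.
move=> Lf sf' ff; split.
- exact: smooth_L2H1 ff.
- exact: measurable_face_pt (smooth_continuous sf').
exists (fun=> f'); split=> [//||j|].
- rewrite (_ : (fun _ => _) = cst 0%E); first exact: cvg_cst.
  apply/funext => n; rewrite -[RHS]/((0 : R)%:E) -ff.
  exact: (integral_Ibox (integ_sqB (L2_smooth L_gt0 sf') Lf)).
- have [Lw fw] := smooth_wpartial j Lf sf' ff.
  rewrite (_ : (fun _ => _) = cst 0%E); first exact: cvg_cst.
  apply/funext => n; rewrite -[RHS]/((0 : R)%:E) -fw.
  exact: (integral_Ibox (integ_sqB (L2_smooth L_gt0 (smooth_derive j sf')) Lw)).
- rewrite (_ : (fun _ => _) = cst 0%E); first exact: cvg_cst.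
  by apply/funext => n; apply: integral0_eq => y _; rewrite subrr expr0n.
Qed.

(* The boundary layer of the cut-off contributes nothing in the limit because
   [psi] vanishes linearly where the derivative of the cut-off blows up. *)
Lemma wpartial_by_parts i f g psi : L2 f -> is_wpartial i f g -> smooth psi ->
  (forall x, xcoord i x = 0 \/ xcoord i x = L i -> psi x = 0) ->
  Ibox (f \* 'D_(basis_vec i) psi) = - Ibox (g \* psi).
Proof.
move=> Lf [Lg Hg] sp p0; have sDp := smooth_derive i sp.
have [C C0 HC] := dcut1_bound L_gt0 i.
have [K K0 HK] := vanishing_bound L_gt0 sp p0.
pose S n := fun x => f x * (psi x * 'D_(basis_vec i) (cutoff L n) x).
have mS n : mbox (S n).
  apply: measurable_realfun.measurable_funM; first exact: L2_measurable.
  apply: mbox_continuous; apply: smooth_continuous.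
  exact: smoothM sp (smooth_derive i (smooth_cutoff L n)).
have Sle n x : box x -> `|S n x| <= K * C * `|f x|.
  move=> bx; rewrite /S normrM mulrC ler_wpM2r // normrM.
  have [h _] := HC n x bx.
  apply: le_trans (ler_pM _ _ (HK x bx) (derive_cutoff_le L n i x)) _ => //.
  by rewrite -mulrA ler_wpM2l.
have [iS S0] : integ (cst 0) /\ Ibox (S n) @[n --> \oo] --> Ibox (cst 0).
  apply: (@Ibox_dominated _ L S (cst 0) (fun x => K * C * `|f x|)) => //.
  (* At a fixed point [psi] is at most [K d] and the derivative of the cut-off at most
     [C / ((n+1) d^2)]. *)
  - move=> x bx; pose d := xcoord i x * (L i - xcoord i x).
    have d0 : 0 < d by have /andP[? ?] := bx i; rewrite mulr_gt0 ?subr_gt0.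
    apply/cvgrPdist_le => e e0; near=> n; rewrite sub0r normrN.
    rewrite /S normrM normrM.
    have [_ h] := HC n x bx.
    have H1 : `|psi x| * `|'D_(basis_vec i) (cutoff L n) x| <= K * d * `|dcut1 L n i x|.
      exact: (ler_pM _ _ (HK x bx) (derive_cutoff_le L n i x)).
    have H2 : n.+1%:R * d * (K * d * `|dcut1 L n i x|) <= K * C.
      rewrite (_ : _ * _ = K * (n.+1%:R * d ^+ 2 * `|dcut1 L n i x|)); last by ring.
      by rewrite ler_wpM2l.
    have H3 : K * d * `|dcut1 L n i x| <= K * C / (n.+1%:R * d).
      by rewrite ler_pdivlMr; [rewrite mulrC|exact: mulr_gt0].
    apply: le_trans (ler_wpM2l (normr_ge0 _) (le_trans H1 H3)) _.
    rewrite mulrA ler_pdivrMr; last exact: mulr_gt0.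
    rewrite [leRHS]mulrCA -ler_pdivrMr; last exact: mulr_gt0.
    by apply: ltW; near: n; exact: near_succ_gt.
  - by apply: integZ; have := L2_integ L_gt0 Lf => /integrable_norm; exact: integ_eq.
have T1 := Ibox_cutoff L_gt0 Lf sDp.
have T2 := Ibox_cutoff L_gt0 Lg sp.
have E n : Ibox (fun x => f x * ('D_(basis_vec i) psi x * cutoff L n x)) =
    - Ibox (fun x => g x * (psi x * cutoff L n x)) - Ibox (S n).
  rewrite -[- Ibox _](Hg _ (test_fun_cutoff L n sp)).
  have sc := smooth_cutoff L n.
  have i0 : integ (S n).
    exact: (L2_mul_integ Lf (L2_smooth L_gt0 (smoothM sp (smooth_derive i sc)))).
  have i1 := L2_mul_integ Lf (L2_smooth L_gt0 (smooth_derive i (smoothM sp sc))).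
  rewrite -IboxN // -[RHS](IboxD i1 (integN i0)).
  by apply: Ibox_eq => x _ /=; rewrite derive_mul_at // /S; ring.
have T3 : - Ibox (fun x => g x * (psi x * cutoff L n x)) - Ibox (S n) @[n --> \oo]
    --> - Ibox (g \* psi).
  rewrite -[X in _ --> X]subr0; apply: cvgB; first exact: cvgN.
  by move: S0; rewrite Ibox0.
by move: T1; under eq_cvg do rewrite E; move/(cvg_unique (@Rhausdorff R)); apply.
Unshelve. all: by end_near. Qed.

End Weak.

(** * Fields satisfying the boundary conditions classically *)

Section Nice.
Context {R : realType} (L : 'I_3 -> R).
Hypothesis L_gt0 : forall i, 0 < L i.
Local Notation box := (box L).
Local Notation integ := (integ L).
Local Notation Ibox := (Ibox L).
Local Notation L2 := (L2 L).
Local Notation inner := (inner L).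
Local Notation wpartial := (wpartial L).
Implicit Types (f g h : R * R * R -> R) (i j : 'I_3) (x : R * R * R) (u v w : field R).

Definition ccurl u : field R := fun x => \row_(j < 3)
  ('D_(basis_vec (j + 1)) (component u (j + 2)) x
   - 'D_(basis_vec (j + 2)) (component u (j + 1)) x).

Definition conv u v : field R := fun x => \row_(j < 3)
  \sum_i component u i x * 'D_(basis_vec i) (component v j) x.

Definition on_face i x : Prop := xcoord i x = 0 \/ xcoord i x = L i.

(** The conditions are asked on whole planes and in all of space. Modes satisfy them there, and no
    restriction to the box or to its faces has to be carried along. *)
Record nice u : Prop := Nice {
  nice_smooth : forall j, smooth (component u j);
  nice_normal : forall i x, on_face i x -> component u i x = 0;
  nice_div : forall x, \sum_i 'D_(basis_vec i) (component u i) x = 0;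
  nice_curl : forall i j x, i != j -> on_face i x -> component (ccurl u) j x = 0 }.

Lemma componentD u v j : component (u + v)%R j = component u j \+ component v j.
Proof. by apply/funext => x; rewrite /component /= mxE. Qed.

Lemma componentZ (c : R) u j : component (c *: u) j = fun x => c * component u j x.
Proof. by apply/funext => x; rewrite /component /= mxE. Qed.

Lemma component_ccurl u j x : component (ccurl u) j x =
  'D_(basis_vec (j + 1)) (component u (j + 2)) x
   - 'D_(basis_vec (j + 2)) (component u (j + 1)) x.
Proof. by rewrite /component mxE. Qed.

Lemma derive_add_at f g i x : smooth f -> smooth g ->
  'D_(basis_vec i) (f \+ g) x = 'D_(basis_vec i) f x + 'D_(basis_vec i) g x.
Proof. by move=> sf sg; rewrite deriveD //; exact: smooth_derivable. Qed.

Lemma derive_scale_at (c : R) f i x : smooth f ->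
  'D_(basis_vec i) (fun x => c * f x) x = c * 'D_(basis_vec i) f x.
Proof. by move=> sf; exact: (congr1 (@^~ x) (derive_scaleE c i sf)). Qed.

Lemma niceD u v : nice u -> nice v -> nice (u + v)%R.
Proof.
move=> [su nu du cu] [sv nv dv cv]; split.
- by move=> j; rewrite componentD; exact: smoothD.
- by move=> i x xi; rewrite componentD /= nu // nv // addr0.
- move=> x; under eq_bigr do rewrite componentD derive_add_at //.
  by rewrite big_split /= du dv addr0.
- move=> i j x ij xi; rewrite component_ccurl !componentD !derive_add_at //.
  have := cu i j x ij xi; have := cv i j x ij xi; rewrite !component_ccurl.
  by move=> hv hu; rewrite opprD addrACA hu hv addr0.
Qed.

Lemma niceZ (c : R) u : nice u -> nice (c *: u).
Proof.
move=> [su nu du cu]; split.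
- by move=> j; rewrite componentZ; exact: smoothZ.
- by move=> i x xi; rewrite componentZ nu // mulr0.
- move=> x; under eq_bigr do rewrite componentZ derive_scale_at //.
  by rewrite -mulr_sumr du mulr0.
- move=> i j x ij xi; rewrite component_ccurl !componentZ !derive_scale_at //.
  by have := cu i j x ij xi; rewrite component_ccurl -mulrBr => ->; rewrite mulr0.
Qed.

Lemma smooth_ccurl u j : (forall i, smooth (component u i)) ->
  smooth (component (ccurl u) j).
Proof.
move=> su; rewrite (_ : component _ _ = 'D_(basis_vec (j + 1)) (component u (j + 2))
  \+ (fun x => - 'D_(basis_vec (j + 2)) (component u (j + 1)) x)).
  by apply: smoothD; [|apply: smoothN]; apply: smooth_derive; exact: su.
by apply/funext => x; rewrite component_ccurl.
Qed.

Lemma nice_Ibox_grad u f : nice u -> smooth f ->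
  Ibox (fun x => \sum_i component u i x * 'D_(basis_vec i) f x) = 0.
Proof.
move=> [su nu du _] sf.
have Ls g : smooth g -> L2 g by exact: L2_smooth.
have i1 i := L2_mul_integ (Ls _ (su i)) (Ls _ (smooth_derive i sf)).
have i2 i := L2_mul_integ (Ls _ (smooth_derive i (su i))) (Ls _ sf).
have E i : Ibox (component u i \* 'D_(basis_vec i) f) =
    - Ibox ('D_(basis_vec i) (component u i) \* f).
  have nf x : on_face i x -> (component u i \* f) x = 0 by move=> xi /=; rewrite nu ?mul0r.
  have := Ibox_derive_eq0 L_gt0 (smoothM (su i) sf) nf.
  rewrite (derive_mulE i (su i) sf) (IboxD (i2 i) (i1 i)) addrC.
  by move/eqP; rewrite addr_eq0 => /eqP.
rewrite (Ibox_sum L_gt0 _ (fun i _ => i1 i)).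
rewrite (eq_bigr _ (fun i _ => E i)) sumrN -(Ibox_sum L_gt0 _ (fun i _ => i2 i)).
by rewrite Ibox0 ?oppr0 // => x _; rewrite -mulr_suml du mul0r.
Qed.

Lemma nice_H u : nice u -> H L u.
Proof.
move=> nu; have su := nice_smooth nu; split.
- by move=> j; exact: L2_smooth.
- by move=> phi [sphi _]; exact: nice_Ibox_grad.
- by move=> phi sphi; exact: nice_Ibox_grad.
Qed.

Lemma curl_null u j : (forall i, smooth (component u i)) ->
  L2 (component (curl L u) j) /\
  sqdist L (component (ccurl u) j) (component (curl L u) j) = 0.
Proof.
move=> su.
have W i l : L2 (wpartial i (component u l)) /\
    sqdist L ('D_(basis_vec i) (component u l)) (wpartial i (component u l)) = 0.
  by apply: smooth_wpartial => //; [exact: L2_smooth|exact: sqdist_xx].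
have [L1 E1] := W (j + 1) (j + 2); have [L2' E2] := W (j + 2) (j + 1).
have cE : component (curl L u) j =
    fun x => wpartial (j + 1) (component u (j + 2)) x - wpartial (j + 2) (component u (j + 1)) x.
  by apply/funext => x; rewrite /component mxE.
have cE' : component (ccurl u) j = fun x => 'D_(basis_vec (j + 1)) (component u (j + 2)) x
     - 'D_(basis_vec (j + 2)) (component u (j + 1)) x.
  by apply/funext => x; rewrite component_ccurl.
rewrite cE cE'; split; first exact: L2B.
by apply: sqdist0B => //; apply: L2_smooth => //; exact: smooth_derive.
Qed.

Lemma xcoord_face_pt i (c : R) y : xcoord i (face_pt i c y) = c.
Proof. by have [<-|[<-|<-]] := ord3_cases i. Qed.

Lemma nice_DA u : nice u -> DA L u.
Proof.
move=> nu; have su := nice_smooth nu; split; first exact: nice_H.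
  by move=> j; exact: smooth_H2.
move=> i b; exists (fun y => ccurl u (face_pt i (face_pos L i b) y)); split=> [j|].
  have [Lc cc] := curl_null j su.
  exact: (smooth_is_trace L_gt0 i b Lc (smooth_ccurl j su) cc).
apply: aeW => y _; set g := ccurl _ _.
have gj j : i != j -> g 0 j = 0.
  move=> ij; apply: (nice_curl nu (i := i)) => //.
  by rewrite /on_face xcoord_face_pt /face_pos; case: (b); [right|left].
clearbody g; apply/rowP => j; rewrite !mxE.
rewrite /dot (bigD1 i) //= big1 ?addr0; last first.
  by move=> l li; rewrite gj ?mul0r // eq_sym.
rewrite !mxE !eqxx; have [<-|ij] := eqVneq i j.
  by rewrite mulr1; case: (b); ring.
by rewrite gj // !mulr0 subr0.
Qed.

Lemma innerE u v : inner u v = Ibox (fun x => \sum_i component u i x * component v i x).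
Proof. by []. Qed.

Lemma inner_sum_Ibox u v : (forall i, L2 (component u i)) -> (forall i, L2 (component v i)) ->
  inner u v = \sum_i Ibox (component u i \* component v i).
Proof.
move=> Lu Lv; rewrite innerE (Ibox_sum L_gt0) // => i _.
exact: L2_mul_integ.
Qed.

Lemma V_L2 w j : V L w -> L2 (component w j).
Proof. by case=> -[]. Qed.

Lemma V_wpartial w i j : V L w ->
  is_wpartial L i (component w j) (wpartial i (component w j)).
Proof. by move=> [_ /(_ j)[_ /(_ i)[g]]]; exact: wpartialP. Qed.

(** The derivative moves from [w_j] to [u_i v_j], which vanishes on the faces normal to [i] because
    [u_i] does. The term containing the divergence of [u] then drops out. *)
Lemma B_convE u v w : nice u -> (forall j, smooth (component v j)) -> V L w ->
  B L u v w = inner (conv u v) w.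
Proof.
move=> nu sv Vw; have su := nice_smooth nu.
have Ls f : smooth f -> L2 f by exact: L2_smooth.
have Lw j := V_L2 j Vw.
have P i j := V_wpartial i j Vw.
have LP i j : L2 (wpartial i (component w j)) by case: (P i j).
pose psi i j := component u i \* component v j.
have sp i j : smooth (psi i j) by exact: smoothM.
have part i j : Ibox (component w j \* 'D_(basis_vec i) (psi i j)) =
    - Ibox (wpartial i (component w j) \* psi i j).
  apply: wpartial_by_parts => // x xi.
  by rewrite /psi /= (nice_normal nu) ?mul0r.
have i1 i j : integ (wpartial i (component w j) \* psi i j).
  by apply: L2_mul_integ => //; exact: Ls.
have i2 i j : integ (component w j \* 'D_(basis_vec i) (psi i j)).
  by apply: L2_mul_integ => //; apply: Ls; exact: smooth_derive.
have -> : B L u v w = - \sum_j \sum_i Ibox (wpartial i (component w j) \* psi i j).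
  rewrite /B; congr (- _).
  under eq_bigr do rewrite -(Ibox_sum L_gt0) //.
  rewrite -(Ibox_sum L_gt0) => [|j _]; last by apply: integ_sum.
  apply: Ibox_eq => x _; apply: eq_bigr => j _.
  by rewrite mulr_suml; apply: eq_bigr => i _; rewrite /psi /=; ring.
rewrite -sumrN; under eq_bigr do rewrite -sumrN.
under eq_bigr => j _ do under eq_bigr => i _ do rewrite -part.
under eq_bigr => j _ do rewrite -(Ibox_sum L_gt0 _ (fun i _ => i2 i j)).
rewrite -(Ibox_sum L_gt0); last by move=> j _; apply: integ_sum.
apply: Ibox_eq => x _; apply: eq_bigr => j _.
rewrite -mulr_sumr mulrC; congr (_ * _); rewrite mxE.
under eq_bigr do rewrite derive_mul_at //.
by rewrite big_split /= -mulr_suml (nice_div nu) mul0r add0r.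
Qed.

Lemma ord3D : ((0 : 'I_3) + 1 = 1) * ((0 : 'I_3) + 2 = 2) * ((1 : 'I_3) + 1 = 2) *
  ((1 : 'I_3) + 2 = 0) * ((2 : 'I_3) + 1 = 0) * ((2 : 'I_3) + 2 = 1).
Proof. by do !split; exact: val_inj. Qed.

(** The [j]-th component of the curl of [w] only involves derivatives in directions other than [j],
    and on the faces normal to these the [j]-th component of the curl of [u] vanishes. *)
Lemma inner_curl_curl u w : nice u -> V L w ->
  inner (curl L u) (curl L w) = inner (ccurl (ccurl u)) w.
Proof.
move=> nu Vw; have su := nice_smooth nu.
have Lw j := V_L2 j Vw.
have P i j := V_wpartial i j Vw.
have LP i j : L2 (wpartial i (component w j)) by case: (P i j).
have scc j := smooth_ccurl j su.
have Lcc j := L2_smooth L_gt0 (scc j).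
have sccc j := smooth_ccurl j scc.
have cwE j : component (curl L w) j = fun x =>
    wpartial (j + 1) (component w (j + 2)) x - wpartial (j + 2) (component w (j + 1)) x.
  by apply/funext => x; rewrite /component mxE.
have Lcw j : L2 (component (curl L w) j) by rewrite cwE; exact: L2B.
have Lcu j : L2 (component (curl L u) j) by have [] := curl_null j su.
have Lccc j := L2_smooth L_gt0 (sccc j).
rewrite (inner_sum_Ibox Lcu Lcw) (inner_sum_Ibox Lccc Lw).
have rep j : Ibox (component (curl L u) j \* component (curl L w) j) =
    Ibox (component (ccurl u) j \* component (curl L w) j).
  have [Lc cc] := curl_null j su; apply/esym.
  exact: sqdist0_mul (Lcc j) Lc (Lcw j) cc.
have part i j l : i != j ->
    Ibox (component (ccurl u) j \* wpartial i (component w l)) =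
    - Ibox ('D_(basis_vec i) (component (ccurl u) j) \* component w l).
  move=> ij; have H := wpartial_by_parts L_gt0 (Lw l) (P i l) (scc j)
    (fun x xi => nice_curl nu ij xi).
  rewrite -[LHS]opprK; congr (- _); transitivity
    (- Ibox (wpartial i (component w l) \* component (ccurl u) j)).
    by congr (- _); apply: Ibox_eq => x _ /=; rewrite mulrC.
  by rewrite -H; apply: Ibox_eq => x _ /=; rewrite mulrC.
have LD i j : L2 ('D_(basis_vec i) (component (ccurl u) j)).
  by apply: L2_smooth => //; exact: smooth_derive.
have split2 j : Ibox (component (ccurl u) j \* component (curl L w) j) =
   Ibox ('D_(basis_vec (j + 2)) (component (ccurl u) j) \* component w (j + 1))
   - Ibox ('D_(basis_vec (j + 1)) (component (ccurl u) j) \* component w (j + 2)).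
  have n1 : j + 1 != j by rewrite -subr_eq0 addrAC subrr add0r.
  have n2 : j + 2 != j by rewrite -subr_eq0 addrAC subrr add0r.
  have ia := L2_mul_integ (Lcc j) (LP (j + 1) (j + 2)).
  have ib := L2_mul_integ (Lcc j) (LP (j + 2) (j + 1)).
  rewrite addrC -[X in _ = _ + X]opprK -(part _ _ _ n1) -(part _ _ _ n2).
  rewrite -(IboxN ib) -(IboxD ia (integN ib)).
  by apply: Ibox_eq => x _; rewrite cwE; exact: mulrBr.
rewrite (eq_bigr _ (fun j _ => rep j)) (eq_bigr _ (fun j _ => split2 j)).
have exp j : Ibox (component (ccurl (ccurl u)) j \* component w j) =
   Ibox ('D_(basis_vec (j + 1)) (component (ccurl u) (j + 2)) \* component w j)
   - Ibox ('D_(basis_vec (j + 2)) (component (ccurl u) (j + 1)) \* component w j).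
  have ia := L2_mul_integ (LD (j + 1) (j + 2)) (Lw j).
  have ib := L2_mul_integ (LD (j + 2) (j + 1)) (Lw j).
  rewrite -IboxN // -IboxD //; last exact: integN.
  by apply: Ibox_eq => x _; rewrite -[RHS]mulrBl -component_ccurl.
rewrite (eq_bigr _ (fun j _ => exp j)).
(* Both sides are sums of the same six integrals, in a different order. *)
pose K i l m := Ibox ('D_(basis_vec i) (component (ccurl u) l) \* component w m).
rewrite (eq_bigr (fun j => K (j + 2) j (j + 1) - K (j + 1) j (j + 2))) //.
rewrite [RHS](eq_bigr (fun j => K (j + 1) (j + 2) j - K (j + 2) (j + 1) j)) //.
clearbody K; rewrite !sum_ord3 !ord3D; ring.
Qed.

End Nice.

(** * Modes and their interactions *)

Section Modes.
Context {R : realType} (L : 'I_3 -> R).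
Hypothesis L_gt0 : forall i, 0 < L i.
Local Notation Ibox := (Ibox L).
Local Notation L2 := (L2 L).
Local Notation inner := (inner L).
Local Notation nice := (nice L).
Implicit Types (k m : 'I_3 -> int) (i j l : 'I_3) (x : R * R * R).
Implicit Types (v w z K M : 'rV[R]_3).

Definition mode v K : field R := fun x => \row_(i < 3) (v 0 i * tprod (ei i) (K 0) x).

Definition frv k : 'rV[R]_3 := \row_l fr L k l.

(** The parity of the [j]-th component of the curl of a mode. *)
Definition ec j : 'I_3 -> bool := fun l => l != j.

Lemma component_mode v K i :
  component (mode v K) i = fun x => v 0 i * tprod (ei i) (K 0) x.
Proof. by apply/funext => x; rewrite /component mxE. Qed.

Lemma smooth_mode v K i : smooth (component (mode v K) i).
Proof. by rewrite component_mode; apply: smoothZ; exact: smooth_tprod. Qed.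

Lemma derive_tprod_at b (w : 'I_3 -> R) j x : 'D_(basis_vec j) (tprod b w) x =
  (if b j then w j else - w j) * tprod (flip j b) w x.
Proof. exact: (congr1 (@^~ x) (derive_tprod b w j)). Qed.

Lemma derive_mode v K i j x : 'D_(basis_vec j) (component (mode v K) i) x =
  v 0 i * ((if j == i then K 0 j else - K 0 j) * tprod (flip j (ei i)) (K 0) x).
Proof.
rewrite component_mode derive_scale_at; last exact: smooth_tprod.
by rewrite derive_tprod_at.
Qed.

Lemma modeD v w K : mode (v + w) K = mode v K + mode w K.
Proof.
apply/funext => x; apply/rowP => i.
by rewrite -[RHS]/((mode v K x + mode w K x) 0 i) !mxE mulrDl.
Qed.

Lemma modeZ c v K : mode (c *: v) K = c *: mode v K.
Proof.
by apply/funext => x; apply/rowP => i; rewrite [RHS]mxE !mxE mulrA.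
Qed.

Lemma mode0 K : mode 0 K = 0.
Proof. by rewrite -[0 in LHS](scale0r 0) modeZ scale0r. Qed.

Lemma sin_int_pi (n : int) : sin (n%:~R * pi) = 0 :> R.
Proof.
have H (p : nat) : sin (p%:R * pi) = 0 :> R.
  elim: p => [|p IH]; first by rewrite mul0r sin0.
  by rewrite -natr1 mulrDl mul1r sinDpi IH oppr0.
case: n => p; first exact: H.
by rewrite NegzE mulrNz mulNr sinN (H p.+1) oppr0.
Qed.

Lemma tprod_face (b : 'I_3 -> bool) k l x : b l -> on_face L l x ->
  tprod b (frv k 0) x = 0.
Proof.
move=> bl xl; rewrite (tprodD1 _ _ l) bl mxE /fr /=; case: xl => ->.
  by rewrite mulr0 sin0 mul0r.
rewrite -mulrA divfK ?sin_int_pi ?mul0r //.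
by rewrite gt_eqF.
Qed.

Lemma flip_ei_same i : flip i (ei i) = (fun=> false).
Proof. by apply/funext => l; rewrite /flip /ei; case: (l == i). Qed.

Lemma flip_ei12 j : flip (j + 1) (ei (j + 2)) = ec j.
Proof.
apply/funext => l; move: j l; rewrite /flip /ei /ec.
by apply: ord3P; apply: ord3P.
Qed.

Lemma flip_ei21 j : flip (j + 2) (ei (j + 1)) = ec j.
Proof.
apply/funext => l; move: j l; rewrite /flip /ei /ec.
by apply: ord3P; apply: ord3P.
Qed.

Lemma component_ccurl_mode v K j x : component (ccurl (mode v K)) j x =
  (v 0 (j + 1) * K 0 (j + 2) - v 0 (j + 2) * K 0 (j + 1)) * tprod (ec j) (K 0) x.
Proof.
rewrite component_ccurl !derive_mode flip_ei12 flip_ei21.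
have -> : (j + 1 == j + 2) = false by move: j; apply: ord3P.
have -> : (j + 2 == j + 1) = false by move: j; apply: ord3P.
by ring.
Qed.

Lemma nice_mode v k : dot v (frv k) = 0 -> nice (mode v (frv k)).
Proof.
move=> vk; split.
- by move=> j; exact: smooth_mode.
- move=> i x xi; rewrite component_mode (tprod_face k _ xi) ?mulr0 //.
  by rewrite /ei eqxx.
- move=> x; transitivity (dot v (frv k) * tprod (fun=> false) (frv k 0) x).
    rewrite /dot mulr_suml; apply: eq_bigr => i _.
    by rewrite derive_mode eqxx flip_ei_same mulrA.
  by rewrite vk mul0r.
- move=> i j x ij xi; rewrite component_ccurl_mode (tprod_face k _ xi) ?mulr0 //.
Qed.

Lemma dot_ord3 v w : dot v w = v 0 0 * w 0 0 + v 0 1 * w 0 1 + v 0 2 * w 0 2.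
Proof. by rewrite /dot sum_ord3. Qed.

Lemma flip_ec1 j : flip (j + 1) (ec (j + 2)) = ei j.
Proof.
apply/funext => l; move: j l; rewrite /flip /ei /ec.
by apply: ord3P; apply: ord3P.
Qed.

Lemma flip_ec2 j : flip (j + 2) (ec (j + 1)) = ei j.
Proof.
apply/funext => l; move: j l; rewrite /flip /ei /ec.
by apply: ord3P; apply: ord3P.
Qed.

Lemma ccurl_ccurl_mode v K : dot v K = 0 ->
  ccurl (ccurl (mode v K)) = dot K K *: mode v K.
Proof.
move=> vK; apply/funext => x; apply/rowP => j.
rewrite -[LHS]/(component (ccurl (ccurl (mode v K))) j x) component_ccurl.
pose om j := v 0 (j + 1) * K 0 (j + 2) - v 0 (j + 2) * K 0 (j + 1).
have cE j' : component (ccurl (mode v K)) j' = fun x => om j' * tprod (ec j') (K 0) x.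
  by apply/funext => y; rewrite component_ccurl_mode.
rewrite !cE !derive_scale_at; try exact: smooth_tprod.
rewrite !derive_tprod_at flip_ec1 flip_ec2.
have -> : ec (j + 2) (j + 1) by move: j; apply: ord3P.
have -> : ec (j + 1) (j + 2) by move: j; apply: ord3P.
rewrite [RHS]mxE mxE mulrA; set T := tprod _ _ _.
rewrite !mulrA -mulrBl; congr (_ * T).
rewrite /om; move: vK; rewrite !dot_ord3 => vK; clear -vK.
have [<-|[<-|<-]] := ord3_cases j; rewrite !ord3D.
- by rewrite -[RHS]subr0 -(mulr0 (K 0 0)) -vK; ring.
- by rewrite -[RHS]subr0 -(mulr0 (K 0 1)) -vK; ring.
- by rewrite -[RHS]subr0 -(mulr0 (K 0 2)) -vK; ring.
Qed.

(** * Interaction of two modes *)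

Definition sg (t : bool * bool * bool) l : int :=
  if nth false [:: t.1.1; t.1.2; t.2] l then -1 else 1.

Definition sgv t v : 'rV[R]_3 := \row_l ((sg t l)%:~R * v 0 l).

Lemma sum_bool3 (V : nmodType) (f : bool * bool * bool -> V) :
  \sum_t f t = f (true, true, true) + f (true, true, false)
   + (f (true, false, true) + f (true, false, false))
   + (f (false, true, true) + f (false, true, false)
   + (f (false, false, true) + f (false, false, false))).
Proof.
rewrite (eq_bigr (fun p => f (p.1, p.2))); last by case.
rewrite -(pair_bigA _ (fun p c => f (p, c))) /=.
rewrite (eq_bigr (fun p => \sum_c f ((p.1, p.2), c))); last by case.
rewrite -(pair_bigA _ (fun a b => \sum_c f ((a, b), c))) /=.
by rewrite !big_bool.
Qed.

(** For amplitudes orthogonal to their own wave vectors the two coefficients are [dot w M] and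
    [dot z K]. Writing them with [K + M] is convenient when the resulting wave vector is the
    prescribed one. *)
Definition advect K w M z : 'rV[R]_3 := dot w (K + M) *: z + dot z (K + M) *: w.

Lemma dotC v w : dot v w = dot w v.
Proof. by apply: eq_bigr => i _; rewrite mulrC. Qed.

Lemma dotDr v w z : dot v (w + z) = dot v w + dot v z.
Proof. by rewrite /dot -big_split; apply: eq_bigr => i _; rewrite mxE mulrDr. Qed.

Lemma dotDl v w z : dot (v + w) z = dot v z + dot w z.
Proof. by rewrite dotC dotDr !(dotC z). Qed.

Lemma dotZr c v w : dot v (c *: w) = c * dot v w.
Proof. by rewrite /dot mulr_sumr; apply: eq_bigr => i _; rewrite mxE mulrCA. Qed.

Lemma dotZl c v w : dot (c *: v) w = c * dot v w.
Proof. by rewrite dotC dotZr dotC. Qed.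

Lemma sg_sqr t l : (sg t l)%:~R * (sg t l)%:~R = 1 :> R.
Proof. by rewrite /sg; case: nth; rewrite ?mulrNN ?mulr1. Qed.

Lemma dot_sgv t v w : dot (sgv t v) (sgv t w) = dot v w.
Proof.
by apply: eq_bigr => i _; rewrite !mxE mulrACA sg_sqr mul1r.
Qed.

(** Product-to-sum formulas, once the amplitudes have been simplified by [dot w K = 0] and
    [dot z M = 0]. The factor 1/8 is 1/2 for each variable. *)
Lemma conv_modes w K z M x : dot w K = 0 -> dot z M = 0 ->
  conv (mode w K) (mode z M) x + conv (mode z M) (mode w K) x =
  8^-1 *: \sum_t mode (advect K w (sgv t M) (sgv t z)) (K + sgv t M) x.
Proof.
move=> wK zM; apply/rowP => j.
have aE t : advect K w (sgv t M) (sgv t z) =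
    dot w (sgv t M) *: sgv t z + dot (sgv t z) K *: w.
  by rewrite /advect !dotDr wK add0r dot_sgv zM addr0.
rewrite [RHS]mxE summxE [LHS]mxE /conv.
rewrite (eq_bigr (fun t => (dot w (sgv t M) * sgv t z 0 j + dot (sgv t z) K * w 0 j)
  * tprod (ei j) ((K + sgv t M) 0) x)); last first.
  by move=> t _; rewrite mxE aE !mxE.
rewrite [X in X + _ = _]mxE [X in _ + X = _]mxE !sum_ord3 sum_bool3.
rewrite !derive_mode !component_mode /tprod !prod_ord3.
rewrite !dot_ord3 /sgv !mxE /sg /ei /flip /=.
rewrite !(mulrDl _ _ (xcoord _ _)) -!mulrA !(mulrNz, mulr1z, mulN1r, mul1r, mulNr).
have cs (a b : R) : (cos (a + b) = cos a * cos b - sin a * sin b) *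
  (sin (a + b) = sin a * cos b + cos a * sin b) by rewrite cosD sinD.
by have [<-|[<-|<-]] := ord3_cases j;
  rewrite /= !cs !(sinN, cosN) ?(mulrNz, mulr1z); field.
Qed.

(** The projection onto H at the level of a single mode. For [K = 0] it is the identity. *)
Definition proj v K : 'rV[R]_3 := v - (dot v K / dot K K) *: K.

Lemma dot_sqr_eq0 v : dot v v = 0 -> v = 0.
Proof.
rewrite dot_ord3 => v0; apply/rowP => i; rewrite mxE.
have := sqr_ge0 (v 0 0); have := sqr_ge0 (v 0 1); have := sqr_ge0 (v 0 2).
rewrite !expr2 => h2 h1 h0; apply/eqP; rewrite -sqrf_eq0 expr2; apply/eqP.
by have [<-|[<-|<-]] := ord3_cases i; lra.
Qed.

Lemma dot_proj v K : dot (proj v K) K = 0.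
Proof.
rewrite /proj dotDl -scaleNr dotZl mulNr.
have [K0|K0] := eqVneq (dot K K) 0; last by rewrite divfK // subrr.
have -> : dot v K = 0.
  by rewrite (dot_sqr_eq0 K0) -(scale0r (0 : 'rV[R]_3)) dotZr mul0r.
by rewrite !mul0r subrr.
Qed.

(* [mode K K] is the gradient of a smooth function, which is orthogonal to H. *)
Lemma inner_mode_self k (u : field R) : H L u -> inner (mode (frv k) (frv k)) u = 0.
Proof.
move=> [Lu _ nu].
pose f x := - tprod (fun=> false) (frv k 0) x.
have sf : smooth f by apply: smoothN; exact: smooth_tprod.
rewrite -[RHS](nu f sf); apply: Ibox_eq => x _; apply: eq_bigr => i _.
rewrite mulrC; congr (_ * _); rewrite mxE.
have -> : f = (fun x => -1 * tprod (fun=> false) (frv k 0) x).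
  by apply/funext => y; rewrite mulN1r.
rewrite derive_scale_at; last exact: smooth_tprod.
rewrite derive_tprod_at mulN1r mulNr opprK; congr (_ * tprod _ _ _).
by apply/funext => l; rewrite /flip /ei; case: (l == i).
Qed.

Lemma innerD (u v w : field R) : (forall i, L2 (component u i)) ->
  (forall i, L2 (component v i)) -> (forall i, L2 (component w i)) ->
  inner (u + v) w = inner u w + inner v w.
Proof.
move=> Lu Lv Lw.
have Luv i : L2 (component (u + v)%R i) by rewrite componentD; exact: L2D.
rewrite (inner_sum_Ibox L_gt0 Luv Lw) (inner_sum_Ibox L_gt0 Lu Lw).
rewrite (inner_sum_Ibox L_gt0 Lv Lw) -big_split; apply: eq_bigr => i _ /=.
rewrite -(IboxD (L2_mul_integ (Lu i) (Lw i)) (L2_mul_integ (Lv i) (Lw i))).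
by apply: Ibox_eq => x _; rewrite componentD /= mulrDl.
Qed.

Lemma innerZ c (u w : field R) : (forall i, L2 (component u i)) ->
  (forall i, L2 (component w i)) -> inner (c *: u) w = c * inner u w.
Proof.
move=> Lu Lw.
have Lcu i : L2 (component (c *: u) i) by rewrite componentZ; exact: L2Z.
rewrite (inner_sum_Ibox L_gt0 Lcu Lw) (inner_sum_Ibox L_gt0 Lu Lw) mulr_sumr.
apply: eq_bigr => i _; rewrite -(IboxZ c (L2_mul_integ (Lu i) (Lw i))).
by apply: Ibox_eq => x _; rewrite componentZ /= mulrA.
Qed.

Lemma L2_mode v K i : L2 (component (mode v K) i).
Proof. exact: L2_smooth (smooth_mode v K i). Qed.

Lemma inner_mode_proj v k (u : field R) : V L u ->
  inner (mode v (frv k)) u = inner (mode (proj v (frv k)) (frv k)) u.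
Proof.
move=> Vu; have Lu i := V_L2 i Vu.
set c := dot v (frv k) / dot (frv k) (frv k).
have -> : v = proj v (frv k) + c *: frv k by rewrite /proj subrK.
rewrite [in LHS]modeD modeZ innerD; try exact: L2_mode; last first.
- exact: Lu.
- by move=> i; rewrite componentZ; apply: L2Z; exact: L2_mode.
rewrite innerZ; [|exact: L2_mode|exact: Lu].
by rewrite inner_mode_self ?mulr0 ?addr0 /proj ?subrK //; exact: Vu.1.
Qed.

Lemma inner_sum I (r : seq I) (F : I -> field R) (u : field R) :
  (forall a i, L2 (component (F a) i)) -> (forall i, L2 (component u i)) ->
  inner (\sum_(a <- r) F a) u = \sum_(a <- r) inner (F a) u.
Proof.
move=> LF Lu; elim: r => [|a r IH].
  rewrite !big_nil -(scale0r (0 : field R)) innerZ ?mul0r //.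
  by move=> i; apply: L2_eq (L2_cst L_gt0 0) => x _; rewrite /component mxE.
have Lr i : L2 (component (\sum_(b <- r) F b) i).
  elim: r {IH} => [|b r IH].
    by rewrite big_nil; apply: L2_eq (L2_cst L_gt0 0) => x _; rewrite /component mxE.
  by rewrite big_cons componentD; exact: L2D.
by rewrite !big_cons innerD // IH.
Qed.

(* The wave vectors [k + t m] of the interaction of two modes. *)
Definition shift k t m l : int := k l + sg t l * m l.

Lemma frv_shift k t m : frv (shift k t m) = frv k + sgv t (frv m).
Proof. by apply/rowP => l; rewrite !mxE /fr /shift intrD intrM; ring. Qed.

Definition interaction k w m z t : field R :=
  mode (proj (advect (frv k) w (sgv t (frv m)) (sgv t z)) (frv (shift k t m)))
    (frv (shift k t m)).

Definition interactions k w m z : field R := 8^-1 *: \sum_t interaction k w m z t.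

(** Tested against V, the gradient parts disappear, which replaces the amplitudes by their
    projections. *)
Lemma symB_modes k w m z (u : field R) : dot w (frv k) = 0 -> dot z (frv m) = 0 ->
  V L u ->
  symB L (mode z (frv m)) (mode w (frv k)) u = inner (interactions k w m z) u.
Proof.
move=> wk zm Vu; have Lu i := V_L2 i Vu.
have nw := nice_mode wk; have nz := nice_mode zm.
have -> : symB L (mode z (frv m)) (mode w (frv k)) u =
  B L (mode z (frv m)) (mode w (frv k)) u + B L (mode w (frv k)) (mode z (frv m)) u by [].
rewrite !B_convE //; try exact: smooth_mode.
have Lconv (v v' : 'rV[R]_3) K K' i : L2 (component (conv (mode v K) (mode v' K')) i).
  rewrite (_ : component _ _ = fun x => \sum_l component (mode v K) l x
      * 'D_(basis_vec l) (component (mode v' K') i) x); last first.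
    by apply/funext => x; rewrite /component mxE.
  apply: L2_sum => // l _; apply: L2_smooth => //.
  by apply: smoothM; [exact: smooth_mode|apply: smooth_derive; exact: smooth_mode].
rewrite -innerD //.
rewrite (_ : conv _ _ + conv _ _ =
    8^-1 *: \sum_t mode (advect (frv k) w (sgv t (frv m)) (sgv t z)) (frv (shift k t m))).
  have Li t i : L2 (component (interaction k w m z t) i) by exact: L2_mode.
  have Ls I (r : seq I) (F : I -> field R) :
      (forall a i, L2 (component (F a) i)) ->
      forall i, L2 (component (\sum_(a <- r) F a) i).
    move=> LF i; elim: r => [|b r IH].
      by rewrite big_nil; apply: L2_eq (L2_cst L_gt0 0) => x _; rewrite /component mxE.
    by rewrite big_cons componentD; exact: L2D.
  rewrite /interactions !innerZ //; try by apply: Ls => *; exact: L2_mode.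
  rewrite !inner_sum //; try by move=> *; exact: L2_mode.
  by congr (_ * _); apply: eq_bigr => t _; rewrite inner_mode_proj.
apply/funext => x; rewrite addrC; have := conv_modes x wk zm.
rewrite -[(conv _ _ + conv _ _) x]/(conv _ _ x + conv _ _ x) => ->.
rewrite -[RHS]/(8^-1 *: ((\sum_t _) x)); congr (_ *: _).
rewrite fct_sumE; apply: eq_bigr => t _.
by rewrite frv_shift.
Qed.

Lemma nice_sum I (r : seq I) (F : I -> field R) :
  (forall a, nice (F a)) -> nice (\sum_(a <- r) F a).
Proof.
move=> nF; elim: r => [|a r IH]; last by rewrite big_cons; exact: niceD.
have n0 : nice (mode 0 (frv (fun=> 0))) by apply: nice_mode; rewrite -(scale0r (0 : 'rV[R]_3)) dotZl mul0r.
by rewrite big_nil -[X in nice X](mode0 (frv (fun=> 0))).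
Qed.

Lemma nice_interactions k w m z : nice (interactions k w m z).
Proof.
apply: niceZ; apply: nice_sum => t.
by apply: nice_mode; exact: dot_proj.
Qed.

(** [B(a, a)] is half of the symmetrised product of [a] with itself. *)
Lemma B_mode_in_H k w : dot w (frv k) = 0 ->
  in_H L (B L (mode w (frv k)) (mode w (frv k))).
Proof.
move=> wk; exists (2^-1 *: interactions k w k w).
  apply: nice_H => //; apply: niceZ; exact: nice_interactions.
move=> u Vu; have Lu i := V_L2 i Vu.
rewrite innerZ //; last first.
  by move=> i; apply: L2_smooth => //; exact: nice_smooth (nice_interactions k w k w) i.
rewrite -symB_modes //.
set b := B L _ _; rewrite -[symB L _ _ u]/(b u + b u).
by field.
Qed.

End Modes.

(** * Saturation *)

Section Linspan.
Context {R : realType} {V : lmodType R}.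
Implicit Types (S T : set V) (u v : V).

Lemma linspanD S u v :
  linspan S u -> linspan S v -> linspan S (u + v).
Proof.
move=> [n [c [s [Ss ->]]]] [n' [c' [s' [Ss' ->]]]].
exists (n + n')%N, (fun i => match fintype.split i with inl a => c a | inr b => c' b end),
  (fun i => match fintype.split i with inl a => s a | inr b => s' b end); split.
  by move=> i; case: (fintype.split i).
rewrite big_split_ord /=; congr (_ + _); apply: eq_bigr => i _.
  by rewrite (unsplitK (inl _ i)).
by rewrite (unsplitK (inr _ i)).
Qed.

Lemma linspanZ S (a : R) u : linspan S u -> linspan S (a *: u).
Proof.
move=> [n [c [s [Ss ->]]]]; exists n, (fun i => a * c i), s; split=> //.
by rewrite scaler_sumr; apply: eq_bigr => i _; rewrite scalerA.
Qed.

Lemma linspan0 S : linspan S 0.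
Proof.
exists 0%N, (fun=> 0), (fun=> 0); split; first by case.
by rewrite big_ord0.
Qed.

Lemma linspan_sub S u : S u -> linspan S u.
Proof.
move=> Su; exists 1%N, (fun=> 1), (fun=> u); split=> //.
by rewrite big_ord1 scale1r.
Qed.

Lemma linspanS S T : S `<=` T -> linspan S `<=` linspan T.
Proof.
by move=> ST _ [n [c [s [Ss ->]]]]; exists n, c, s; split=> // i; apply: ST.
Qed.

End Linspan.

Section Saturation.
Context {R : realType} (L : 'I_3 -> R) (wf : nat -> ('I_3 -> nat) -> 'rV[R]_3).
Hypothesis L_gt0 : forall i, 0 < L i.
Hypothesis hw : admissible L wf.
Local Notation inner := (inner L).
Local Notation nice := (nice L).
Local Notation frv := (frv L).
Local Notation C := (Cset L wf).
Implicit Types (k m n : 'I_3 -> int) (i j l : 'I_3) (x : R * R * R).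
Implicit Types (v w z K M N : 'rV[R]_3).

Definition products (E : set (field R)) : set (functional R) :=
  [set l' | exists a b : field R,
     [/\ C a, E b, in_H L (B L a a), in_H L (B L b b) & l' = symB L a b]].

(* [FL] with [DA] replaced by the smaller space of fields satisfying [nice],
   which is clearly stable under addition. *)
Definition FLnice (E : set (field R)) : set (field R) :=
  [set u | exists e g : field R, [/\ E e, nice g, u = e + g &
     exists2 l : functional R, linspan (products E) l & eq_on_V L l (inner g)]].

Definition Gnice (j : nat) : set (field R) := iter j FLnice (linspan C).

Lemma Gnice_G (j : nat) : Gnice j `<=` G L C j.
Proof.
elim: j => [//|j IH] u [e [g [Ee ng -> [l ll lg]]]].
exists e, g; split=> //; [exact: IH|exact: nice_DA|exists l => //].
apply: linspanS ll => _ [a [b [Ca Eb Ha Hb ->]]]; exists a, b; split=> //.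
exact: IH.
Qed.

Lemma nice_L2 (u : field R) i : nice u -> L2 L (component u i).
Proof. by move=> nu; apply: L2_smooth => //; exact: nice_smooth nu i. Qed.

Lemma nice0 : nice (0 : field R).
Proof.
rewrite -(mode0 (frv (fun=> 0))); apply: nice_mode => //.
by rewrite -(scale0r (0 : 'rV[R]_3)) dotZl mul0r.
Qed.

Lemma GniceD (j : nat) (u v : field R) : Gnice j u -> Gnice j v -> Gnice j (u + v).
Proof.
elim: j u v => [|j IH] u v; first exact: linspanD.
move=> [e [g [Ee ng -> [l ll lg]]]] [e' [g' [Ee' ng' -> [l' ll' lg']]]].
exists (e + e'), (g + g'); split; [exact: IH|exact: niceD|exact: addrACA|].
exists (l + l'); first exact: linspanD.
move=> w Vw; rewrite innerD //; try by move=> i; exact: nice_L2.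
  by rewrite -lg // -lg'.
by move=> i; exact: V_L2.
Qed.

Lemma GniceZ (j : nat) a (u : field R) : Gnice j u -> Gnice j (a *: u).
Proof.
elim: j u => [|j IH] u; first exact: linspanZ.
move=> [e [g [Ee ng -> [l ll lg]]]].
exists (a *: e), (a *: g); split; [exact: IH|exact: niceZ|exact: scalerDr|].
exists (a *: l); first exact: linspanZ.
move=> w Vw; rewrite innerZ //; try by move=> i; exact: nice_L2.
  by rewrite -lg.
by move=> i; exact: V_L2.
Qed.

Lemma Gnice_succ (j : nat) (u : field R) : Gnice j u -> Gnice j.+1 u.
Proof.
move=> Gu; exists u, 0; split=> //; [exact: nice0|by rewrite addr0|].
exists 0; first exact: linspan0.
move=> w Vw; rewrite -(scale0r (0 : field R)) innerZ ?mul0r // => i.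
  exact: nice_L2 nice0.
exact: V_L2.
Qed.

Lemma Gnice0 (j : nat) : Gnice j 0.
Proof. by elim: j => [|j IH]; [exact: linspan0|exact: Gnice_succ]. Qed.

Lemma Gnice_le (j j' : nat) (u : field R) : (j <= j')%N -> Gnice j u -> Gnice j' u.
Proof.
move=> /subnKC <-; elim: (j' - j)%N => [|d IH] Gu; first by rewrite addn0.
by rewrite addnS; apply: Gnice_succ; exact: IH.
Qed.

Definition reach (u : field R) : Prop := exists j : nat, Gnice j u.

Lemma reachD (u v : field R) : reach u -> reach v -> reach (u + v).
Proof.
move=> [j Gu] [j' Gv]; exists (maxn j j'); apply: GniceD.
  exact: Gnice_le (leq_maxl _ _) Gu.
exact: Gnice_le (leq_maxr _ _) Gv.
Qed.

Lemma reachZ a (u : field R) : reach u -> reach (a *: u).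
Proof. by move=> [j Gu]; exists j; exact: GniceZ. Qed.

Lemma reach0 : reach 0.
Proof. by exists 0%N; exact: Gnice0. Qed.

Lemma reachB (u v : field R) : reach u -> reach v -> reach (u - v).
Proof. by move=> ru rv; apply: reachD => //; rewrite -scaleN1r; exact: reachZ. Qed.

Lemma reach_sum I (r : seq I) (P : pred I) (F : I -> field R) :
  (forall a, P a -> reach (F a)) -> reach (\sum_(a <- r | P a) F a).
Proof.
move=> rF; elim: r => [|a r IH]; first by rewrite big_nil; exact: reach0.
by rewrite big_cons; case: ifPn => // Pa; apply: reachD => //; exact: rF.
Qed.

Lemma reachZ_cancel (a : R) (u : field R) : a != 0 -> reach (a *: u) -> reach u.
Proof. by move=> a0 /(reachZ a^-1); rewrite scalerA mulVf // scale1r. Qed.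

Lemma Y_mode s (n : 'I_3 -> nat) : Y L wf s n = mode (wf s n) (frv (fun l => (n l)%:Z)).
Proof.
apply/funext => x; apply/rowP => i; rewrite !mxE; congr (_ * _).
apply: eq_bigr => l _; rewrite /trig /ei mxE /fr.
have -> : (n l)%:R * pi * xcoord l x / L l = (n l)%:Z%:~R * (pi / L l) * xcoord l x.
  by rewrite -pmulrn; ring.
by [].
Qed.

Lemma wf_perp s (n : 'I_3 -> nat) : (nzeros n <= 1)%N -> s \in js n ->
  [/\ wf s n != 0, dot (wf s n) (frv (fun l => (n l)%:Z)) = 0 &
      forall i, n i = 0%N -> wf s n 0 i = 0].
Proof.
move=> n1 sn; have [/(_ s sn)[w0 wn w00] _ _] := hw n1; split; [|  |exact: w00].
  (* In [perp], [z != 0] is an inequality of functions. *)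
  apply/eqP => wE; move/eqP: w0; apply; rewrite wE.
  by apply/funext => i; apply/funext => l; rewrite mxE.
transitivity (pi * \sum_i wf s n 0 i * (n i)%:R / L i).
  by rewrite mulr_sumr; apply: eq_bigr => i _; rewrite mxE /fr -pmulrn; ring.
by rewrite wn mulr0.
Qed.

Lemma Y_in_C s (n : 'I_3 -> nat) : (forall i, (n i <= 3)%N) -> (nzeros n <= 1)%N ->
  s \in js n -> C (mode (wf s n) (frv (fun l => (n l)%:Z))).
Proof. by move=> n3 n1 sn; exists n, s; split=> //; rewrite Y_mode. Qed.

Lemma reach_interactions_wf k w s (n : 'I_3 -> nat) : (forall i, (n i <= 3)%N) ->
  (nzeros n <= 1)%N -> s \in js n -> dot w (frv k) = 0 -> reach (mode w (frv k)) ->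
  reach (interactions L k w (fun l => (n l)%:Z) (wf s n)).
Proof.
move=> n3 n1 sn wk [j Gw]; have [_ wn _] := wf_perp n1 sn.
exists j.+1, 0, (interactions L k w (fun l => (n l)%:Z) (wf s n)); split.
- exact: Gnice0.
- exact: nice_interactions.
- by rewrite add0r.
exists (symB L (mode (wf s n) (frv (fun l => (n l)%:Z))) (mode w (frv k))).
  apply: linspan_sub; eexists; eexists; split; last by reflexivity.
  - exact: Y_in_C.
  - exact: Gw.
  - exact: B_mode_in_H.
  - exact: B_mode_in_H.
by move=> u Vu; exact: symB_modes.
Qed.

Lemma projD v w K : proj (v + w) K = proj v K + proj w K.
Proof. by rewrite /proj dotDl mulrDl scalerDl opprD addrACA. Qed.

Lemma projZ a v K : proj (a *: v) K = a *: proj v K.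
Proof. by rewrite /proj dotZl -mulrA -scalerA scalerBr. Qed.

Lemma proj_id v K : dot v K = 0 -> proj v K = v.
Proof. by rewrite /proj => ->; rewrite mul0r scale0r subr0. Qed.

Lemma proj_self K : proj K K = 0.
Proof.
rewrite /proj; have [K0|K0] := eqVneq (dot K K) 0; last by rewrite divff // scale1r subrr.
by rewrite (dot_sqr_eq0 K0) scaler0 subr0.
Qed.

Lemma sgvD t v w : sgv t (v + w) = sgv t v + sgv t w.
Proof. by apply/rowP => i; rewrite !mxE mulrDr. Qed.

Lemma sgvZ t a v : sgv t (a *: v) = a *: sgv t v.
Proof. by apply/rowP => i; rewrite !mxE mulrCA. Qed.

(** By linearity in [z], products with the members of [C] of a given wave vector yield those with
    all the amplitudes in their span. *)
Lemma interactions_linear k w m a z z' :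
  interactions L k w m (a *: z + z') =
  a *: interactions L k w m z + interactions L k w m z'.
Proof.
have aE t : interaction L k w m (a *: z + z') t =
    a *: interaction L k w m z t + interaction L k w m z' t.
  rewrite /interaction -modeZ -modeD -projZ -projD; congr (mode (proj _ _) _).
  rewrite /advect sgvD sgvZ dotDl dotZl; set c := dot w _; set d := dot _ _; set d' := dot _ _.
  by clearbody c d d'; apply/rowP => i; rewrite !mxE; ring.
rewrite /interactions; under eq_bigr do rewrite aE.
rewrite big_split /= -scaler_sumr scalerDr; congr (_ + _).
by rewrite !scalerA mulrC.
Qed.

Lemma orthogonal_decomp (a b c v : 'rV[R]_3) : a != 0 -> b != 0 -> c != 0 ->
  dot a b = 0 -> dot a c = 0 -> dot b c = 0 ->
  v = (dot v a / dot a a) *: a + (dot v b / dot b b) *: b + (dot v c / dot c c) *: c.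
Proof.
have nz u : u != 0 -> dot u u != 0 by apply: contra_neq => /dot_sqr_eq0.
move=> /nz a0 /nz b0 /nz c0 ab ac bc; apply/eqP; rewrite -subr_eq0; apply/eqP.
set r := v - _.
have ra : dot r a = 0.
  by rewrite /r dotDl -scaleN1r dotZl !dotDl !dotZl (dotC b a) (dotC c a) ab ac !mulr0 ?addr0 ?add0r
    divfK // mulN1r subrr.
have rb : dot r b = 0.
  by rewrite /r dotDl -scaleN1r dotZl !dotDl !dotZl (dotC c b) ab bc !mulr0 ?addr0 ?add0r
    divfK // mulN1r subrr.
have rc : dot r c = 0.
  by rewrite /r dotDl -scaleN1r dotZl !dotDl !dotZl ac bc !mulr0 ?addr0 ?add0r
    divfK // mulN1r subrr.
clearbody r.
(* The remainder [r] is orthogonal to three vectors whose determinant [D] is nonzero: [D^2] is their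
   Gram determinant, here the product of the squared lengths. *)
pose D := a 0 0 * (b 0 1 * c 0 2 - b 0 2 * c 0 1) - a 0 1 * (b 0 0 * c 0 2 - b 0 2 * c 0 0)
  + a 0 2 * (b 0 0 * c 0 1 - b 0 1 * c 0 0).
have D2 : D ^+ 2 = dot a a * (dot b b * dot c c - dot b c ^+ 2)
  - dot a b * (dot a b * dot c c - dot b c * dot a c)
  + dot a c * (dot a b * dot b c - dot b b * dot a c).
  by rewrite /D !dot_ord3; ring.
have D0 : D != 0.
  rewrite -sqrf_eq0 D2 ab ac bc expr0n !mul0r !subr0 addr0.
  by rewrite !mulf_eq0 !negb_or a0 b0.
have DE i : D * r 0 i = dot r a * (b 0 (i + 1) * c 0 (i + 2) - b 0 (i + 2) * c 0 (i + 1))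
  + dot r b * (c 0 (i + 1) * a 0 (i + 2) - c 0 (i + 2) * a 0 (i + 1))
  + dot r c * (a 0 (i + 1) * b 0 (i + 2) - a 0 (i + 2) * b 0 (i + 1)).
  rewrite /D !dot_ord3; clear.
  by have [<-|[<-|<-]] := ord3_cases i; rewrite !ord3D; ring.
apply/rowP => i; rewrite mxE; apply/eqP.
by have := DE i; rewrite ra rb rc !mul0r !addr0 => /eqP; rewrite mulf_eq0 (negbTE D0).
Qed.

Lemma nzerosE (n : 'I_3 -> nat) : nzeros n = ((n 0%R == 0) + (n 1%R == 0) + (n 2%R == 0))%N.
Proof.
rewrite /nzeros -sum1_card big_mkcond /= !big_ord_recl big_ord0 addn0 addnA.
have -> : lift ord0 (lift ord0 ord0) = 2 :> 'I_3 by exact: val_inj.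
have -> : lift ord0 ord0 = 1 :> 'I_3 by exact: val_inj.
by rewrite -!topredE /=; do 3!case: (n _ == _).
Qed.

Lemma frv_eq0 k i : (frv k 0 i == 0) = (k i == 0).
Proof.
have pL : pi / L i != 0 by rewrite gt_eqF // divr_gt0 // pi_gt0.
by rewrite mxE /fr mulf_eq0 intr_eq0 (negbTE pL) orbF.
Qed.

(** At most one component of [k] is nonzero, and orthogonality to the wave vector then makes the
    same component of [z] vanish. *)
Lemma perp_eq0 k z : (1 < nzeros (fun l => `|k l|%N))%N ->
  dot z (frv k) = 0 -> (forall i, k i = 0 -> z 0 i = 0) -> z = 0.
Proof.
move=> n2 zm z0.
have zi i : z 0 i * frv k 0 i = 0 -> z 0 i = 0.
  by move=> /eqP; rewrite mulf_eq0 frv_eq0 => /orP[/eqP //|/eqP]; exact: z0.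
apply/rowP => i; rewrite mxE; apply: zi.
move: zm n2; rewrite dot_ord3 nzerosE !absz_eq0.
have zz j : k j == 0 -> z 0 j * frv k 0 j = 0 by move=> /eqP/z0 ->; rewrite mul0r.
by have [<-|[<-|<-]] := ord3_cases i;
  case: (boolP (k 0 == 0)) => [/zz e0|_]; case: (boolP (k 1 == 0)) => [/zz e1|_];
  case: (boolP (k 2 == 0)) => [/zz e2|_] // zm _; lra.
Qed.

(** The family is completed to an orthogonal basis by the wave vector, and by the axis [i] if
    [n_i = 0]; [z] has no component along the added vectors. *)
Lemma wf_span z (n : 'I_3 -> nat) : (nzeros n <= 1)%N ->
  dot z (frv (fun l => (n l)%:Z)) = 0 -> (forall i, n i = 0%N -> z 0 i = 0) ->
  exists c : nat -> R, z = \sum_(s <- js n) c s *: wf s n.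
Proof.
move=> n1 zn z0; have [_ _ orth] := hw n1; set N := frv _ in zn.
have W := fun s (sn : s \in js n) => wf_perp n1 sn.
have N0 : N != 0.
  have [i ni] : exists i, n i != 0%N.
    move: n1; rewrite nzerosE; have [_|n0] := eqVneq (n 0) 0%N; last by exists 0.
    by have [_|n0] := eqVneq (n 1) 0%N; last by exists 1.
  apply: contra_neq ni => N0; apply/eqP; rewrite -eqz_nat.
  by rewrite -(frv_eq0 (fun l => (n l)%:Z)) -/N N0 mxE.
have [n0|n10] : nzeros n = 0%N \/ nzeros n = 1%N by case: (nzeros n) n1 => [|[|]]; auto.
  have jsE : js n = [:: 1; 2]%N by rewrite /js n0.
  have in1 : 1%N \in js n by rewrite jsE.
  have in2 : 2%N \in js n by rewrite jsE.
  have [w1 p1 _] := W _ in1; have [w2 p2 _] := W _ in2.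
  have o12 := orth _ _ in1 in2 isT.
  exists (fun s => dot z (wf s n) / dot (wf s n) (wf s n)).
  rewrite jsE big_cons big_seq1.
  rewrite {1}(orthogonal_decomp z w1 w2 N0 o12 p1 p2) zn mul0r scale0r addr0 //.
have jsE : js n = [:: 1]%N by rewrite /js n10.
have in1 : 1%N \in js n by rewrite jsE.
have [w1 p1 z1] := W _ in1.
have [i ni] : exists i, n i = 0%N.
  have : (0 < nzeros n)%N by rewrite n10.
  by rewrite /nzeros => /card_gt0P[i]; rewrite inE => /eqP; exists i.
pose e : 'rV[R]_3 := delta_mx 0 i.
have eE u : dot u e = u 0 i.
  rewrite /dot (bigD1 i) //= big1 ?addr0 ?mxE ?eqxx ?mulr1 // => l /negbTE li.
  by rewrite mxE li andbF mulr0.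
have e0 : e != 0.
  apply/eqP => /(congr1 (fun v : 'rV[R]_3 => v 0 i))/eqP.
  by rewrite !mxE !eqxx oner_eq0.
have Ne : dot N e = 0 by rewrite eE mxE /fr ni mul0r.
exists (fun s => dot z (wf s n) / dot (wf s n) (wf s n)).
rewrite jsE big_seq1.
have we : dot (wf 1 n) e = 0 by rewrite eE z1.
by rewrite {1}(orthogonal_decomp z w1 N0 e0 p1 we Ne) zn eE z0 // !mul0r !scale0r !addr0.
Qed.

Lemma interactions0 k w m : interactions L k w m 0 = 0.
Proof.
have := interactions_linear k w m (-1) 0 0.
by rewrite scaler0 addr0 scaleN1r addNr.
Qed.

Lemma reach_interactions k w m z : (forall i, 0 <= m i <= 3) ->
  dot z (frv m) = 0 -> (forall i, m i = 0 -> z 0 i = 0) ->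
  dot w (frv k) = 0 -> reach (mode w (frv k)) -> reach (interactions L k w m z).
Proof.
move=> m3 zm z0 wk rw.
pose n i := `|m i|%N.
have mE : m = fun i => (n i)%:Z.
  by apply/funext => i; have /andP[m0 _] := m3 i; rewrite /n gez0_abs.
have n3 i : (n i <= 3)%N by have := m3 i; rewrite mE lez_nat.
have zn i : n i = 0%N -> z 0 i = 0 by move=> ni; apply: z0; rewrite mE ni.
have [n1|n2] := leqP (nzeros n) 1.
  have [|c ->] := wf_span n1 _ zn; first by rewrite -mE.
  have : {subset js n <= js n} by [].
  elim: {1 3}(js n) => [|s r IH] sub.
    by rewrite big_nil interactions0; exact: reach0.
  rewrite big_cons interactions_linear; apply: reachD.
    rewrite {1}mE; apply: reachZ; apply: reach_interactions_wf => //.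
    by apply: sub; rewrite mem_head.
  by apply: IH => s' s'r; apply: sub; rewrite in_cons s'r orbT.
suff -> : z = 0 by rewrite interactions0; exact: reach0.
exact: perp_eq0 zm z0.
Qed.

(** * Tools for the induction on the wave vector *)

Definition reach_all n := forall v, dot v (frv n) = 0 -> reach (mode v (frv n)).

(** The weights [1/L_i] of the wave vector are left out, which makes this an integer, fit for
    induction. *)
Definition sqr_freq n : int := \sum_l n l ^+ 2.

Definition flips t n l : int := sg t l * n l.

(** Where [K_i = 0] the factor [sin 0] removes the [i]-th component, whatever the amplitude. *)
Lemma mode_ext v w K : (forall i, K 0 i != 0 -> v 0 i = w 0 i) -> mode v K = mode w K.
Proof.
move=> vw; apply/funext => x; apply/rowP => i; rewrite !mxE.
have [Ki|/vw -> //] := eqVneq (K 0 i) 0.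
by rewrite (tprodD1 _ _ i) /ei eqxx Ki /= mul0r sin0 mul0r !mulr0.
Qed.

(** The sine is odd and the cosine even, so simultaneous sign changes in amplitude and wave vector
    leave the field unchanged. *)
Lemma mode_sgv t v K : mode (sgv t v) (sgv t K) = mode v K.
Proof.
apply/funext => x; apply/rowP => i; rewrite !mxE /tprod (bigD1 i) //= [in RHS](bigD1 i) //=.
rewrite /ei eqxx !mxE mulrA [in RHS]mulrA; congr (_ * _).
  rewrite /trig -[in RHS](mul1r (v 0 i)) -(sg_sqr t i) /sg.
  by case: nth; rewrite ?(mulrNz, mulr1z, mulN1r, mul1r, mulrN, mulNr, sinN, opprK).
apply: eq_bigr => l /negbTE li; rewrite li mxE /trig /sg.
by case: nth; rewrite ?(mulrNz, mulr1z, mulN1r, mul1r, mulNr, cosN).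
Qed.

Lemma frv_flips t n : frv (flips t n) = sgv t (frv n).
Proof. by apply/rowP => l; rewrite !mxE /fr /flips intrM mulrA. Qed.

Lemma proj_sgv t v K : proj (sgv t v) (sgv t K) = sgv t (proj v K).
Proof. by rewrite /proj !dot_sgv -!scaleNr sgvD sgvZ. Qed.

Lemma advect_sgv t K w M z :
  advect (sgv t K) (sgv t w) (sgv t M) (sgv t z) = sgv t (advect K w M z).
Proof. by rewrite /advect -sgvD !dot_sgv sgvD !sgvZ. Qed.

Lemma sgvK t v : sgv t (sgv t v) = v.
Proof. by apply/rowP => l; rewrite !mxE mulrA sg_sqr mul1r. Qed.

Lemma reach_flips t n : reach_all n -> reach_all (flips t n).
Proof.
move=> Pn v vn; rewrite frv_flips -(sgvK t v) mode_sgv; apply: Pn.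
by rewrite -(sgvK t (frv n)) dot_sgv -frv_flips.
Qed.

Definition sgb (b : 'I_3 -> bool) := (b 0, b 1, b 2).

Lemma sg_sgb b l : sg (sgb b) l = if b l then -1 else 1.
Proof. by have [<-|[<-|<-]] := ord3_cases l. Qed.

Lemma reach_abs n : reach_all (fun l => `|n l|) -> reach_all n.
Proof.
move=> Pn; rewrite (_ : n = flips (sgb (fun l => n l < 0)) (fun l => `|n l|)).
  exact: reach_flips.
apply/funext => l; rewrite /flips sg_sgb; case: ltrP => nl.
  by rewrite ltr0_norm // mulN1r opprK.
by rewrite ger0_norm // mul1r.
Qed.

(* A sign [t] is good when [shift k t m] is [k + m] up to signs, in which case the
   interaction is the same as that of [k + m]. *)
Lemma interaction_good k w m z t :
  (forall i, m i = 0 -> z 0 i = 0) -> (forall i, k i = 0 -> m i != 0 -> w 0 i = 0) ->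
  (forall i, sg t i = -1 -> m i = 0 \/ k i = 0) ->
  interaction L k w m z t = mode (proj (advect (frv k) w (frv m) z) (frv k + frv m))
     (frv k + frv m).
Proof.
(* [t'] keeps the minus signs of [t] at which [m_i] is nonzero. There [k_i] and [w_i] vanish, so
   [t'] fixes [k] and [w], while it acts like [t] on [m] and [z]. *)
move=> z0 w0 good; pose t' := sgb (fun i => (sg t i == -1) && (m i != 0)).
have sgE i : sg t' i = sg t i \/ m i = 0 /\ sg t' i = 1.
  rewrite sg_sgb; have [->|] := eqVneq (m i) 0; first by rewrite andbF; right.
  by rewrite andbT /sg; left; case: nth.
have k0 i : sg t' i = 1 \/ k i = 0 /\ m i != 0.
  rewrite sg_sgb; case: ifP; last by left.
  by move=> /andP[/eqP/good [->|->] m0]; [rewrite eqxx in m0|right].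
have tM : sgv t (frv m) = sgv t' (frv m).
  by apply/rowP => i; rewrite !mxE /fr; have [->//|[-> _]] := sgE i; rewrite !(mul0r,mulr0).
have tz : sgv t z = sgv t' z.
  by apply/rowP => i; rewrite !mxE; have [->//|[/z0 -> _]] := sgE i; rewrite !mulr0.
have tK : frv k = sgv t' (frv k).
  apply/rowP => i; rewrite !mxE /fr; have [->|[-> _]] := k0 i; first by rewrite mul1r.
  by rewrite !(mul0r, mulr0).
have tw : w = sgv t' w.
  apply/rowP => i; rewrite !mxE; have [->|[ki mi]] := k0 i; first by rewrite mul1r.
  by rewrite w0 // mulr0.
rewrite /interaction frv_shift tM tz [in LHS]tK [in LHS]tw advect_sgv -sgvD.
by rewrite proj_sgv mode_sgv.
Qed.

(** The good signs all contribute the same field, and the others contribute reachable fields, which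
    can be subtracted. What remains is a nonzero multiple of the wanted field because the sign
    vector without minus signs is good. *)
Lemma reach_top k m w z :
  (forall i, 0 <= m i <= 3) -> dot z (frv m) = 0 -> (forall i, m i = 0 -> z 0 i = 0) ->
  reach_all k -> dot w (frv k) = 0 -> (forall i, k i = 0 -> m i != 0 -> w 0 i = 0) ->
  (forall t, reach_all (shift k t m) \/ forall i, sg t i = -1 -> m i = 0 \/ k i = 0) ->
  reach (mode (proj (advect (frv k) w (frv m) z) (frv k + frv m)) (frv k + frv m)).
Proof.
move=> m3 zm z0 Pk wk w0 sh; set X := mode _ _.
pose good t := [forall i, (sg t i == -1) ==> ((m i == 0) || (k i == 0))].
have goodP t : good t -> interaction L k w m z t = X.
  move=> /forallP gt; apply: interaction_good => // i /eqP si.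
  by have := gt i; rewrite si /= => /orP[] /eqP; auto.
have bad t : ~~ good t -> reach (interaction L k w m z t).
  move=> gt; have [Ps|g] := sh t; first by apply: Ps; exact: dot_proj.
  case/negP: gt; apply/forallP => i; apply/implyP => /eqP/g [->|->]; rewrite eqxx //.
  by rewrite orbT.
have : reach (interactions L k w m z) by apply: reach_interactions => //; exact: Pk.
rewrite /interactions => /(reachZ_cancel (invr_neq0 (lt0r_neq0 (ltr0n R 8)))).
move=> /reachB /(_ (reach_sum (index_enum _) bad)).
rewrite (bigID good) /=; rewrite addrK (eq_bigr (fun=> X)) // sumr_const -scaler_nat; apply: reachZ_cancel.
rewrite pnatr_eq0 -lt0n; apply/card_gt0P; exists (false, false, false).
by apply/forallP => i; have [<-|[<-|<-]] := ord3_cases i.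
Qed.

Lemma sqr_freq_shift k m t i : (forall l, 0 <= k l) -> (forall l, 0 <= m l) ->
  sg t i = -1 -> m i != 0 -> k i != 0 ->
  sqr_freq (shift k t m) < sqr_freq (fun l => k l + m l).
Proof.
move=> k0 m0 ti mi ki; rewrite /sqr_freq (bigD1 i) //= [ltRHS](bigD1 i) //=.
apply: ltr_leD.
  by rewrite /shift ti; have := k0 i; have := m0 i; nia.
apply: ler_sum => l _; rewrite /shift /sg; have := k0 l; have := m0 l.
by case: nth; nia.
Qed.

Lemma frvD k m : frv k + frv m = frv (fun l => k l + m l).
Proof. by apply/rowP => l; rewrite !mxE /fr intrD -mulrDl. Qed.

(** A minus sign at an index where [k_i] and [m_i] are both positive shortens the wave vector; sign
    vectors without such an index are good. *)
Lemma reach_top_below n k m w z :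
  (forall n', sqr_freq n' < sqr_freq n -> reach_all n') ->
  n = (fun l => k l + m l) -> (forall l, 0 <= k l) -> (exists l, m l != 0) ->
  (forall i, 0 <= m i <= 3) -> dot z (frv m) = 0 -> (forall i, m i = 0 -> z 0 i = 0) ->
  dot w (frv k) = 0 -> (forall i, k i = 0 -> m i != 0 -> w 0 i = 0) ->
  reach (mode (proj (advect (frv k) w (frv m) z) (frv n)) (frv n)).
Proof.
move=> IH nE k0 [i0 mi0] m3 zm z0 wk w0.
have m0 l : 0 <= m l by have /andP[] := m3 l.
rewrite nE -frvD; apply: reach_top => //.
  apply: IH; rewrite nE /sqr_freq (bigD1 i0) //= [ltRHS](bigD1 i0) //=; apply: ltr_leD.
    by have := k0 i0; have := m0 i0; move: mi0; nia.
  by apply: ler_sum => l _; have := k0 l; have := m0 l; nia.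
move=> t; case: (pselect (exists2 i, sg t i = -1 & m i != 0 /\ k i != 0)).
  by move=> [i ti [mi ki]]; left; apply: IH; rewrite nE; exact: sqr_freq_shift ti mi ki.
move=> h; right=> i ti; have [|mi] := eqVneq (m i) 0; [by left|right].
by apply/eqP/negPn/negP => ki; apply: h; exists i.
Qed.

(** One has to solve [(w . N) z + (z . N) w = v] modulo [N], subject to [w . K = 0]. This is
    possible for every [v] orthogonal to [N] once [z . N] is nonzero and [M] and [K] differ in
    length. *)
Lemma reach_caseA n k m z :
  (forall n', sqr_freq n' < sqr_freq n -> reach_all n') ->
  n = (fun l => k l + m l) -> (forall l, 0 <= k l) -> (exists l, m l != 0) ->
  (forall i, 0 <= m i <= 3) -> dot z (frv m) = 0 -> (forall i, m i = 0 -> z 0 i = 0) ->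
  (forall i, k i = 0 -> m i = 0) ->
  dot z (frv n) != 0 -> dot (frv m) (frv m) < dot (frv k) (frv k) -> reach_all n.
Proof.
move=> IH nE k0 m1 m3 zm z0 km c0 mk v vn.
have NE : frv n = frv k + frv m by rewrite nE frvD.
have : 0 < dot (frv n) (frv n).
  rewrite lt_def dot_ord3 -!expr2 !addr_ge0 ?sqr_ge0 // andbT -dot_ord3.
  by apply: contra_neq c0 => /dot_sqr_eq0 ->; rewrite -(scale0r (0 : 'rV[R]_3)) dotZr mul0r.
set N := frv n in vn c0 NE *; set K := frv k in mk NE; set M := frv m in zm mk NE.
move=> /lt0r_neq0 N0.
pose c := dot z N; pose d := dot M M - dot K K.
have d0 : d != 0 by rewrite subr_eq0 lt_eqF.
(* The value of [w . N]. It is forced by [w . K = 0], as [2 N . K - N . N = - d]; the multiple of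
   [N] in the next line is the one that makes [w . N] equal to [s]. *)
pose s := dot v K * dot N N / (c * d).
pose w := c^-1 *: (v - s *: z + (2 * s * c / dot N N) *: N).
have zK : dot z K = c by rewrite /c NE dotDr zm addr0.
have wk : dot w K = 0.
  rewrite dotZl !dotDl -scaleNr !dotZl zK.
  have dE : 2 * dot N K - dot N N = - d.
    by rewrite NE /d !dotDl !dotDr (dotC M K); ring.
  have -> : dot N K = (dot N N - d) / 2 by rewrite -[d]opprK -dE; field.
  by rewrite /s; field; rewrite N0 c0 d0.
have := reach_top_below IH nE k0 m1 m3 zm z0 wk.
rewrite -/N -/K -/M /advect -NE -/c.
have -> : dot w N = s.
  rewrite dotZl !dotDl -scaleNr !dotZl vn -/c divfK //.
  by move: (s) => r; field.
rewrite /w scalerA divff // scale1r addrA addrCA subrr addr0.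
rewrite projD projZ proj_self scaler0 addr0 proj_id //; by apply=> i /km ->.
Qed.

(** * The induction step, with a large component along the axis [a] *)

Section Permuted_axes.
Variables (a b c : 'I_3).
Hypotheses (ab : a != b) (ac : a != c) (bc : b != c).

Lemma ord3_axes l : [\/ l = a, l = b | l = c].
Proof.
have [->|la] := eqVneq l a; first by constructor.
have [->|lb] := eqVneq l b; first by constructor.
have [->|lc] := eqVneq l c; first by constructor.
have : uniq [:: l; a; b; c] by rewrite /= !inE !negb_or la lb lc ab ac bc.
by move=> /card_uniqP E; have := max_card [in [:: l; a; b; c]]; rewrite E card_ord.
Qed.

Lemma sum_axes (V : nmodType) (F : 'I_3 -> V) : \sum_l F l = F a + F b + F c.
Proof.
rewrite (bigD1 a) //= (bigD1 b) //= 1?eq_sym // (bigD1 c) /=.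
  rewrite big1 ?addr0 ?addrA // => l; have [->|->|->] := ord3_axes l;
  by rewrite ?eqxx ?andbF.
by rewrite !(eq_sym c) ac bc.
Qed.

Definition vec (V : Type) (x y z : V) l : V := if l == a then x else if l == b then y else z.

Lemma vec_a (V : Type) (x y z : V) : vec x y z a = x.
Proof. by rewrite /vec eqxx. Qed.

Lemma vec_b (V : Type) (x y z : V) : vec x y z b = y.
Proof. by rewrite /vec eq_sym (negbTE ab) eqxx. Qed.

Lemma vec_c (V : Type) (x y z : V) : vec x y z c = z.
Proof. by rewrite /vec !(eq_sym c) (negbTE ac) (negbTE bc). Qed.

Definition vecE V := (@vec_a V, @vec_b V, @vec_c V).

Lemma all_axes (P : 'I_3 -> Prop) : P a -> P b -> P c -> forall l, P l.
Proof. by move=> Pa Pb Pc l; have [->|->|->] := ord3_axes l. Qed.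

Definition rvec (x y z : R) : 'rV[R]_3 := \row_l vec x y z l.

Lemma dot_axes v w : dot v w = v 0 a * w 0 a + v 0 b * w 0 b + v 0 c * w 0 c.
Proof. by rewrite /dot sum_axes. Qed.

Lemma frv_axes (x y z : int) : frv (vec x y z) =
  pi *: rvec (x%:~R / L a) (y%:~R / L b) (z%:~R / L c).
Proof.
apply/rowP; apply: all_axes; rewrite !mxE /fr !vecE; ring.
Qed.

Definition det3 (u v w : 'rV[R]_3) : R :=
  u 0 a * (v 0 b * w 0 c - v 0 c * w 0 b)
  - u 0 b * (v 0 a * w 0 c - v 0 c * w 0 a)
  + u 0 c * (v 0 a * w 0 b - v 0 b * w 0 a).

Lemma reach_all_span n v1 v2 : det3 v1 v2 (frv n) != 0 ->
  reach (mode (proj v1 (frv n)) (frv n)) -> reach (mode (proj v2 (frv n)) (frv n)) ->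
  reach_all n.
Proof.
set N := frv n => D0 r1 r2 v vN; apply: (reachZ_cancel D0); rewrite -modeZ.
(* Cramer's rule *)
have -> : det3 v1 v2 N *: v =
    det3 v v2 N *: proj v1 N + det3 v1 v N *: proj v2 N.
  rewrite -[v in LHS](proj_id vN) -/N -!projZ -projD -[RHS]addr0.
  have <- : det3 v1 v2 v *: proj N N = 0 by rewrite proj_self scaler0.
  rewrite -projZ -projD.
  by clearbody N; congr (proj _ N); apply/rowP; apply: all_axes; rewrite !mxE /det3; ring.
by rewrite modeD !modeZ; apply: reachD; apply: reachZ.
Qed.

Lemma vec_eta n : n = vec (n a) (n b) (n c).
Proof. by apply/funext; apply: all_axes; rewrite !vecE. Qed.

Let L_neq0 l : L l != 0. Proof. exact: lt0r_neq0. Qed.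

Let pi_neq0 : pi != 0 :> R. Proof. exact: lt0r_neq0 (pi_gt0 R). Qed.

(** The comparison is made coordinate by coordinate, so that it holds for all lengths [L]. *)
Lemma dot_frv_lt k m i : (forall l, m l ^+ 2 <= k l ^+ 2) -> m i ^+ 2 < k i ^+ 2 ->
  dot (frv m) (frv m) < dot (frv k) (frv k).
Proof.
move=> mk mki; rewrite /dot (bigD1 i) //= [ltRHS](bigD1 i) //=.
have E n l : frv n 0 l * frv n 0 l = (n l ^+ 2)%:~R * (pi / L l) ^+ 2.
  by rewrite mxE /fr rmorphXn /= -expr2 exprMn.
have p l : 0 < (pi / L l) ^+ 2 by rewrite exprn_gt0 // divr_gt0 // pi_gt0.
apply: ltr_leD; first by rewrite !E ltr_pM2r // ltr_int.
by apply: ler_sum => l _; rewrite !E ler_pM2r // ler_int.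
Qed.

Lemma reach_large n : (forall n', sqr_freq n' < sqr_freq n -> reach_all n') ->
  (forall l, 0 <= n l) -> 4 <= n a -> 2 <= n b -> reach_all n.
Proof.
(* For the [z] below, [z . N] is [pi (n_a - s n_b)]. Thus [s = 1] works unless [n_a = n_b], and then
   [s = 2] does. *)
move=> IH n0 na nb; pose s : int := if n a == n b then 2 else 1.
have s12 : 1 <= s <= 2 by rewrite /s; case: ifP.
pose m := vec s 1 0; pose k l := n l - m l.
have km : n = (fun l => k l + m l) by apply/funext => l; rewrite subrK.
have nc := n0 c.
have k0 : forall l, 0 <= k l by apply: all_axes; rewrite /k /m !vecE; lia.
pose z := rvec (L a) (- s%:~R * L b) 0.
apply: (reach_caseA (k := k) (m := m) (z := z)) => //.
- by exists b; rewrite /m vecE.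
- by apply: all_axes; rewrite /m !vecE //; lia.
- by rewrite /m frv_axes dotZr dot_axes !mxE !vecE; field; rewrite !L_neq0.
- by apply: all_axes; rewrite /m /z !mxE !vecE //; lia.
- by apply: all_axes; rewrite /k /m !vecE //; lia.
- rewrite [n in frv n]vec_eta frv_axes dotZr dot_axes !mxE !vecE.
  rewrite mulf_neq0 //.
  have -> : L a * ((n a)%:~R / L a) + - s%:~R * L b * ((n b)%:~R / L b)
      + 0 * ((n c)%:~R / L c) = (n a - s * n b)%:~R.
    by rewrite intrB intrM; field; rewrite !L_neq0.
  by rewrite intr_eq0; move: na nb; rewrite /s; have [->|ne] := eqVneq (n a) (n b); lia.
- have ka : s ^+ 2 <= (n a - s) ^+ 2 by nia.
  have kb : 1 ^+ 2 <= (n b - 1) ^+ 2 by nia.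
  have kl : forall l, m l ^+ 2 <= k l ^+ 2.
    by apply: all_axes; rewrite /k /m !vecE //; nia.
  (* If [n_a = n_b = 4], the entries of [k] and [m] along [a] are both 2; strictness then comes from
     [b]. *)
  have [E|E] := eqVneq (n a) (n b).
    by apply: (dot_frv_lt (i := b)) => //; rewrite /k /m !vecE; nia.
  apply: (dot_frv_lt (i := a)) => //; rewrite /k /m !vecE /s (negbTE E); nia.
Qed.

Section Thin.
Variable N : int.
Hypothesis N4 : 4 <= N.
(** A hypothesis on a region instead of on [sqr_freq]: [reach_flat] uses [reach_thin] for
    [(N, 1, 2)], which is longer than the vector [(N, 1, 0)] under induction. *)
Hypothesis IH : forall n, `|n a| < N -> `|n b| <= 1 -> `|n c| <= 2 -> reach_all n.

(** From [(N, 1, p) = (N - s, 1, 0) + (s, 0, p)]. Since [k_c = 0] and [m_b = 0], the entries [w_c]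
    and [z_b] must vanish, which determines [w] and [z] up to factors. The coefficients are
    [w . N = pi s] and [z . N = pi p (N - s)]. *)
Lemma reach_thin_step (p s : int) : 1 <= p <= 2 -> 1 <= s <= 2 ->
  reach (mode (proj (rvec (p%:~R * N%:~R * L a) (- (p%:~R * (N - s)%:~R ^+ 2 * L b))
    (- (s%:~R ^+ 2 * L c))) (frv (vec N 1 p))) (frv (vec N 1 p))).
Proof.
move=> p12 s12; set v := rvec _ _ _.
pose m := vec s 0 p; pose k := vec (N - s) 1 0.
pose z := rvec (p%:~R * L a) 0 (- s%:~R * L c).
pose w := rvec (L a) (- (N - s)%:~R * L b) 0.
have := @reach_top k m w z.
have kmE : frv k + frv m = frv (vec N 1 p).
  rewrite frvD; congr frv; apply/funext.
  by apply: all_axes; rewrite /k /m !vecE ?subrK ?addr0 ?add0r.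
have -> : advect (frv k) w (frv m) z = pi *: v.
  rewrite /advect kmE !frv_axes !dotZr !dot_axes.
  by apply/rowP; apply: all_axes; rewrite !mxE !vecE ?intrB; field; rewrite !L_neq0.
rewrite kmE projZ modeZ => H; apply: (reachZ_cancel pi_neq0); apply: H.
- by apply: all_axes; rewrite /m !vecE //; lia.
- by rewrite frv_axes dotZr dot_axes !mxE !vecE; field; rewrite !L_neq0.
- by apply: all_axes; rewrite /m !mxE !vecE //; lia.
- by apply: IH; rewrite /k !vecE //; lia.
- by rewrite frv_axes dotZr dot_axes !mxE !vecE; field; rewrite !L_neq0.
- by apply: all_axes; rewrite /m /k !mxE !vecE //; lia.
(* A minus sign along [a] gives the entry [N - 2 s], smaller than [N] in absolute value. Otherwise
   the minus signs sit at zeros of [m] or [k]. *)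
move=> t; have [ta|ta] := eqVneq (sg t a) 1.
  by right; apply: all_axes; rewrite /m /k ?ta !vecE; [|left|right].
left; apply: IH; rewrite /shift /k /m !vecE.
- by move: ta; rewrite /sg; case: nth => // _; lia.
- by rewrite mulr0 addr0.
- by rewrite /sg; case: nth; lia.
Qed.

Lemma reach_thin (p : int) : 1 <= p <= 2 -> reach_all (vec N 1 p).
Proof.
move=> p12; apply: reach_all_span (reach_thin_step p12 (s := 1) isT)
  (reach_thin_step p12 (s := 2) isT).
rewrite frv_axes /det3 !mxE !vecE.
set x := L a; set y := L b; set t := L c.
pose q : R := p%:~R; pose r : R := N%:~R.
have q1 : 1 <= q by rewrite ler1z; lia.
have r4 : 4 <= r by rewrite -[4]/(4%:~R) ler_int.
have x0 : 0 < x by exact: L_gt0. have y0 : 0 < y by exact: L_gt0. have t0 : 0 < t by exact: L_gt0.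
rewrite !intrB -/q -/r.
set D := (X in X != 0).
(* The amplitudes for [s = 1] and [s = 2] are independent modulo the wave vector for all side
   lengths, because each of these three terms is positive. *)
have -> : D = pi * (q * y * t / x * (4 * (r - 1) ^+ 2 - (r - 2) ^+ 2) * r
   + 3 * q * r * x * t / y + q ^+ 3 * r * x * y / t * ((r - 1) ^+ 2 - (r - 2) ^+ 2)).
  by rewrite /D; field; rewrite !lt0r_neq0.
rewrite mulf_neq0 // lt0r_neq0 //.
have q0 : 0 < q by lra.
have r0 : 0 < r by lra.
apply: addr_gt0; first apply: addr_gt0.
- by rewrite !mulr_gt0 ?invr_gt0 //; nra.
- by rewrite !mulr_gt0 ?invr_gt0.
- by rewrite !mulr_gt0 ?invr_gt0 ?exprn_gt0 //; nra.
Qed.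

(** With [0 <= m <= n] and [m_a < N], either [k] or [m] would have two zero entries and carry no
    mode; hence the negative entry of [k]. One amplitude suffices: as [n_c = 0], the amplitude
    [(0, 0, 1)] gives the zero field and completes the span. *)
Lemma reach_flat : reach_all (vec N 1 0).
Proof.
pose n := vec N 1 0.
pose m : 'I_3 -> int := vec 1 0 1; pose k := vec (N - 1) 1 (- 1).
pose z := rvec (L a) 0 (- L c).
pose w := rvec (L a) (- (N - 1)%:~R * L b) 0.
pose v := rvec ((1 + N)%:~R * L a) (- (N * (N - 1))%:~R * L b) (- L c).
have kmE : frv k + frv m = frv n.
  rewrite frvD; congr frv; apply/funext.
  by apply: all_axes; rewrite /k /m /n !vecE ?subrK ?addr0 ?addNr.
have r1 : reach (mode (proj v (frv n)) (frv n)).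
  have := @reach_top k m w z.
  have -> : advect (frv k) w (frv m) z = pi *: v.
    rewrite /advect kmE !frv_axes !dotZr !dot_axes.
    apply/rowP; apply: all_axes; rewrite !mxE !vecE ?intrB ?intrM ?intrD ?intrB; field;
    by rewrite !L_neq0.
  rewrite kmE projZ modeZ => H; apply: (reachZ_cancel pi_neq0); apply: H.
  - by apply: all_axes; rewrite /m !vecE.
  - by rewrite frv_axes dotZr dot_axes !mxE !vecE; field; rewrite !L_neq0.
  - by apply: all_axes; rewrite /m !mxE !vecE.
  - by apply: IH; rewrite /k !vecE //; lia.
  - by rewrite frv_axes dotZr dot_axes !mxE !vecE; field; rewrite !L_neq0.
  - by apply: all_axes; rewrite /m /k !mxE !vecE //; lia.
  move=> t; have [ta|ta] := eqVneq (sg t a) 1; last first.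
    left; apply: IH; rewrite /shift /k /m !vecE.
    - by move: ta; rewrite /sg; case: nth => // _; lia.
    - by rewrite mulr0 addr0.
    - by rewrite /sg; case: nth; lia.
  have [tc|tc] := eqVneq (sg t c) 1.
    by right; apply: all_axes; rewrite /m /k ?ta ?tc !vecE; [|left|].
  left; apply: reach_abs; rewrite (_ : (fun l => _) = vec N 1 2); first exact: reach_thin.
  apply/funext; apply: all_axes; rewrite /shift /k /m !vecE ?ta.
  - by lia.
  - by rewrite mulr0 addr0.
  - by move: tc; rewrite /sg; case: nth.
pose e := rvec 0 0 1.
have r2 : reach (mode (proj e (frv n)) (frv n)).
  rewrite proj_id; last by rewrite dot_axes !mxE /fr /n !vecE; ring.
  rewrite (@mode_ext _ 0) ?mode0; first exact: reach0.
  by apply: all_axes; rewrite !mxE /fr /n !vecE // mul0r eqxx.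
apply: reach_all_span r1 r2.
rewrite frv_axes /det3 !mxE !vecE.
set x := L a; set y := L b; pose r : R := N%:~R.
have r4 : 4 <= r by rewrite -[4]/(4%:~R) ler_int.
have x0 : 0 < x by exact: L_gt0. have y0 : 0 < y by exact: L_gt0.
rewrite intrM !intrD intrN -/r.
set D := (X in X != 0).
have -> : D = - (pi * ((1 + r) * x / y + r ^+ 2 * (r - 1) * y / x)).
  by rewrite /D; field; rewrite !lt0r_neq0.
rewrite oppr_eq0 mulf_neq0 // lt0r_neq0 //.
have r0 : 0 < r by lra.
by apply: addr_gt0; rewrite !mulr_gt0 ?invr_gt0 ?exprn_gt0 //; lra.
Qed.

End Thin.

End Permuted_axes.

(** Entries at the zeros of [n] do not affect the field, so they may be set to 0, as [wf_span]
    requires. *)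
Lemma reach_all_support n : (forall v, dot v (frv n) = 0 ->
  (forall i, n i = 0 -> v 0 i = 0) -> reach (mode v (frv n))) -> reach_all n.
Proof.
move=> Pn v vn; pose u : 'rV[R]_3 := \row_l (if n l == 0 then 0 else v 0 l).
have -> : mode v (frv n) = mode u (frv n).
  by apply: mode_ext => i; rewrite frv_eq0 mxE => /negbTE ->.
apply: Pn => [|i ni]; last by rewrite mxE ni eqxx.
rewrite -vn; apply: eq_bigr => l _; rewrite !mxE /fr.
by case: eqP => // ->; rewrite !mul0r mulr0.
Qed.

Lemma reach_two_zeros n : (1 < nzeros (fun l => `|n l|%N))%N -> reach_all n.
Proof.
move=> n2; apply: reach_all_support => v vn v0.
by rewrite (perp_eq0 n2 vn v0) mode0; exact: reach0.
Qed.

Lemma reach_small n : (forall l, 0 <= n l <= 3) -> reach_all n.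
Proof.
move=> n3; have [n1|] := leqP (nzeros (fun l => `|n l|%N)) 1; last exact: reach_two_zeros.
apply: reach_all_support => u un u0.
have nE : n = fun l => `|n l|%N%:Z.
  by apply/funext => l; rewrite gez0_abs //; have /andP[] := n3 l.
rewrite nE in un *.
have [|c ->] := wf_span n1 un.
  by move=> i ni; apply: u0; apply/eqP; rewrite -absz_eq0 ni.
have : {subset js (fun l => `|n l|%N) <= js (fun l => `|n l|%N)} by [].
elim: {1 3}(js _) => [|s r IH] sub; first by rewrite big_nil mode0; exact: reach0.
rewrite big_cons modeD modeZ; apply: reachD; last first.
  by apply: IH => s' s'r; apply: sub; rewrite in_cons s'r orbT.
apply: reachZ; exists 0%N; apply: linspan_sub; apply: Y_in_C => //.
  by move=> i; have := n3 i; lia.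
by apply: sub; rewrite mem_head.
Qed.

Lemma reach_all_freq n : reach_all n.
Proof.
have [d nd] : exists d : nat, sqr_freq n < d%:Z.
  by exists `|sqr_freq n|.+1; lia.
elim: d n nd => [|d IHd] n nd.
  by move: nd; rewrite ltNge sumr_ge0 // => i _; exact: sqr_ge0.
apply: reach_abs; set n' : 'I_3 -> int := fun l => _.
have IH n'' : sqr_freq n'' < sqr_freq n' -> reach_all n''.
  move=> lt; apply: IHd; suff : sqr_freq n = sqr_freq n' by lia.
    by apply: eq_bigr => l _; rewrite real_normK // num_real.
have n0 l : 0 <= n' l by exact: normr_ge0.
clearbody n'; clear n nd IHd; move: n' IH n0 => n IH n0.
case: (pselect (exists a, 4 <= n a)) => [[a na]|small]; last first.
  apply: reach_small => l; rewrite n0 /= leNgt; apply/negP => nl; apply: small.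
  by exists l; lia.
have a12 : [/\ a != a + 1, a != a + 2 & a + 1 != a + 2] by move: a {na}; apply: ord3P.
case: a12; move: (a + 1) (a + 2) => b c ab ac bc.
have ca : c != a by rewrite eq_sym.
have cb : c != b by rewrite eq_sym.
have [nb|nb] := lerP 2 (n b); first exact: (reach_large ab ac bc).
have [nc|nc] := lerP 2 (n c); first exact: (reach_large ac ab cb).
(* The region of the thin cases lies below [n] because [(n_a - 1)^2 + 1 + 4 < n_a^2] for
   [n_a >= 4]. *)
have IHs (b' c' : 'I_3) : a != b' -> a != c' -> b' != c' ->
   forall n', `|n' a| < n a -> `|n' b'| <= 1 -> `|n' c'| <= 2 -> reach_all n'.
  move=> ab' ac' bc' n' na' nb' nc'; apply: IH.
  rewrite /sqr_freq !(sum_axes ab' ac' bc').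
  have := sqr_ge0 (n b'); have := sqr_ge0 (n c').
  have : n' b' ^+ 2 <= 1 by nia.
  have : n' c' ^+ 2 <= 4 by nia.
  have : n' a ^+ 2 <= (n a - 1) ^+ 2 by nia.
  by rewrite sqrrB1; lia.
have [nb1|nb0] := eqVneq (n b) 1; have [nc1|nc0] := eqVneq (n c) 1.
- rewrite (vec_eta ab ac bc n) nb1 nc1; exact: (reach_thin ab ac bc na (IHs _ _ ab ac bc)).
- rewrite (vec_eta ab ac bc n) nb1 (_ : n c = 0); last by have := n0 c; lia.
  exact: (reach_flat ab ac bc na (IHs _ _ ab ac bc)).
- rewrite (vec_eta ac ab cb n) nc1 (_ : n b = 0); last by have := n0 b; lia.
  exact: (reach_flat ac ab cb na (IHs _ _ ac ab cb)).
have {}nb0 : n b = 0 by have := n0 b; lia.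
have {}nc0 : n c = 0 by have := n0 c; lia.
apply: reach_two_zeros; rewrite /nzeros.
apply: (@leq_trans #|[set b; c]%SET|); first by rewrite cards2 bc.
apply: subset_leq_card.
by apply/fintype.subsetP => l; rewrite !inE => /orP[]/eqP ->; rewrite ?nb0 ?nc0.
Qed.

(** * The fields of [C] are eigenfunctions *)

(** The product of the two functions contains a sine in [x_j], so its derivative integrates to 0;
    that derivative is a nonzero multiple of the difference of the two squares. *)
Lemma Ibox_sqr_tprod_flip k b j : k j != 0 ->
  Ibox L (fun x => tprod (flip j b) (frv k 0) x ^+ 2) =
  Ibox L (fun x => tprod b (frv k 0) x ^+ 2).
Proof.
move=> kj; set w := frv k 0; set T := tprod b w; set T' := tprod (flip j b) w.
have sT : smooth T by exact: smooth_tprod.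
have sT' : smooth T' by exact: smooth_tprod.
have flipK : flip j (flip j b) = b.
  by apply/funext => l; rewrite /flip; case: eqP => // _; rewrite negbK.
have : Ibox L ('D_(basis_vec j) (T \* T')) = 0.
  apply: (Ibox_derive_eq0 L_gt0 (smoothM sT sT')) => x xj; rewrite /= /T /T'.
  have [bj|bj] := boolP (b j); first by rewrite (tprod_face L_gt0 k bj xj) mul0r.
  by rewrite (@tprod_face _ _ L_gt0 (flip j b) k j x) ?mulr0 // /flip eqxx.
pose s : R := if b j then w j else - w j.
rewrite (@Ibox_eq _ L _ (fun x => s * (T' x ^+ 2 - T x ^+ 2))); last first.
  move=> x _; rewrite derive_mul_at // !derive_tprod_at flipK /s /flip eqxx -/T -/T'.
  by case: (b j) => /=; ring.
have iT : integ L (fun x => T x ^+ 2) by apply: L2_sqr_integ; exact: L2_smooth.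
have iT' : integ L (fun x => T' x ^+ 2) by apply: L2_sqr_integ; exact: L2_smooth.
rewrite IboxZ; last exact: (integD iT' (integN iT)).
rewrite (IboxD iT' (integN iT)) IboxN // => /eqP; rewrite mulf_eq0 subr_eq0.
suff /negbTE -> : s != 0 by move/eqP.
by rewrite /s; case: (b j); rewrite ?oppr_eq0 frv_eq0.
Qed.

(** The squares of the eight products of all parities add up to 1. If this integral vanished,
    flipping factors one by one would make all eight vanish. *)
Lemma Ibox_sqr_tprod_gt0 k i : k i != 0 ->
  0 < Ibox L (fun x => tprod (ei i) (frv k 0) x ^+ 2).
Proof.
move=> ki; set w := frv k 0; pose T b := Ibox L (fun x => tprod b w x ^+ 2).
have T_ge0 b : 0 <= T b by apply: Ibox_ge0 => x _; exact: sqr_ge0.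
rewrite lt_def T_ge0 andbT; apply/eqP => T0.
(* If [k_j = 0], the flip replaces a cosine by the sine of 0. *)
have flip0 b j : T b = 0 -> b j = false -> T (flip j b) = 0.
  move=> Tb bj; have [kj|kj] := eqVneq (k j) 0; last by rewrite -Tb; exact: Ibox_sqr_tprod_flip.
  apply: (Ibox0 L_gt0) => x _; rewrite (tprodD1 _ _ j) /flip eqxx bj /=.
  have -> : w j = 0 by apply/eqP; rewrite frv_eq0 kj.
  by rewrite mul0r sin0 mul0r expr0n.
have Tc : T (fun=> false) = 0.
  by rewrite -T0 /T -(flip_ei_same i); exact: Ibox_sqr_tprod_flip.
pose bt (t : bool * bool * bool) (l : 'I_3) := nth false [:: t.1.1; t.1.2; t.2] l.
have T_bt t : T (bt t) = 0.
  have E (b b' : 'I_3 -> bool) : b 0 = b' 0 -> b 1 = b' 1 -> b 2 = b' 2 -> b = b'.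
    by move=> e0 e1 e2; apply/funext; apply: ord3P.
  have H0 (p : bool) b j : T b = 0 -> b j = false -> T (if p then flip j b else b) = 0.
    by case: p => // Tb bj; exact: flip0.
  have := H0 t.2 _ 2 (H0 t.1.2 _ 1 (H0 t.1.1 _ 0 Tc erefl) _) _.
  move=> <-; first (congr T; apply: E); by case: t => [[[] []] []].
have : Ibox L (cst 1) = 0.
  rewrite (@Ibox_eq _ L _ (fun x => \sum_t tprod (bt t) w x ^+ 2)).
    rewrite (Ibox_sum L_gt0); first by rewrite big1 // => t _; exact: T_bt.
    by move=> t _; apply: L2_sqr_integ; apply: (L2_smooth L_gt0); exact: smooth_tprod.
  move=> x _; rewrite sum_bool3 /tprod !prod_ord3 /bt /trig /= /cst.
  have c (y : R) : cos y ^+ 2 = 1 - sin y ^+ 2 by rewrite -(cos2Dsin2 y); ring.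
  by rewrite !exprMn !c; ring.
rewrite (Ibox_cst L_gt0) mul1r => /eqP; rewrite !mulf_eq0.
by rewrite !(negbTE (lt0r_neq0 (L_gt0 _))).
Qed.

Lemma L2_inner_integ (u : field R) : (forall i, L2 L (component u i)) ->
  integ L (fun x => dot (u x) (u x)).
Proof.
move=> Lu; apply: integ_sum => i _; exact: L2_mul_integ (Lu i) (Lu i).
Qed.

Lemma L2normE (u : field R) : (forall i, L2 L (component u i)) ->
  L2norm L u = (Num.sqrt (inner u u))%:E.
Proof. by move=> Lu; rewrite /L2norm integral_Ibox //; exact: L2_inner_integ. Qed.

Lemma L2norm_mode_neq0 k v i : k i != 0 -> v 0 i != 0 -> L2norm L (mode v (frv k)) != 0%E.
Proof.
move=> ki vi; have Lm := L2_mode L_gt0 v (frv k).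
rewrite L2normE //; apply/eqP => -[] /eqP; rewrite sqrtr_eq0 leNgt => /negP; apply.
rewrite (inner_sum_Ibox L_gt0 Lm Lm) (bigD1 i) //=.
apply: ltr_wpDr.
  by apply: sumr_ge0 => l _; apply: Ibox_ge0 => x _; rewrite /= -expr2 sqr_ge0.
rewrite component_mode (@Ibox_eq _ L _ (fun x => v 0 i ^+ 2 * tprod (ei i) (frv k 0) x ^+ 2)).
  rewrite IboxZ; first by rewrite mulr_gt0 ?Ibox_sqr_tprod_gt0 // exprn_even_gt0.
  by apply: L2_sqr_integ; apply: (L2_smooth L_gt0); exact: smooth_tprod.
by move=> x _; rewrite /= -expr2 exprMn.
Qed.

Lemma C_nice y : C y -> nice y.
Proof.
move=> [n [s [_ n1 sn ->]]]; rewrite Y_mode; apply: nice_mode => //.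
by have [] := wf_perp n1 sn.
Qed.

Lemma C_eigenfunction (nu : R) y : C y -> eigenfunction L nu y.
Proof.
move=> Cy; split; first by apply: nice_DA => //; exact: C_nice.
  move: Cy => [n [s [_ n1 sn ->]]]; rewrite Y_mode.
  have [w0 _ w00] := wf_perp n1 sn.
  have [i wi] : exists i, wf s n 0 i != 0.
    apply/existsP; apply: contraNT w0; rewrite negb_exists => /forallP H.
    by apply/eqP/rowP => i; rewrite mxE; apply/eqP; have := H i; rewrite negbK.
  apply: (L2norm_mode_neq0 (i := i)) => //.
  by apply: contra_neq wi => /eqP; rewrite eqz_nat => /eqP/w00.
have ny := C_nice Cy; move: Cy => [n [s [_ n1 sn yE]]].
rewrite Y_mode in yE; have [_ wn _] := wf_perp n1 sn.
set K := frv _ in yE wn.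
exists (nu * dot K K) => w Vw.
rewrite /stokes (inner_curl_curl L_gt0 ny Vw) {1}yE ccurl_ccurl_mode // -yE.
rewrite innerZ ?mulrA // => i; first exact: nice_L2.
exact: V_L2.
Qed.

Lemma finite_C : finite_set C.
Proof.
apply: (@sub_finite_set _ _ [set Y L wf (p.2 : 'I_3) (fun i => (p.1 i : 'I_4) : nat)
   | p in [set: {ffun 'I_3 -> 'I_4} * 'I_3]]); last first.
  by apply: finite_image; exact: finite_finset.
move=> _ [n [s [n3 n1 sn ->]]].
have s3 : (s < 3)%N.
  by move: sn; rewrite /js mem_undup !inE => /orP[]/eqP ->; rewrite ?ltnS ?leq_subr.
exists ([ffun i => inord (n i)], Ordinal s3) => //=; congr (Y L wf s _).
by apply/funext => i; rewrite ffunE inordK ?ltnS ?n3.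
Qed.

(** * Density in H *)

Lemma innerC (u v : field R) : inner u v = inner v u.
Proof. by rewrite !innerE; apply: Ibox_eq => x _; apply: eq_bigr => i _; rewrite mulrC. Qed.

Lemma reach_nice (u : field R) : reach u -> nice u.
Proof.
move=> [j]; elim: j u => [|j IH] u.
  move=> [n [c [s [Cs ->]]]]; apply: nice_sum => // i; apply: niceZ; exact: C_nice.
by move=> [e [g [/IH ne ng -> _]]]; exact: niceD.
Qed.

(* Orthogonal splittings into a reachable field and a gradient. *)
Definition splits (P : field R) := exists p g : field R,
  [/\ P = p + g, reach p, forall i, L2 L (component g i) &
      forall u, H L u -> inner g u = 0].

Lemma splitsD P Q : splits P -> splits Q -> splits (P + Q).
Proof.
move=> [p [g [-> rp Lg gH]]] [q [h [-> rq Lh hH]]].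
exists (p + q), (g + h); split; [exact: addrACA|exact: reachD| |].
  by move=> i; rewrite componentD; exact: L2D.
by move=> u Hu; have [Lu _ _] := Hu; rewrite innerD // gH // hH // addr0.
Qed.

Lemma splits_mode v k : splits (mode v (frv k)).
Proof.
set K := frv k; set c := dot v K / dot K K.
exists (mode (proj v K) K), (c *: mode K K); split.
- by rewrite -modeZ -modeD /proj subrK.
- by apply: reach_all_freq; exact: dot_proj.
- by move=> i; rewrite componentZ; apply: L2Z; exact: L2_mode.
- move=> u Hu; have [Lu _ _] := Hu; rewrite innerZ ?inner_mode_self ?mulr0 //.
  exact: L2_mode.
Qed.

Lemma splits0 : splits 0.
Proof. by rewrite -(mode0 (frv (fun=> 0))); exact: splits_mode. Qed.

Lemma splits_sum I (r : seq I) (F : I -> field R) :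
  (forall a, splits (F a)) -> splits (\sum_(a <- r) F a).
Proof.
move=> sF; elim: r => [|a r IH]; first by rewrite big_nil; exact: splits0.
by rewrite big_cons; exact: splitsD.
Qed.

Lemma component_sum I (r : seq I) (F : I -> field R) i x :
  component (\sum_(a <- r) F a) i x = \sum_(a <- r) component (F a) i x.
Proof. by rewrite /component fct_sumE summxE. Qed.

(** Each component is expanded separately, into modes whose amplitude is along one axis; these are
    not divergence free in general. *)
Lemma trigspan_splits (p : 'I_3 -> R * R * R -> R) : (forall i, trigspan L i (p i)) ->
  exists2 P, splits P & forall i, component P i = p i.
Proof.
move=> /choice[r pE].
pose F i a := mode (a.1 *: delta_mx 0 i) (frv a.2).
exists (\sum_i \sum_(a <- r i) F i a).
  by apply: splits_sum => i; apply: splits_sum => a; exact: splits_mode.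
move=> i; apply/funext => x; rewrite component_sum (bigD1 i) //= [X in _ + X]big1 => [|j ji].
  rewrite addr0 component_sum pE; apply: eq_bigr => a _.
  rewrite component_mode !mxE !eqxx mulr1; congr (_ * tprod _ _ _).
  by apply/funext => l; rewrite mxE.
rewrite component_sum big1 // => a _.
by rewrite component_mode !mxE eq_sym (negbTE ji) andbF mulr0 mul0r.
Qed.

Lemma pythagoras (u g : field R) : (forall i, L2 L (component u i)) ->
  (forall i, L2 L (component g i)) -> inner g u = 0 ->
  inner u u <= inner (u - g) (u - g).
Proof.
move=> Lu Lg gu; rewrite -scaleN1r.
have LNg i : L2 L (component (-1 *: g) i) by rewrite componentZ; exact: L2Z.
have LB i : L2 L (component (u + -1 *: g) i) by rewrite componentD; exact: L2D.
rewrite innerD // innerZ // !(innerC _ (u + _)) !innerD // !innerZ //.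
rewrite (innerC u) gu.
have : 0 <= inner g g.
  by rewrite innerE; apply: Ibox_ge0 => x _; apply: sumr_ge0 => i _; rewrite -expr2 sqr_ge0.
lra.
Qed.

Lemma dense_reach : dense_in_H L reach.
Proof.
move=> u Hu eps eps0; have [Lu _ _] := Hu.
(* A third of [eps^2] for each of the three components. *)
have e0 : 0 < eps ^+ 2 / 3 by rewrite divr_gt0 // exprn_gt0.
have /choice[p pP] : forall i, exists p, trigspan L i p /\
    sqdist L (component u i) p < eps ^+ 2 / 3.
  by move=> i; have [_ /(_ _ e0)[p]] := trigspan_dense L_gt0 i (Lu i); exists p.
have [P [q [g [PE rq Lg gH]]] Pp] := trigspan_splits (fun i => (pP i).1).
exists q => //.
have nq := reach_nice rq; have Hq := nice_H L_gt0 nq.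
have Lq i : L2 L (component q i) by exact: nice_L2.
have LNq i : L2 L (component (-1 *: q) i) by rewrite componentZ; exact: L2Z.
have Luq i : L2 L (component (u - q) i) by rewrite -scaleN1r componentD; exact: L2D.
have guq : inner g (u - q) = 0.
  by rewrite innerC -scaleN1r innerD // innerZ // !(innerC _ g) !gH // mulr0 addr0.
rewrite L2normE // lte_fin.
apply: (@le_lt_trans _ _ (Num.sqrt (inner (u - q - g) (u - q - g)))).
  by rewrite ler_wsqrtr // pythagoras.
have -> : u - q - g = u - P by rewrite PE opprD addrA.
have LP i : L2 L (component P i).
  by rewrite Pp; apply: (L2_smooth L_gt0); exact: smooth_trigspan (pP i).1.
have LB i : L2 L (component (u - P) i).
  by rewrite -scaleN1r componentD componentZ; apply: L2D => //; exact: L2Z.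
rewrite (inner_sum_Ibox L_gt0 LB LB).
have E i : Ibox L (component (u - P) i \* component (u - P) i) =
    sqdist L (component u i) (p i).
  apply: Ibox_eq => x _; rewrite -Pp expr2 /= -scaleN1r componentD componentZ /=.
  by rewrite mulN1r.
have eE : eps = Num.sqrt (eps ^+ 2) by rewrite sqrtr_sqr gtr0_norm.
rewrite [ltRHS]eE ltr_sqrt ?exprn_gt0 //.
have -> : eps ^+ 2 = \sum_(i < 3) eps ^+ 2 / 3 by rewrite sum_ord3; field.
apply: ltr_sum => [|i _]; first by apply/hasP; exists 0 => //; rewrite mem_index_enum.
by rewrite E; exact: (pP i).2.
Qed.

End Saturation.

Theorem theorem3p1 (R : realType) (nu : R) (L : 'I_3 -> R)
    (wf : nat -> ('I_3 -> nat) -> 'rV[R]_3) (hnu : 0 < nu)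
    (hL : forall i, 0 < L i) (hw : admissible L wf) :
  (forall y, Cset L wf y -> eigenfunction L nu y) /\
  saturating L (Cset L wf).
Proof.
split; first by move=> y; exact: C_eigenfunction.
split; first exact: finite_C.
  by move=> y Cy; apply: nice_DA => //; exact: C_nice hw _ Cy.
move=> u Hu eps eps0; have [v [j rv] uv] := dense_reach hL hw Hu eps0.
by exists v => //; exists j => //; exact: Gnice_G rv.
Qed.
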